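(* Let $I$ be any ($\mathbb{Z}^r$-homogeneous) $B$-saturated ideal in $S$ and let $\mathbf{c}\in\bigcap_{i=1}^{n}(\mathbf{a}_i+\mathcal{K})$. If $m$ is the Gotzmann number of the multigraded Hilbert polynomial $P_{S/I}(\mathbf{t})$, then $$\bigcap_{\sigma\subseteq[n],\ \widehat{\sigma}\in\Delta}\bigl((m-1)\mathbf{c}+\operatorname{reg}(S_\sigma)\bigr)\subseteq\operatorname{reg}(S/I).$$
   Context: Setting. $X$ is a smooth projective toric variety of dimension $d$ over a field $\Bbbk$ determined by a fan $\Delta$ in $\mathbb{R}^d$. The rays of the fan are numbered $1,\dots,n$, with minimal lattice generators $\mathbf{b}_1,\dots,\mathbf{b}_n$ (spanning $\mathbb{R}^d$), and $\Delta$ is identified with a simplicial complex on $[n]=\{1,\dots,n\}$ ($\sigma\in\Delta$ iff the rays indexed by $\sigma$ span a cone of the fan). Put $r=n-d$ and fix an integer $r\times n$ matrix $A=[\mathbf{a}_1\cdots\mathbf{a}_n]$ such that $0\to\mathbb{Z}^d\xrightarrow{[\mathbf{b}_1\cdots\mathbf{b}_n]^{T}}\mathbb{Z}^n\xrightarrow{A}\mathbb{Z}^r\to0$ is exact. $S=\Bbbk[x_1,\dots,x_n]$ is $\mathbb{Z}^r$-graded by $\deg(x_i)=\mathbf{a}_i$, so $\deg(\mathbf{x}^{\mathbf{u}})=A\mathbf{u}$. The irrelevant ideal is $B=\langle\prod_{i\notin\sigma}x_i:\sigma\in\Delta\rangle$. For $\sigma\subseteq[n]$, $\widehat\sigma=[n]\setminus\sigma$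 and $\mathbb{N}A_\sigma$ is the semigroup generated by $\{\mathbf{a}_i:i\in\sigma\}$. Let $\mathcal{K}=\bigcap_{\sigma\in\Delta}\mathbb{N}A_{\widehat\sigma}$ (the lattice points of an $r$-dimensional pointed cone $\mathcal{K}\otimes\mathbb{R}$ in $\mathbb{R}^r$), with unique minimal Hilbert basis (minimal generating set as a semigroup) $\mathbf{c}_1,\dots,\mathbf{c}_e$. An ideal $I$ is $B$-saturated if $(I:B^\infty)=I$. For $\sigma\subseteq[n]$, $S_\sigma=\Bbbk[x_i:i\in\sigma]$, regarded as the $S$-module $S/\langle x_i:i\notin\sigma\rangle$. Multigraded regularity. A finitely generated $\mathbb{Z}^r$-graded $S$-module $M$ is $\mathbf{k}$-regular ($\mathbf{k}\in\mathbb{Z}^r$) if: (1) $H^i_B(M)_{\mathbf{p}}=0$ for all $i\ge1$ and all $\mathbf{p}\in\bigcup(\mathbf{k}-\lambda_1\mathbf{c}_1-\dots-\lambda_e\mathbf{c}_e+\mathcal{K})$, the union over all $\lambda_1,\dots,\lambda_e\in\mathbb{N}$ with $\lambda_1+\dots+\lambda_e=i-1$; and (2) $H^0_B(M)_{\mathbf{p}}=0$ for all $\mathbf{p}\in\bigcup_{1\le j\le e}(\mathbf{k}+\mathbf{c}_j+\mathcal{K})$. Here $H^i_B$ is local cohomology. $\operatorname{reg}(M)=\{\mathbf{k}\in\mathbb{Z}^r: M\text{ is }\mathbf{k}\text{-regular}\}$. Hilbert polynomial. $P_M(\mathbf{t})\in\mathbb{Q}[t_1,\dots,t_r]$ is the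 unique polynomial with $P_M(\mathbf{t})=\dim_\Bbbk M_{\mathbf{t}}$ for all $\mathbf{t}$ in some finite intersection of translates of $\mathcal{K}$. Gotzmann number. Fix a unimodular change of coordinates $\phi\in GL_r(\mathbb{Z})$ such that the positive orthant $\mathbb{R}^r_{\ge0}$ lies inside $\phi(\mathcal{K}\otimes\mathbb{R})$ (such $\phi$ exists), and for a polynomial $Q$ write $Q^\phi(\mathbf{t})=Q(\phi^{-1}(\mathbf{t}))$. Fix a monomial order $<$ on $\mathbb{Q}[t_1,\dots,t_r]$ refining the order by total degree, and write $\operatorname{in}_<$ for the leading monomial. It induces a partial order on $\Delta$: $\widehat\sigma<\widehat\tau$ iff $\operatorname{in}_<(P_{S_\tau}^\phi)<\operatorname{in}_<(P_{S_\sigma}^\phi)$. This order refines inclusion. Fix a total order $\prec$ on $\Delta$ refining this partial order. For a polynomial $P$, consider all finite sequences of pairs $(\mathbf{x}^{\mathbf{v}_1},\tau_1),\dots,(\mathbf{x}^{\mathbf{v}_k},\tau_k)$, where $\mathbf{x}^{\mathbf{v}_i}$ is a monomial of $S$ and $\widehat\tau_i\in\Delta$, such that, putting $Q_0=P$ and $Q_i(\mathbf{t})=Q_{i-1}(\mathbf{t})-P_{S_{\tau_i}}(\mathbf{t}-A\mathbf{v}_i)$: - $\mathbf{x}^{\mathbf{v}_1}=1$; - for each $i>1$ there is $j<i$ with $\widehat\tau_j\preceq\widehat\tau_i$ and $\mathbf{x}^{\mathbf{v}_i}=\mathbf{x}^{\mathbf{v}_j}x_\ell$ for some $\ell\notin\tau_j$;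 - $\operatorname{in}_<(Q_{i-1}^\phi)=\operatorname{in}_<(P_{S_{\tau_i}}^\phi)$ for each $i$; - for each $i<k$, $Q_i\neq0$ and the leading coefficient of $Q_i^\phi$ with respect to $<$ is positive; and $Q_k=0$. There are only finitely many such sequences. The Gotzmann number of $P$ (relative to the fixed choices) is the largest number of pairs in a set $\{(\mathbf{x}^{\mathbf{v}_i},\tau_i):1\le i\le k\}$ arising from such a sequence (it is $0$ when $P=0$). The theorem holds for any fixed choice of $\phi$, $<$ and $\prec$. *)

(* Defs.v *)
From HB Require Import structures.
From mathcomp Require Import all_boot all_order all_algebra.
From mathcomp Require Import boolp reals.
From mathcomp Require Import mpoly.

Set Implicit Arguments.
Unset Strict Implicit.
Unset Printing Implicit Defensive.

Import Order.TTheory GRing.Theory Num.Theory.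
Local Open Scope ring_scope.
Local Open Scope quotient_scope.

Section QuotientModule.
Variables (R : pzRingType) (V : lmodType R) (N : submodClosed V).

(* The library's submodClosed does not inherit from zmodClosed, hence this
   copy of N, on which the closure under subtraction is declared. *)
Definition submod_pred : {pred V} := fun x => x \in N.

Fact submod_pred_zmod : zmod_closed submod_pred.
Proof.
split=> [|x y Nx Ny]; first exact: (rpred0 N).
by rewrite unfold_in rpredD // -scaleN1r rpredZ.
Qed.
HB.instance Definition _ := GRing.isZmodClosed.Build V submod_pred submod_pred_zmod.

Definition quot_mod : Type := Quotient.quot submod_pred.
HB.instance Definition _ := GRing.Zmodule.on quot_mod.

Definition quot_pi (x : V) : quot_mod := \pi_(Quotient.quot submod_pred) x.

Lemma quot_piP x y : quot_pi x = quot_pi y <-> x - y \in N.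
Proof.
rewrite -[x - y \in N]/(x - y \in submod_pred) Quotient.idealrBE.
by split=> [xy|/eqP//]; apply/eqP.
Qed.

Lemma quot_piB : {morph quot_pi : x y / x - y}.
Proof. exact: raddfB. Qed.

Lemma quot_piD : {morph quot_pi : x y / x + y}.
Proof. exact: raddfD. Qed.

Lemma quot_pi_surj m : exists x, m = quot_pi x.
Proof. by exists (repr m); rewrite /quot_pi reprK. Qed.

Definition quot_scale (a : R) (m : quot_mod) : quot_mod :=
  quot_pi (a *: repr (m : Quotient.quot submod_pred)).

Lemma quot_scaleE a x : quot_scale a (quot_pi x) = quot_pi (a *: x).
Proof.
apply/quot_piP; rewrite -scalerBr rpredZ //; apply/quot_piP.
by rewrite /quot_pi reprK.
Qed.

Fact quot_scaleA a b m : quot_scale a (quot_scale b m) = quot_scale (a * b) m.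
Proof. by case: (quot_pi_surj m) => x ->; rewrite !quot_scaleE scalerA. Qed.

Fact quot_scale1 : left_id 1 quot_scale.
Proof. by move=> m; case: (quot_pi_surj m) => x ->; rewrite quot_scaleE scale1r. Qed.

Fact quot_scaleDr : right_distributive quot_scale +%R.
Proof.
move=> a m m'; case: (quot_pi_surj m) => x ->; case: (quot_pi_surj m') => y ->.
by rewrite -quot_piD !quot_scaleE scalerDr quot_piD.
Qed.

Fact quot_scaleDl m : {morph quot_scale^~ m : a b / a + b}.
Proof.
move=> a b; case: (quot_pi_surj m) => x ->.
by rewrite !quot_scaleE scalerDl quot_piD.
Qed.

HB.instance Definition _ := GRing.Zmodule_isLmodule.Build R quot_mod
  quot_scaleA quot_scale1 quot_scaleDr quot_scaleDl.

End QuotientModule.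

(* Ideals are the submodules of S over itself, the unit ideal included. *)
Notation ideal k n := (submodClosed {mpoly k[n]}^o).

Section Ideals.
Variables (k : fieldType) (n : nat).
Local Notation S := {mpoly k[n]}.

Definition ideal_gen (G : S -> Prop) : {pred S^o} := fun f : S =>
  `[< exists s : seq (S * S),
        (forall x, x \in s -> G x.2) /\ f = \sum_(x <- s) x.1 * x.2 >].

Fact ideal_gen_submod (G : S -> Prop) : subsemimod_closed (ideal_gen G).
Proof.
split; first split.
- by apply/asboolP; exists [::]; rewrite big_nil.
- move=> f g /asboolP[s [sG ->]] /asboolP[t [tG ->]]; apply/asboolP.
  exists (s ++ t); split; last by rewrite big_cat.
  by move=> x; rewrite mem_cat => /orP[/sG|/tG].
- move=> a f /asboolP[s [sG ->]]; apply/asboolP.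
  exists [seq (a * x.1, x.2) | x <- s]; split.
    by move=> x /mapP[y ys ->]; exact: (sG y ys).
  rewrite big_map [LHS]mulr_sumr; apply: eq_bigr => x _ /=.
  by rewrite mulrA.
Qed.
HB.instance Definition _ (G : S -> Prop) :=
  GRing.isSubSemiModClosed.Build S S^o (ideal_gen G) (@ideal_gen_submod G).

Definition ideal_pow (J : ideal k n) (N : nat) : ideal k n :=
  ideal_gen (fun f => exists h : 'I_N -> S,
    (forall i, h i \in J) /\ f = \prod_(i < N) h i).

Definition colon_infty (I J : ideal k n) (f : S) : Prop :=
  exists N : nat, forall g : S, g \in ideal_pow J N -> f * g \in I.

Definition saturated (J I : ideal k n) : Prop :=
  forall f : S, colon_infty I J f <-> f \in I.

(* S_sigma = S / (x_i : i notin sigma) is the quotient by this ideal. *)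
Definition coord_ideal (sigma : {set 'I_n}) : ideal k n :=
  ideal_gen (fun f => exists2 i : 'I_n, i \notin sigma & f = 'X_i).

Definition face_gen (sigma : {set 'I_n}) : S := \prod_(i in ~: sigma) 'X_i.

Definition irrelevant_ideal (Delta : {set {set 'I_n}}) : ideal k n :=
  ideal_gen (fun f => exists2 sigma, sigma \in Delta & f = face_gen sigma).

End Ideals.

Section Grading.
Variables (k : fieldType) (n r : nat) (A : 'M[int]_(r, n)).
Local Notation S := {mpoly k[n]}.

Definition mon_deg (u : 'X_{1..n}) : 'cV[int]_r := A *m \col_i (u i)%:Z.

Definition homogeneous (p : 'cV[int]_r) (f : S) : Prop :=
  forall u, u \in msupp f -> mon_deg u = p.

Definition homog_part (p : 'cV[int]_r) (f : S) : S :=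
  \sum_(u <- msupp f | mon_deg u == p) f@_u *: 'X_[u].

Definition homog_ideal (I : ideal k n) : Prop :=
  forall (f : S) p, f \in I -> homog_part p f \in I.

(* Degree p part of the module S/I. *)
Definition quot_grading (I : ideal k n) (p : 'cV[int]_r) (m : quot_mod I) : Prop :=
  exists2 f : S, homogeneous p f & m = quot_pi I f.

End Grading.

(* M is an S-module and G p its part of degree p.  An element x/f^a of the
   localization M_f is represented by the pair (x, a), equality in M_f being
   frac_eq f.  Local cohomology is the cohomology of the Cech complex on a
   finite family of generators g of the ideal: its term in cohomological degree
   i is the sum over the i-subsets J of the localizations of M at the product
   of the g j, j in J, so that the term for i = 0 is M itself. *)
Section LocalCohomology.
Variables (k : fieldType) (n r : nat) (A : 'M[int]_(r, n)).
Local Notation S := {mpoly k[n]}.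
Variables (M : lmodType S) (G : 'cV[int]_r -> M -> Prop).

Definition frac : Type := (M * nat)%type.

Definition frac_eq (f : S) (u v : frac) : Prop :=
  exists l : nat, f ^+ l *: (f ^+ v.2 *: u.1 - f ^+ u.2 *: v.1) = 0.

Definition frac0 : frac := (0, 0%N).

Definition frac_add (f : S) (u v : frac) : frac :=
  (f ^+ v.2 *: u.1 + f ^+ u.2 *: v.1, (u.2 + v.2)%N).

Definition frac_scale (s : S) (u : frac) : frac := (s *: u.1, u.2).

(* The map M_f -> M_(h f), x/f^a |-> (h^a x)/(h f)^a. *)
Definition frac_res (h : S) (u : frac) : frac := (h ^+ u.2 *: u.1, u.2).

Definition frac_homog (f : S) (p : 'cV[int]_r) (u : frac) : Prop :=
  exists (v : frac) (q : 'cV[int]_r),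
    [/\ frac_eq f u v, homogeneous A q f & G (p + q *+ v.2) v.1].

Variables (N : nat) (g : 'I_N -> S).

Definition cech_loc (J : {set 'I_N}) : S := \prod_(j in J) g j.

Definition cech_d (c : {set 'I_N} -> frac) (J : {set 'I_N}) : frac :=
  \big[frac_add (cech_loc J) / frac0]_(j in J)
    frac_scale ((-1) ^+ #|[set j' in J | (j' < j)%N]|)
               (frac_res (g j) (c (J :\ j))).

Definition cech_cohomology_vanishes (i : nat) (p : 'cV[int]_r) : Prop :=
  forall c : {set 'I_N} -> frac,
    (forall J : {set 'I_N}, #|J| = i -> frac_homog (cech_loc J) p (c J)) ->
    (forall J : {set 'I_N}, #|J| = i.+1 -> frac_eq (cech_loc J) (cech_d c J) frac0) ->
    exists b : {set 'I_N} -> frac,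
      (forall J : {set 'I_N}, #|J|.+1 = i -> frac_homog (cech_loc J) p (b J)) /\
      (forall J : {set 'I_N}, #|J| = i -> frac_eq (cech_loc J) (c J) (cech_d b J)).

End LocalCohomology.

(* H^i_B(M)_p = 0, for B generated by the monomials face_gen sigma. *)
Definition HB_vanishes (k : fieldType) (n r : nat) (A : 'M[int]_(r, n))
    (Delta : {set {set 'I_n}}) (M : lmodType {mpoly k[n]})
    (G : 'cV[int]_r -> M -> Prop) (i : nat) (p : 'cV[int]_r) : Prop :=
  cech_cohomology_vanishes A G
    (fun j : 'I_#|Delta| => face_gen k (enum_val j)) i p.

(* b has the ray generators b_1, ..., b_n as its rows, so that b *m _ is the
   map [b_1 ... b_n]^T from Z^d to Z^n. *)
Section Fans.
Variables (R : realType) (d n : nat) (b : 'M[int]_(n, d)).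

Definition cone (sigma : {set 'I_n}) (v : 'rV[R]_d) : Prop :=
  exists l : 'I_n -> R,
    (forall i, 0 <= l i) /\
    v = \sum_(i in sigma) l i *: map_mx intr (row i b).

Definition part_of_basis (sigma : {set 'I_n}) : Prop :=
  exists (W : 'M[int]_d) (f : 'I_n -> 'I_d),
    [/\ W \in unitmx, {in sigma &, injective f}
      & forall i, i \in sigma -> row i b = row (f i) W].

(* The toric variety of a complete fan is projective iff the fan has a strictly
   convex integral support function, equivalently is the normal fan of a
   lattice polytope, here { m | <m, b_i> <= h i for all i }: the facet sigma is
   the normal cone of the vertex m. *)
Definition strictly_convex_support (Delta : {set {set 'I_n}})
    (h : 'I_n -> int) : Prop :=
  forall sigma : {set 'I_n}, maxset (mem Delta) sigma ->
    exists m : 'cV[int]_d,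
      (forall i, i \in sigma -> (b *m m) i 0 = h i) /\
      (forall i, i \notin sigma -> (b *m m) i 0 < h i).

Record smooth_projective_fan (Delta : {set {set 'I_n}}) : Prop := {
  fan_empty : set0 \in Delta;
  fan_sub : forall sigma tau : {set 'I_n},
    tau \subset sigma -> sigma \in Delta -> tau \in Delta;
  fan_rays : forall i, [set i] \in Delta;
  fan_primitive : forall i (a : nat) (v : 'rV[int]_d), row i b = v *+ a -> a = 1%N;
  fan_meet : forall sigma tau, sigma \in Delta -> tau \in Delta ->
    forall v, cone sigma v -> cone tau v -> cone (sigma :&: tau) v;
  fan_smooth : forall sigma, sigma \in Delta -> part_of_basis sigma;
  fan_complete : forall v, exists2 sigma, sigma \in Delta & cone sigma v;
  fan_projective : exists h, strictly_convex_support Delta h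
}.

End Fans.

Definition short_exact (d n r : nat) (b : 'M[int]_(n, d)) (A : 'M[int]_(r, n)) : Prop :=
  [/\ forall u : 'cV[int]_d, b *m u = 0 -> u = 0,
      forall w : 'cV[int]_n, A *m w = 0 <-> exists u : 'cV[int]_d, w = b *m u
    & forall q : 'cV[int]_r, exists w : 'cV[int]_n, q = A *m w].

Section Semigroup.
Variables (n r : nat) (A : 'M[int]_(r, n)) (Delta : {set {set 'I_n}}).

Definition semigroup (T : finType) (a : T -> 'cV[int]_r) (J : {set T})
    (p : 'cV[int]_r) : Prop :=
  exists l : T -> nat, p = \sum_(i in J) a i *+ l i.

Definition NA (sigma : {set 'I_n}) : 'cV[int]_r -> Prop :=
  semigroup (fun i => col i A) sigma.

Definition Ksg (p : 'cV[int]_r) : Prop :=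
  forall sigma, sigma \in Delta -> NA (~: sigma) p.

Definition hilbert_basis (e : nat) (c : 'I_e -> 'cV[int]_r) : Prop :=
  (forall p, Ksg p <-> semigroup c [set: 'I_e] p) /\
  (forall J : {set 'I_e}, (forall p, Ksg p <-> semigroup c J p) -> J = [set: 'I_e]).

Definition KR (R : realType) (y : 'cV[R]_r) : Prop :=
  exists s : seq (R * 'cV[int]_r),
    (forall x, x \in s -> 0 <= x.1 /\ Ksg x.2) /\
    y = \sum_(x <- s) x.1 *: map_mx intr x.2.

Definition orthant_in_cone (R : realType) (phi : 'M[int]_r) : Prop :=
  forall x : 'cV[R]_r, (forall i, 0 <= x i 0) ->
    exists2 y : 'cV[R]_r, KR y & x = map_mx intr phi *m y.

Variables (k : fieldType) (M : lmodType {mpoly k[n]}) (G : 'cV[int]_r -> M -> Prop).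

Definition regular (e : nat) (c : 'I_e -> 'cV[int]_r) (q : 'cV[int]_r) : Prop :=
  (forall (i : nat) (l : 'I_e -> nat) (p : 'cV[int]_r), (1 <= i)%N ->
     (\sum_j l j)%N = i.-1 -> Ksg p ->
     HB_vanishes A Delta G i (q - \sum_j c j *+ l j + p)) /\
  (forall (j : 'I_e) (p : 'cV[int]_r), Ksg p ->
     HB_vanishes A Delta G 0 (q + c j + p)).

Definition has_dim (V : M -> Prop) (N : nat) : Prop :=
  exists v : 'I_N -> M,
    (forall i, V (v i)) /\
    (forall m, V m -> exists! a : 'rV[k]_N, m = \sum_i (a 0 i)%:MP *: v i).

Definition hilbert_poly (P : {mpoly rat[r]}) : Prop :=
  exists ws : seq 'cV[int]_r,
    forall t : 'cV[int]_r, (forall w, w \in ws -> Ksg (t - w)) ->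
      exists2 N : nat, has_dim (G t) N & P.@[fun i => (t i 0)%:~R] = N%:R.

End Semigroup.

Section PolynomialsInT.
Variable r : nat.

Definition lin_change (phi : 'M[int]_r) (Q : {mpoly rat[r]}) : {mpoly rat[r]} :=
  Q \mPo [tuple \sum_(j < r) (invmx phi i j)%:~R *: 'X_j | i < r].

Definition translate (w : 'cV[int]_r) (Q : {mpoly rat[r]}) : {mpoly rat[r]} :=
  Q \mPo [tuple 'X_i - ((w i 0)%:~R)%:MP | i < r].

(* Refining the total degree makes 1 the least monomial, and lt a well-order. *)
Record graded_monomial_order (lt : rel 'X_{1..r}) : Prop := {
  mo_irr : irreflexive lt;
  mo_trans : transitive lt;
  mo_total : forall u v, u != v -> lt u v || lt v u;
  mo_add : forall u v w, lt u v -> lt (u + w)%MM (v + w)%MM;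
  mo_deg : forall u v, (mdeg u < mdeg v)%N -> lt u v
}.

Definition lead_mon (lt : rel 'X_{1..r}) (Q : {mpoly rat[r]}) (u : 'X_{1..r}) : Prop :=
  u \in msupp Q /\ (forall v, v \in msupp Q -> v != u -> lt v u).

End PolynomialsInT.

Section Gotzmann.
Variables (n r : nat) (A : 'M[int]_(r, n)) (Delta : {set {set 'I_n}}).
(* PS tau is the Hilbert polynomial of S_tau, for ~: tau in Delta. *)
Variables (phi : 'M[int]_r) (lt : rel 'X_{1..r}) (PS : {set 'I_n} -> {mpoly rat[r]}).

Definition face_lt (alpha beta : {set 'I_n}) : Prop :=
  exists u v, [/\ lead_mon lt (lin_change phi (PS (~: beta))) u,
                  lead_mon lt (lin_change phi (PS (~: alpha))) v & lt u v].

(* prec is the reflexive order: prec alpha beta reads "alpha equals or precedes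
   beta". *)
Record refining_total_order (prec : rel {set 'I_n}) : Prop := {
  prec_refl : {in Delta, reflexive prec};
  prec_anti : {in Delta &, antisymmetric prec};
  prec_trans : {in Delta & &, transitive prec};
  prec_total : {in Delta &, total prec};
  prec_refines : forall alpha beta, alpha \in Delta -> beta \in Delta ->
    face_lt alpha beta -> prec alpha beta
}.

Variable prec : rel {set 'I_n}.

Local Notation mpair := ('X_{1..n} * {set 'I_n})%type.

(* The remainder Q_i; the pairs being numbered from 0 in s, it is compared with
   the pair of index i. *)
Definition remainder (P : {mpoly rat[r]}) (s : seq mpair) (i : nat) : {mpoly rat[r]} :=
  P - \sum_(x <- take i s) translate (mon_deg A x.1) (PS x.2).

Local Notation nthp s i := (nth (0%MM, set0) s i).

(* lead_mon fails for the zero polynomial, so gs_lead contains Q_i <> 0; in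
   particular the only sequence for P = 0 is the empty one. *)
Record gotzmann_seq (P : {mpoly rat[r]}) (s : seq mpair) : Prop := {
  gs_face : forall x, x \in s -> ~: x.2 \in Delta;
  gs_first : (0 < size s)%N -> (nthp s 0).1 = 0%MM;
  gs_step : forall i, (0 < i < size s)%N -> exists j l,
    [/\ (j < i)%N, prec (~: (nthp s j).2) (~: (nthp s i).2), l \notin (nthp s j).2
      & (nthp s i).1 = ((nthp s j).1 + U_(l))%MM];
  gs_lead : forall i, (i < size s)%N -> exists u,
    [/\ lead_mon lt (lin_change phi (remainder P s i)) u,
        lead_mon lt (lin_change phi (PS (nthp s i).2)) u
      & 0 < (lin_change phi (remainder P s i))@_u];
  gs_end : remainder P s (size s) = 0
}.

(* The pairs of a sequence are counted without repetition. *)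
Definition gotzmann_number (P : {mpoly rat[r]}) (m : nat) : Prop :=
  (exists2 s, gotzmann_seq P s & size (undup s) = m) /\
  (forall s, gotzmann_seq P s -> (size (undup s) <= m)%N).

End Gotzmann.

(* Main.v *)
Require Import Defs.
From HB Require Import structures.
From mathcomp Require Import all_boot all_order all_algebra.
From mathcomp Require Import boolp reals mpoly.
From mathcomp Require Import zify ring.

(* Everything happens inside the ring S.  Local cohomology of S/I is the cohomology
   of the limit of the Koszul complexes on the powers of the generators of B, taken
   with coefficients in graded subquotients of S.

   The existence of c puts an ample class alpha = n c at our disposal: every face has
   a monomial y of degree alpha whose support is the complement of the face.  On the
   line p + N alpha, S/I filtered by the degree in one variable is noetherian over
   k[y], so its cohomology vanishes in low weights, and vanishing for the initial
   ideal with respect to that variable implies vanishing for I.  Degenerating along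
   all the variables in turn replaces I by a monomial ideal J with the same Hilbert
   function.

   S/J is filtered greedily: among the faces for which k[tau] does not meet J, choose
   the one whose complement is least for prec, split off S_tau, and continue with the
   colon ideals by the variables outside tau; pieces with no such face are B-torsion
   and contribute neither to the Hilbert polynomial nor to H^i for i > 0.  Sorted by
   prec, the pairs obtained form a Gotzmann sequence of P: the leading terms agree
   because the coefficients of highest degree of every P_{S_tau} are nonnegative in
   the coordinates phi.  So there are at most m pairs, every monomial x^v that occurs
   has degree at most m - 1, and H^i(S/J) vanishes wherever all the H^i(S_tau(-v))
   do.  Finally H^0_B(S/I) = 0 because I is saturated. *)

Set Implicit Arguments.
Unset Strict Implicit.
Unset Printing Implicit Defensive.

Import Order.TTheory GRing.Theory Num.Theory.
Local Open Scope ring_scope.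

(** * Koszul complexes and their limit *)

(** In the localizations at the [y] the degree in a variable takes arbitrarily negative values, so
    the induction on weight that passes from the associated graded module to the filtered one has no
    evident start. Vanishing in low weights provides it; it rests on the kernel and the cokernel of
    one multiplication at a time, down to modules on which all the generators act by zero. The
    squarefree generators of B have no common degree, so they are exchanged for monomials with the
    same supports, all of degree [c *+ n]. Treating the variables singly replaces a term order by
    integer filtrations; homogeneity in a variable already treated survives the later steps, so the
    last ideal is homogeneous in every variable, that is, monomial. Choosing the least face makes
    the recursion end: if the colon ideal by a variable outside tau were not larger, tau with that
    variable added would have been an earlier choice. The bound m - 1 comes from chains of
    predecessors: a pair whose monomial has degree e forces pairs of all smaller degrees. *)

Section Koszul.
Variables (F : fieldType) (S : comAlgType F) (N : nat).
Implicit Types (i j : 'I_N) (J : {set 'I_N}) (c b : {set 'I_N} -> S).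

Definition ksign (j : 'I_N) (J : {set 'I_N}) : S :=
  (-1) ^+ #|[set j' in J | (j' < j)%N]|.

Lemma ksignK j J : ksign j J * ksign j J = 1.
Proof. by rewrite /ksign -expr2 sqrr_sign. Qed.

Lemma ksign_lt (i j : 'I_N) (J : {set 'I_N}) : i \in J -> j \in J -> (i < j)%N ->
  ksign i J * ksign j (J :\ i) = - (ksign j J * ksign i (J :\ j)).
Proof.
move=> iJ jJ ij; rewrite /ksign.
have -> : [set j' in J :\ j | (j' < i)%N] = [set j' in J | (j' < i)%N].
  apply/setP=> x; rewrite !inE; case: eqVneq => //= ->.
  by rewrite ltnNge (ltnW ij) andbF.
have -> : #|[set j' in J | (j' < j)%N]| = #|[set j' in J :\ i | (j' < j)%N]|.+1.
  rewrite (cardsD1 i [set j' in J | (j' < j)%N]) inE iJ ij add1n; congr _.+1.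
  by apply: eq_card => x; rewrite !inE andbA.
by rewrite exprS !mulN1r mulNr opprK mulrC.
Qed.

Lemma ksign_swap (i j : 'I_N) (J : {set 'I_N}) : i \in J -> j \in J -> i != j ->
  ksign i J * ksign j (J :\ i) = - (ksign j J * ksign i (J :\ j)).
Proof.
move=> iJ jJ ij; have [lt|lt|/val_inj eq] := ltngtP i j.
- exact: ksign_lt.
- by rewrite (@ksign_lt j i) // opprK.
- by rewrite eq eqxx in ij.
Qed.

Variables (z : 'I_N -> S).

Definition kprod (J : {set 'I_N}) : S := \prod_(j in J) z j.

(** The Koszul differential for the [z j ^+ a]. At level [a] the value [c J] stands for the fraction
    with numerator [c J] and denominator [kprod J ^+ a]. *)
Definition kdiff (a : nat) (c : {set 'I_N} -> S) (J : {set 'I_N}) : S :=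
  \sum_(j in J) ksign j J * (z j ^+ a * c (J :\ j)).

Lemma kprod_setD1 J j : j \in J -> kprod J = z j * kprod (J :\ j).
Proof. by move=> jJ; rewrite /kprod (big_setD1 j). Qed.

Lemma kdiff_kdiff a c J : kdiff a (kdiff a c) J = 0.
Proof.
rewrite /kdiff.
pose t (i j : 'I_N) := (ksign i J * ksign j (J :\ i)) *
  (z i ^+ a * z j ^+ a * c (J :\ i :\ j)).
have tN i j : i \in J -> j \in J -> i != j -> t i j = - t j i.
  move=> iJ jJ ij; rewrite /t ksign_swap // mulNr; congr (- (_ * _)).
  rewrite [z i ^+ a * _]mulrC; congr (_ * c _).
  by apply/setP=> x; rewrite !inE andbCA.
rewrite (eq_bigr (fun i : 'I_N => \sum_(j in J | (i != j)) t i j)); last first.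
  move=> i iJ; rewrite 2!mulr_sumr; apply: eq_big => [j|j].
    by rewrite !inE andbC eq_sym.
  by move=> _; rewrite /t; ring.
have split_ij i : \sum_(j in J | i != j) t i j =
    \sum_(j in J | (i < j)%N) t i j + \sum_(j in J | (j < i)%N) t i j.
  rewrite (bigID (fun j : 'I_N => (i < j)%N)) /=; congr (_ + _); apply: eq_bigl => j.
    by rewrite -andbA; congr (_ && _); rewrite andb_idl // => /ltn_eqF/negbT.
  by rewrite -andbA; congr (_ && _); rewrite -leqNgt ltn_neqAle eq_sym.
rewrite (eq_bigr _ (fun i _ => split_ij i)) big_split /=.
rewrite [X in _ + X](exchange_big_dep (fun j => j \in J)) /=; last first.
  by move=> i j _ /andP[].
rewrite -big_split big1 //= => i iJ.
rewrite [X in _ + X](eq_bigl (fun j => (j \in J) && (i < j)%N)); last first.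
  by move=> j; rewrite iJ.
rewrite -big_split big1 //= => j /andP[jJ ij].
by rewrite tN ?addNr //; apply: contraTneq ij => ->; rewrite ltnn.
Qed.

Lemma kdiffD a c c' J : kdiff a (fun J => c J + c' J) J = kdiff a c J + kdiff a c' J.
Proof. by rewrite -big_split; apply: eq_bigr => j _; rewrite /= !mulrDr. Qed.

Lemma kdiffM a h c J : kdiff a (fun J => h * c J) J = h * kdiff a c J.
Proof. by rewrite mulr_sumr; apply: eq_bigr => j _; ring. Qed.

Lemma kdiffB a c c' J : kdiff a (fun J => c J - c' J) J = kdiff a c J - kdiff a c' J.
Proof.
by rewrite kdiffD -[- kdiff a c' J]mulN1r -kdiffM; congr (_ + _);
  apply: eq_bigr => j _; rewrite mulN1r.
Qed.

(** Multiplication of [c J] by [kprod J ^+ e] leaves the fraction unchanged: it is the transition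
    map of the limit from level [a] to level [a + e]. *)
Lemma kdiff_raise a e c J :
  kdiff (a + e) (fun J => kprod J ^+ e * c J) J = kprod J ^+ e * kdiff a c J.
Proof.
rewrite mulr_sumr; apply: eq_bigr => j jJ.
by rewrite (kprod_setD1 jJ) exprMn exprD; ring.
Qed.

Definition kcontract (i : 'I_N) (c : {set 'I_N} -> S) (J : {set 'I_N}) : S :=
  if i \in J then 0 else ksign i (i |: J) * c (i |: J).

Lemma kdiff_contract a i c J :
  kdiff a (kcontract i c) J + kcontract i (kdiff a c) J = z i ^+ a * c J.
Proof.
rewrite {2}/kcontract; case: ifPn => iJ.
  rewrite addr0 /kdiff (bigD1 i) //= big1 ?addr0; last first.
    move=> j /andP[jJ ji]; rewrite /kcontract !inE eq_sym ji iJ /=.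
    by rewrite !mulr0.
  rewrite /kcontract !inE eqxx /= setD1K //.
  by rewrite mulrCA; congr (_ * _); rewrite mulrA ksignK mul1r.
rewrite /kdiff mulr_sumr [X in _ + X](big_setD1 i) ?setU11 //= setU1K //.
rewrite mulrA ksignK mul1r addrCA -[RHS]addr0; congr (_ + _).
rewrite -big_split big1 //= => j jJ.
have ji : j != i by apply: contraNneq iJ => <-.
have iJ' : i \in J :\ j = false by rewrite !inE (negbTE iJ) andbF.
rewrite /kcontract iJ'.
have -> : (i |: J) :\ j = i |: (J :\ j).
  by apply/setP=> x; rewrite !inE; case: (eqVneq x i) => [->|//]; rewrite eq_sym ji.
have := @ksign_swap i j (i |: J); rewrite setU11 setU1r // eq_sym ji setU1K //.
have -> : (i |: J) :\ j = i |: (J :\ j).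
  by apply/setP=> x; rewrite !inE; case: (eqVneq x i) => [->|//]; rewrite eq_sym ji.
move=> /(_ isT isT isT) sw.
have -> : ksign j J = - (ksign i (i |: J) * ksign j (i |: J) * ksign i (i |: J :\ j)).
  by rewrite -[LHS]mul1r -(ksignK i (i |: J)) -mulrA sw mulrN mulrA.
have := ksignK i (i |: J :\ j); set s := ksign _ _ => ss.
rewrite !mulNr; apply/eqP; rewrite addr_eq0 eqr_oppLR opprK; apply/eqP.
transitivity ((s * s) * (ksign i (i |: J) * (ksign j (i |: J) * (z j ^+ a * c (i |: J :\ j))))).
  by ring.
by rewrite ss mul1r.
Qed.

End Koszul.

(** * Limit cohomology with coefficients in graded subquotients *)

Section GradedSubquotients.
Variables (F : fieldType) (S : comAlgType F) (D : zmodType) (N : nat).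
Variables (z : 'I_N -> S) (dz : 'I_N -> D).
Implicit Types (G W Z K : D -> S -> Prop) (g : D) (i j : 'I_N) (J : {set 'I_N}).
Implicit Types (b c : {set 'I_N} -> S).

(** Only closure under multiplication by the [z j] is required: the Rees modules below are modules
    over the algebra generated by these, not over the whole of [S]. *)
Record gsub (G : D -> S -> Prop) : Prop := {
  gsub0 : forall g, G g 0;
  gsubD : forall g x y, G g x -> G g y -> G g (x + y);
  gsubZ : forall g a x, G g x -> G g (a *: x);
  gsubM : forall g j x, G g x -> G (g + dz j) (z j * x)
}.

Lemma gsubN G g x : gsub G -> G g x -> G g (- x).
Proof. by move=> sG Gx; rewrite -scaleN1r; apply: gsubZ. Qed.

Lemma gsubB G g x y : gsub G -> G g x -> G g y -> G g (x - y).
Proof. by move=> sG Gx Gy; apply: gsubD => //; apply: gsubN. Qed.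

Lemma gsub_sum G g (I : finType) (P : pred I) f :
  gsub G -> (forall t : I, P t -> G g (f t)) -> G g (\sum_(t | P t) f t).
Proof.
move=> sG Gf; apply: big_ind => //; first exact: gsub0.
by move=> x y Gx Gy; apply: gsubD.
Qed.

Lemma gsub_sign G g j J x : gsub G -> G g x -> G g (ksign S j J * x).
Proof.
move=> sG Gx; rewrite /ksign -signr_odd; case: odd; last by rewrite mul1r.
by rewrite expr1 mulN1r; apply: gsubN.
Qed.

Lemma gsub_exp G g j a x : gsub G -> G g x -> G (g + dz j *+ a) (z j ^+ a * x).
Proof.
move=> sG Gx; elim: a => [|a IH]; first by rewrite mulr0n addr0 mul1r.
by rewrite mulrSr addrA exprS -mulrA; apply: gsubM.
Qed.

Definition kdeg J : D := \sum_(j in J) dz j.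

Lemma kdeg_setD1 J j : j \in J -> kdeg J = dz j + kdeg (J :\ j).
Proof. by move=> jJ; rewrite /kdeg (big_setD1 j). Qed.

Lemma kdeg_setU1 J j : j \notin J -> kdeg (j |: J) = dz j + kdeg J.
Proof. by move=> jJ; rewrite /kdeg big_setU1. Qed.

Lemma gsub_kprod G g J e x : gsub G -> G g x -> G (g + kdeg J *+ e) (kprod z J ^+ e * x).
Proof.
move=> sG; rewrite /kprod /kdeg -prodrXl -sumrMnl.
elim/big_rec2: _ x => [|j d p _ IH] x Gx; first by rewrite addr0 mul1r.
by rewrite -mulrA [_ + d]addrC addrA; apply: gsub_exp => //; apply: IH.
Qed.

Lemma gsub_kdiff G g a c J : gsub G ->
  (forall j, j \in J -> G (g + kdeg (J :\ j) *+ a) (c (J :\ j))) ->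
  G (g + kdeg J *+ a) (kdiff z a c J).
Proof.
move=> sG Gc; apply: gsub_sum => // j jJ; apply: gsub_sign => //.
by rewrite (kdeg_setD1 jJ) mulrnDl [_ + kdeg _ *+ a]addrC addrA; apply: gsub_exp => //; apply: Gc.
Qed.

Definition kcochain G (m : nat) g (a : nat) c : Prop :=
  forall J, #|J| = m -> G (g + kdeg J *+ a) (c J).

Definition kcocycle Z (m : nat) g (a : nat) c : Prop :=
  forall J, #|J| = m.+1 -> Z (g + kdeg J *+ a) (kdiff z a c J).

(** In a limit a class may vanish only at a later level, whence the exponent [e]. *)
Definition kbounds G Z (m : nat) g (a : nat) c : Prop :=
  exists (e : nat) b,
    (forall J, #|J|.+1 = m -> G (g + kdeg J *+ (a + e)) (b J)) /\
    (forall J, #|J| = m ->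
       Z (g + kdeg J *+ (a + e)) (kprod z J ^+ e * c J - kdiff z (a + e) b J)).

(* The degree g part of the m-th cohomology of the limit over a of the Koszul
   complexes of the z j ^+ a with coefficients in G / Z is zero. *)
Definition Hvan G Z (m : nat) g : Prop :=
  forall a c, kcochain G m g a c -> kcocycle Z m g a c -> kbounds G Z m g a c.

Lemma card_setD1 J j m : j \in J -> #|J| = m.+1 -> #|J :\ j| = m.
Proof. by move=> jJ cJ; move: (cardsD1 j J); rewrite jJ cJ => -[]. Qed.

Lemma kbounds_raise G Z m g a c e : gsub G -> gsub Z ->
  kbounds G Z m g (a + e) (fun J => kprod z J ^+ e * c J) -> kbounds G Z m g a c.
Proof.
move=> sG sZ [e' [b [Gb Zb]]]; exists (e + e')%N, b; rewrite addnA; split=> // J cJ.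
by have := Zb J cJ; rewrite mulrA -exprD [(e' + e)%N]addnC.
Qed.

(** Exactness of the long cohomology sequence of W/Z, G/Z, G/W at its middle term: a primitive
    modulo [W] leaves an error with values in [W], which is again a cocycle modulo [Z]. *)
Lemma Hvan_ext G W Z m g : gsub G -> gsub W -> gsub Z ->
  (forall g x, Z g x -> W g x) -> (forall g x, W g x -> G g x) ->
  Hvan W Z m g -> Hvan G W m g -> Hvan G Z m g.
Proof.
move=> sG sW sZ ZW WG HWZ HGW a c Gc Zc.
have [|e [b [Gb Wb]]] := HGW a c Gc; first by move=> J cJ; apply/ZW/Zc.
pose c' J := kprod z J ^+ e * c J - kdiff z (a + e) b J.
have [|e' [b' [Wb' Zb']]] := HWZ (a + e)%N c' Wb.
  move=> J cJ; rewrite /c' kdiffB kdiff_kdiff subr0 kdiff_raise.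
  by rewrite mulrnDr addrA; apply: gsub_kprod => //; apply: Zc.
exists (e + e')%N, (fun J => kprod z J ^+ e' * b J + b' J).
rewrite addnA; split=> J cJ.
  apply: gsubD => //; last exact/WG/Wb'.
  by rewrite mulrnDr addrA; apply: gsub_kprod => //; apply: Gb.
have := Zb' J cJ; rewrite /c' kdiffD kdiff_raise mulrBr mulrA -exprD [(e' + e)%N]addnC.
by rewrite opprD addrA.
Qed.

Lemma eq_Hvan G Z G' Z' m g :
  (forall g x, G g x <-> G' g x) -> (forall g x, Z g x <-> Z' g x) ->
  Hvan G Z m g -> Hvan G' Z' m g.
Proof.
move=> eG eZ H a c Gc Zc; have [||e [b [Gb Zb]]] := H a c.
- by move=> J cJ; apply/eG/Gc.
- by move=> J cJ; apply/eZ/Zc.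
by exists e, b; split=> J cJ; [apply/eG/Gb | apply/eZ/Zb].
Qed.

(** The hypotheses on [h] say that multiplication by [h] is an isomorphism of degree [d] from G/Z to
    G'/Z': defined, onto modulo [Z'], and injective. *)
Lemma Hvan_iso G Z G' Z' h d m g : gsub G -> gsub Z -> gsub G' -> gsub Z' ->
  (forall g x, G g x -> G' (g + d) (h * x)) ->
  (forall g x, G' (g + d) x -> exists2 y, G g y & Z' (g + d) (x - h * y)) ->
  (forall g x, G g x -> Z' (g + d) (h * x) <-> Z g x) ->
  Hvan G Z m g -> Hvan G' Z' m (g + d).
Proof.
move=> sG sZ sG' sZ' hG hS hZ H a c Gc Zc.
have /choice[x xP] : forall J, exists y, #|J| = m ->
    G (g + kdeg J *+ a) y /\ Z' (g + kdeg J *+ a + d) (c J - h * y).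
  move=> J; have [cJ|//] := eqVneq #|J| m; last by exists 0 => cJ; rewrite cJ eqxx in i.
  have := Gc J cJ; rewrite addrAC => /hS[y Gy Zy]; by exists y.
have [||e [b [Gb Zb]]] := H a x.
- by move=> J cJ; case: (xP J cJ).
- move=> J cJ; apply/hZ.
    by apply: gsub_kdiff => // j jJ; case: (xP (J :\ j) (card_setD1 jJ cJ)).
  rewrite -kdiffM -[kdiff _ _ _ _]opprK; apply: gsubN => //.
  rewrite -[- _](addKr (kdiff z a c J)) -kdiffB; apply: gsubD => //.
    by rewrite addrAC; apply: gsubN => //; apply: Zc.
  rewrite addrAC; apply: gsub_kdiff => // j jJ; rewrite addrAC.
  by case: (xP (J :\ j) (card_setD1 jJ cJ)).
exists e, (fun J => h * b J); split=> J cJ.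
  by rewrite addrAC; apply: hG; apply: Gb.
rewrite kdiffM.
have -> : kprod z J ^+ e * c J - h * kdiff z (a + e) b J =
  kprod z J ^+ e * (c J - h * x J) + h * (kprod z J ^+ e * x J - kdiff z (a + e) b J).
  by ring.
apply: gsubD => //.
  by rewrite mulrnDr addrA; apply: gsub_kprod => //; rewrite addrAC; case: (xP J cJ).
rewrite addrAC; apply/hZ; last exact: Zb.
apply: gsubB => //; first by rewrite mulrnDr addrA; apply: gsub_kprod => //; case: (xP J cJ).
apply: gsub_kdiff => // j jJ; apply: Gb.
by rewrite (cardsD1 j J) jJ in cJ.
Qed.

(** In positive cohomological degree every [J] contains some [j], so a high power of [kprod z J]
    sends the cochain itself into [Z], and the zero primitive works. *)
Lemma Hvan_torsion G Z m g : gsub G -> gsub Z ->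
  (forall g x j, G g x -> exists e, Z (g + dz j *+ e) (z j ^+ e * x)) ->
  Hvan G Z m.+1 g.
Proof.
move=> sG sZ tors a c Gc _.
have /choice[e eP] : forall J, exists e, #|J| = m.+1 ->
    exists2 j, j \in J & Z (g + kdeg J *+ a + dz j *+ e) (z j ^+ e * c J).
  move=> J; have [cJ|nJ] := eqVneq #|J| m.+1; last by exists 0%N => cJ; rewrite cJ eqxx in nJ.
  have /card_gt0P[j jJ] : (0 < #|J|)%N by rewrite cJ.
  by have [e Ze] := tors _ _ j (Gc J cJ); exists e => _; exists j.
exists (\max_J e J)%N, (fun=> 0); split=> [J _|J cJ]; first exact: gsub0.
rewrite [kdiff _ _ _ _]big1 ?subr0; last by move=> j _; rewrite !mulr0.
have [j jJ Zj] := eP J cJ; have le : (e J <= \max_J e J)%N by apply: (leq_bigmax J).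
rewrite -(subnKC le); set f := (_ - _)%N.
rewrite (kprod_setD1 _ jJ) (kdeg_setD1 jJ) exprMn exprD.
have -> : g + (dz j + kdeg (J :\ j)) *+ (a + (e J + f)) =
    g + kdeg J *+ a + dz j *+ e J + dz j *+ f + kdeg (J :\ j) *+ (e J + f).
  by rewrite -(kdeg_setD1 jJ) mulrnDr addrA {2}(kdeg_setD1 jJ) mulrnDl addrA [dz j *+ (e J + f)]mulrnDr addrA.
rewrite [z j ^+ e J * _]mulrC [_ * _ * kprod _ _ ^+ _]mulrC -!mulrA.
by apply: gsub_kprod => //; apply: gsub_exp.
Qed.

(** For multiplication by [z j] on G/Z, the kernel is [kkernel G Z j] modulo [Z], and the cokernel
    is [G] modulo [kimage G Z j]. *)
Definition kkernel G Z j g x : Prop := G g x /\ Z (g + dz j) (z j * x).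

Definition kimage G Z j g x : Prop :=
  exists y w, [/\ Z g y, G (g - dz j) w & x = y + z j * w].

Lemma gsub_kernel G Z j : gsub G -> gsub Z -> gsub (kkernel G Z j).
Proof.
move=> sG sZ; split=> [g|g x y [Gx Zx] [Gy Zy]|g a x [Gx Zx]|g i x [Gx Zx]].
- by split; rewrite ?mulr0; apply: gsub0.
- by split; rewrite ?mulrDr; apply: gsubD.
- by split; rewrite -?scalerAr; apply: gsubZ.
- by split; [apply: gsubM | rewrite addrAC mulrCA; apply: gsubM].
Qed.

Lemma gsub_image G Z j : gsub G -> gsub Z -> gsub (kimage G Z j).
Proof.
move=> sG sZ; split=> [g|g x y [u [w [Zu Gw ->]]] [u' [w' [Zu' Gw' ->]]]|
    g a x [u [w [Zu Gw ->]]]|g i x [u [w [Zu Gw ->]]]].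
- by exists 0, 0; split; rewrite ?mulr0 ?addr0 //; apply: gsub0.
- by exists (u + u'), (w + w'); split; [apply: gsubD|apply: gsubD|rewrite mulrDr addrACA].
- by exists (a *: u), (a *: w); split; [apply: gsubZ|apply: gsubZ|rewrite scalerDr scalerAr].
- exists (z i * u), (z i * w); split; [exact: gsubM| |by rewrite mulrDr mulrCA].
  by rewrite addrAC; apply: gsubM.
Qed.

(* The class of a cocycle c vanishes as soon as that of z j * c does, because
   the long exact sequences of 0 -> ker -> X -> zX -> 0 and 0 -> zX -> X -> X/zX -> 0
   make multiplication by z j injective. *)
Lemma kbounds_mul G Z j m g a c : gsub G -> gsub Z -> (forall g x, Z g x -> G g x) ->
  Hvan (kkernel G Z j) Z m g ->
  (forall m', m = m'.+1 -> Hvan G (kimage G Z j) m' (g + dz j)) ->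
  kcochain G m g a c -> kcocycle Z m g a c ->
  kbounds G Z m (g + dz j) a (fun J => z j * c J) -> kbounds G Z m g a c.
Proof.
move=> sG sZ ZG Hk Hi Gc Zc [e [b [Gb Zb]]].
have sK := gsub_kernel j sG sZ; have sI := gsub_image j sG sZ.
apply: (@kbounds_raise _ _ _ _ _ _ e) => //.
pose c1 J := kprod z J ^+ e * c J; rewrite -/c1.
have Gc1 : kcochain G m g (a + e) c1.
  by move=> J cJ; rewrite mulrnDr addrA; apply: gsub_kprod => //; apply: Gc.
have Zc1 : kcocycle Z m g (a + e) c1.
  move=> J cJ; rewrite kdiff_raise mulrnDr addrA.
  by apply: gsub_kprod => //; apply: Zc.
have Zb1 J : #|J| = m -> Z (g + dz j + kdeg J *+ (a + e)) (z j * c1 J - kdiff z (a + e) b J).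
  by move=> cJ; rewrite mulrCA; apply: Zb.
move: Gb Gc1 Zc1 Zb1 {Zb Gc Zc}; move: (a + e)%N c1 => {a e c} a c Gb Gc Zc Zb.
(* The primitive [b] of [z j * c] is a cocycle modulo the image of [z j]; there it becomes a
   coboundary, so up to a coboundary and [Z] it equals [z j * w]. Subtracting the coboundary of [w]
   from [c] leaves a cochain with values in the kernel of [z j], to which [Hk] applies. *)
have [e [w [Gw Zw]]] : exists e w, (forall J, #|J|.+1 = m -> G (g + kdeg J *+ (a + e)) (w J)) /\
    (forall J, #|J| = m -> Z (g + dz j + kdeg J *+ (a + e))
      (z j * (kprod z J ^+ e * c J - kdiff z (a + e) w J))).
  case: m Hi Gb Gc Zc Zb {Hk} => [|m'] Hi Gb Gc Zc Zb.
    exists 0%N, (fun=> 0); split=> // J cJ; have := Zb J cJ.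
    rewrite addn0 expr0 mul1r; move/cards0_eq: cJ => ->.
    by rewrite /kdiff !big_set0 !subr0.
  have [//|||e [v [Gv Iv]]] := Hi m' _ a b.
  - by move=> J cJ; apply: Gb; rewrite cJ.
  - move=> J cJ; exists (kdiff z a b J - z j * c J), (c J).
    rewrite subrK; split=> //; last by rewrite addrAC addrK; apply: Gc.
    by rewrite -opprB; apply: gsubN => //; apply: Zb.
  have /choice[w wP] : forall J, exists w, #|J| = m' ->
      G (g + kdeg J *+ (a + e)) w /\ Z (g + dz j + kdeg J *+ (a + e))
        (kprod z J ^+ e * b J - kdiff z (a + e) v J - z j * w).
    move=> J; have [cJ|nJ] := eqVneq #|J| m'; last by exists 0 => cJ; rewrite cJ eqxx in nJ.
    have [u [w [Zu Gw ->]]] := Iv J cJ; exists w => _; rewrite addrK; split=> //.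
    by move: Gw; rewrite addrAC addrK.
  exists e, w; split=> J cJ; first by case: (wP J); case: cJ.
  have -> : z j * (kprod z J ^+ e * c J - kdiff z (a + e) w J) =
      kprod z J ^+ e * (z j * c J - kdiff z a b J) +
      kdiff z (a + e) (fun J => kprod z J ^+ e * b J - kdiff z (a + e) v J - z j * w J) J.
    by rewrite !kdiffB kdiff_kdiff kdiff_raise kdiffM; ring.
  apply: gsubD => //.
    by rewrite mulrnDr addrA; apply: gsub_kprod => //; apply: Zb.
  by apply: gsub_kdiff => // l lJ; case: (wP (J :\ l) (card_setD1 lJ cJ)).
pose c1 J := kprod z J ^+ e * c J - kdiff z (a + e) w J.
have [||e' [w' [Kw' Zw']]] := Hk (a + e)%N c1.
- move=> J cJ; split; last by rewrite addrAC; apply: Zw.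
  apply: gsubB => //; first by rewrite mulrnDr addrA; apply: gsub_kprod => //; apply: Gc.
  by apply: gsub_kdiff => // l lJ; apply: Gw; rewrite (cardsD1 l J) lJ in cJ.
- move=> J cJ; rewrite /c1 kdiffB kdiff_kdiff subr0 kdiff_raise mulrnDr addrA.
  by apply: gsub_kprod => //; apply: Zc.
exists (e + e')%N, (fun J => kprod z J ^+ e' * w J + w' J).
rewrite addnA; split=> J cJ.
  apply: gsubD => //; last by case: (Kw' J cJ).
  by rewrite mulrnDr addrA; apply: gsub_kprod => //; apply: Gw.
have := Zw' J cJ; rewrite /c1 kdiffD kdiff_raise mulrBr mulrA -exprD [(e' + e)%N]addnC.
by rewrite opprD addrA.
Qed.

(** The contraction of [c] by [j] is a primitive. *)
Lemma kbounds_exp G Z j m g a c : gsub G -> gsub Z ->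
  kcochain G m g a c -> kcocycle Z m g a c ->
  kbounds G Z m (g + dz j *+ a) a (fun J => z j ^+ a * c J).
Proof.
move=> sG sZ Gc Zc; exists 0%N, (kcontract j c); rewrite addn0; split=> J cJ.
  rewrite /kcontract; case: ifPn => jJ; first exact: gsub0.
  apply: gsub_sign => //; rewrite -addrA -mulrnDl -kdeg_setU1 //; apply: Gc.
  by rewrite cardsU1 jJ -cJ.
rewrite expr0 mul1r -(kdiff_contract z a j c J) [X in Z _ X]addrAC subrr add0r /kcontract.
case: ifPn => jJ; first exact: gsub0.
apply: gsub_sign => //; rewrite -addrA -mulrnDl -kdeg_setU1 //; apply: Zc.
by rewrite cardsU1 jJ -cJ.
Qed.

(** A power of [z j] kills the class by [kbounds_exp], while each single multiplication on the way
    is injective by [kbounds_mul]. *)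
Lemma Hvan_mul_iter G Z j m g : gsub G -> gsub Z -> (forall g x, Z g x -> G g x) ->
  (forall e, Hvan (kkernel G Z j) Z m (g + dz j *+ e)) ->
  (forall e m', m = m'.+1 -> Hvan G (kimage G Z j) m' (g + dz j *+ e.+1)) ->
  Hvan G Z m g.
Proof.
move=> sG sZ ZG Hk Hi a c Gc Zc.
have step e : kbounds G Z m (g + dz j *+ e) a (fun J => z j ^+ e * c J) ->
    kbounds G Z m g a c.
  elim: e => [|e IH]; first by rewrite mulr0n addr0 (_ : (fun J => _) = c) //;
    apply: funext => J; rewrite mul1r.
  move=> H; apply: IH; apply: (@kbounds_mul _ _ j) => //.
  - by move=> m' mm'; rewrite -addrA -mulrSr; apply: Hi.
  - by move=> J cJ; rewrite addrAC; apply: gsub_exp => //; apply: Gc.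
  - by move=> J cJ; rewrite kdiffM addrAC; apply: gsub_exp => //; apply: Zc.
  rewrite -addrA -mulrSr; move: H; congr kbounds.
  by apply: funext => J; rewrite exprS mulrA.
by apply: (step a); apply: kbounds_exp.
Qed.

Lemma Hvan_mul G Z j m g : gsub G -> gsub Z -> (forall g x, Z g x -> G g x) ->
  Hvan (kkernel G Z j) Z m g ->
  (forall m', m = m'.+1 -> Hvan G (kimage G Z j) m' (g + dz j)) ->
  Hvan G Z m (g + dz j) -> Hvan G Z m g.
Proof.
move=> sG sZ ZG Hk Hi H a c Gc Zc; apply: (@kbounds_mul _ _ j) => //; apply: H => J cJ.
  by rewrite addrAC; apply: gsubM => //; apply: Gc.
by rewrite kdiffM addrAC; apply: gsubM => //; apply: Zc.
Qed.

End GradedSubquotients.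

(** * Independence of the cohomology from the choice of generators *)

Section ChangeOfGenerators.
Variables (F : fieldType) (S : comAlgType F) (D : zmodType) (N : nat).
Variables (z z' u v : 'I_N -> S) (dz dz' du dv : 'I_N -> D).
Variables (L L' M : nat).

Lemma kdeg_lin (f f1 f2 : 'I_N -> D) (l : nat) J :
  (forall j, f j *+ l = f1 j + f2 j) -> kdeg f J *+ l = kdeg f1 J + kdeg f2 J.
Proof. by move=> ff; rewrite /kdeg -sumrMnl -big_split; apply: eq_bigr. Qed.

(** The generators [z j] and [z' j] divide powers of each other. A numerator over [z' ^+ a] becomes,
    after multiplication by [u ^+ a], one over [z ^+ (L * a)]; a primitive found there is brought
    back by a power of [v]. The relation between [u], [v] and [M] makes the round trip a transition
    map. *)
Lemma Hvan_change_gens (G Z : D -> S -> Prop) m g :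
  gsub z dz G -> gsub z dz Z -> gsub z' dz' G -> gsub z' dz' Z ->
  gsub u du G -> gsub u du Z -> gsub v dv G -> gsub v dv Z ->
  (forall j, z j ^+ L = z' j * u j) -> (forall j, dz j *+ L = dz' j + du j) ->
  (forall j, z' j ^+ L' = z j * v j) -> (forall j, dz' j *+ L' = dz j + dv j) ->
  (forall j, u j * v j ^+ L = z' j ^+ M) -> (L' * L = M.+1)%N ->
  Hvan z dz G Z m g -> Hvan z' dz' G Z m g.
Proof.
move=> sG sZ sG' sZ' uG uZ vG vZ zu dzu zv dzv uv LM H a c Gc Zc.
have kzu J : kprod z J ^+ L = kprod z' J * kprod u J.
  by rewrite /kprod -prodrXl -big_split; apply: eq_bigr.
have kzv J : kprod z' J ^+ L' = kprod z J * kprod v J.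
  by rewrite /kprod -prodrXl -big_split; apply: eq_bigr.
have kuv J : kprod u J * kprod v J ^+ L = kprod z' J ^+ M.
  rewrite /kprod -[(\prod_(j in J) v j) ^+ L]prodrXl -[(\prod_(j in J) z' j) ^+ M]prodrXl.
  by rewrite -big_split; apply: eq_bigr => j _; exact: uv.
have dzuJ J := kdeg_lin J dzu; have dzvJ J := kdeg_lin J dzv.
have [||e [b [Gb Zb]]] := H (L * a)%N (fun J => kprod u J ^+ a * c J).
- move=> J cJ; rewrite mulrnA dzuJ mulrnDl addrA.
  by apply: gsub_kprod => //; apply: Gc.
- move=> J cJ; have -> : kdiff z (L * a) (fun J => kprod u J ^+ a * c J) J =
      kprod u J ^+ a * kdiff z' a c J.
    rewrite mulr_sumr; apply: eq_bigr => j jJ.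
    by rewrite exprM zu exprMn (kprod_setD1 _ jJ) exprMn; ring.
  rewrite mulrnA dzuJ mulrnDl addrA.
  by apply: gsub_kprod => //; apply: Zc.
have aE : (a + (M * a + L' * e) = L' * (L * a + e))%N.
  by rewrite mulnDr mulnA LM mulSn addnA.
exists (M * a + L' * e)%N, (fun J => kprod v J ^+ (L * a + e) * b J).
rewrite aE; split=> J cJ.
  by rewrite mulrnA dzvJ mulrnDl addrA; apply: gsub_kprod => //; apply: Gb.
have -> : kdiff z' (L' * (L * a + e)) (fun J => kprod v J ^+ (L * a + e) * b J) J =
    kprod v J ^+ (L * a + e) * kdiff z (L * a + e) b J.
  rewrite mulr_sumr; apply: eq_bigr => j jJ.
  by rewrite exprM zv exprMn (kprod_setD1 _ jJ) exprMn; ring.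
have -> : kprod z' J ^+ (M * a + L' * e) * c J =
    kprod v J ^+ (L * a + e) * (kprod z J ^+ e * (kprod u J ^+ a * c J)).
  rewrite !exprD !exprM -kuv kzv !exprMn; ring.
by rewrite -mulrBr mulrnA dzvJ mulrnDl addrA; apply: gsub_kprod => //; apply: Zb.
Qed.

End ChangeOfGenerators.

(** * Vanishing in high degrees and in low weights *)

Section SerreVanishing.
Variables (F : fieldType) (S : comAlgType F) (N : nat).
Variables (z : 'I_N -> S) (om : 'I_N -> int).
Local Notation D := (int * int)%type.
Let dz (j : 'I_N) : D := (1, om j).
Implicit Types (G Z L : D -> S -> Prop).

(** The Rees parameter has degree (0, 1) and acts as inclusion. In [noetherian], that [gens]
    generate [L] is expressed by saying that every submodule containing [Z] and them contains
    [L]. *)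
Definition weight_mono L : Prop := forall g x, L g x -> L (g + (0, 1)) x.

Definition noetherian G Z : Prop := forall L, gsub z dz L -> weight_mono L ->
  (forall g x, Z g x -> L g x) -> (forall g x, L g x -> G g x) ->
  exists gens : seq (D * S), (forall y, y \in gens -> L y.1 y.2) /\
    forall L', gsub z dz L' -> weight_mono L' ->
      (forall g x, Z g x -> L' g x) -> (forall g x, L' g x -> G g x) ->
      (forall y, y \in gens -> L' y.1 y.2) -> forall g x, L g x -> L' g x.

Lemma noetherian_kernel G Z j : gsub z dz G -> gsub z dz Z ->
  noetherian G Z -> noetherian (kkernel z dz G Z j) Z.
Proof.
move=> sG sZ nG L sL tL ZL LK; have [||||gens [gL gP]] := nG L => //.
  by move=> g x /LK[].
exists gens; split=> // L' sL' tL' ZL' LK' gL' g x Lx.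
by apply: gP Lx => // {x}g x /LK'[].
Qed.

Lemma noetherian_image G Z j : gsub z dz G -> gsub z dz Z ->
  noetherian G Z -> noetherian G (kimage z dz G Z j).
Proof.
move=> sG sZ nG L sL tL ZL LG.
have ZI g x : Z g x -> kimage z dz G Z j g x.
  by move=> Zx; exists x, 0; split; rewrite ?mulr0 ?addr0 //; apply: gsub0 sG _.
have [||||gens [gL gP]] := nG L => //.
  by move=> g x /ZI/ZL.
exists gens; split=> // L' sL' tL' ZL' LK' gL' g x Lx.
by apply: gP Lx => // {x}g x /ZI/ZL'.
Qed.

Lemma weight_mono_kernel G Z j : weight_mono G -> weight_mono Z ->
  weight_mono (kkernel z dz G Z j).
Proof. by move=> tG tZ g x [Gx Zx]; split; [exact: tG | rewrite addrAC; exact: tZ]. Qed.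

Lemma weight_mono_image G Z j : weight_mono G -> weight_mono Z ->
  weight_mono (kimage z dz G Z j).
Proof.
move=> tG tZ g x [y [w [Zy Gw ->]]]; exists y, w; split=> //; first exact: tZ.
by rewrite addrAC; apply: tG.
Qed.

(** When all the [z j] act by zero, G/Z is finitely generated over the polynomials in the Rees
    parameter alone, which raises the weight and fixes the degree. *)
Lemma noetherian_bounded G Z : gsub z dz G -> gsub z dz Z ->
  (forall g x, Z g x -> G g x) -> weight_mono G -> weight_mono Z -> noetherian G Z ->
  (forall j g x, G g x -> Z (g + dz j) (z j * x)) ->
  exists k0 w0 : int, forall (k w : int) x, (k0 <= k) || (w < w0) -> G (k, w) x -> Z (k, w) x.
Proof.
move=> sG sZ ZG tG tZ nG kill; have [gens [gG gP]] := nG G sG tG ZG (fun _ _ => id).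
pose k0 := \sum_(y <- gens) `|y.1.1| + 1; pose w0 := - \sum_(y <- gens) `|y.1.2|.
have bound (f : D * S -> int) y : y \in gens -> `|f y| <= \sum_(y <- gens) `|f y|.
  move=> yg; rewrite (big_rem y) //= lerDl; apply: sumr_ge0 => i _; exact: normr_ge0.
exists k0, w0 => k w x kw Gx.
(* This is a submodule, as products with [z j] fall into [Z] and the Rees parameter keeps both
   bounds; it contains the generators by the choice of [k0] and [w0]. *)
pose L (g : D) x := Z g x \/ (G g x /\ (g.1 < k0) /\ (w0 <= g.2)).
suff [//|[_ [kl wl]]] : L (k, w) x by move: kw; rewrite leNgt kl ltNge wl.
apply: (gP L) Gx => {k w x kw}.
- split=> [g|g x y Lx Ly|g a x [Zx|[Gx bg]]|g j x [Zx|[Gx bg]]].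
  + by left; apply: gsub0 sZ _.
  + case: Lx Ly => [Zx|[Gx bg]] [Zy|[Gy bg']]; first by left; apply: (gsubD sZ).
    * by right; split=> //; apply: (gsubD sG) => //; apply: ZG.
    * by right; split=> //; apply: (gsubD sG) => //; apply: ZG.
    * by right; split=> //; apply: (gsubD sG).
  + by left; apply: (gsubZ sZ).
  + by right; split=> //; apply: (gsubZ sG).
  + by left; apply: (gsubM sZ).
  + by left; apply: kill.
- move=> g x [Zx|[Gx [bk bw]]]; first by left; apply: tZ.
  right; split; [exact: tG | split; rewrite /= ?addr0 //].
  by apply: le_trans bw _; rewrite lerDl.
- by left.
- by move=> g x [/ZG|[]].
- move=> y yg; right; split; first exact: gG.
  have := bound (fun y => y.1.1) y yg; have := bound (fun y => y.1.2) y yg.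
  rewrite /k0 /w0 /=; set a := \sum_(_ <- _) _; set b := \sum_(_ <- _) _; split; lia.
Qed.

(** Induction on the number [s] of generators that may act nontrivially: the kernel and the cokernel
    of the last one are killed by it as well. In high degrees repeated multiplication concludes. Low
    weights are reached by descending from a high degree one step at a time, so their bound depends
    on the degree. *)
Lemma Hvan_high_low (s : nat) G Z : gsub z dz G -> gsub z dz Z ->
  (forall g x, Z g x -> G g x) -> weight_mono G -> weight_mono Z -> noetherian G Z ->
  (forall j : 'I_N, (s <= j)%N -> forall g x, G g x -> Z (g + dz j) (z j * x)) ->
  (exists k0 : int, forall (k w : int) m, k0 <= k -> Hvan z dz G Z m (k, w)) /\
  (forall k : int, exists w0 : int, forall (w : int) m, w < w0 -> Hvan z dz G Z m (k, w)).
Proof.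
have dzE (k w : int) j e : (k, w) + dz j *+ e = (k + e%:Z, w + om j *+ e) :> D.
  elim: e => [|e IH]; first by rewrite !mulr0n !addr0.
  rewrite mulrSr addrA IH mulrSr addrA /dz /GRing.add /= /GRing.add /=.
  by congr (_, _); rewrite -addrA; congr (_ + _); rewrite -addn1 PoszD.
elim: s G Z => [|s IH] G Z sG sZ ZG tG tZ nG kill.
  have [k0 [w0 kw]] := noetherian_bounded sG sZ ZG tG tZ nG (fun j => kill j (leq0n j)).
  have van k w m : (k0 <= k) || (w < w0) -> Hvan z dz G Z m (k, w).
    move=> kwb; case: m => [|m].
      move=> a c Gc _; exists 0%N, (fun=> 0); split=> [J _|J /cards0_eq->].
        exact: gsub0 sG _.
      have := Gc set0; rewrite cards0 expr0 mul1r /kdiff /kdeg !big_set0 !mul0rn !addr0 subr0.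
      by move=> /(_ erefl); apply: kw.
    apply: Hvan_torsion => // g x j Gx; exists 1%N; rewrite mulr1n expr1.
    exact: kill.
  split; first by exists k0 => k w m kk; apply: van; rewrite kk.
  by move=> k; exists w0 => w m ww; apply: van; rewrite ww orbT.
have [sN|Ns] := ltnP s N; last first.
  apply: IH => // j sj; have := ltn_ord j; rewrite ltnNge (leq_trans Ns sj) //.
pose j := Ordinal sN.
have sK := gsub_kernel j sG sZ; have sI := gsub_image j sG sZ.
have ZK g x : Z g x -> kkernel z dz G Z j g x.
  by move=> Zx; split; [exact: ZG | exact: (gsubM sZ)].
have ZI g x : Z g x -> kimage z dz G Z j g x.
  by move=> Zx; exists x, 0; split; rewrite ?mulr0 ?addr0 //; apply: gsub0 sG _.
have IG g x : kimage z dz G Z j g x -> G g x.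
  move=> [y [w [Zy Gw ->]]]; apply: (gsubD sG); first exact: ZG.
  by rewrite -[g](subrK (dz j)); apply: (gsubM sG).
have [||||||| [kK HK] bK] := IH (kkernel z dz G Z j) Z => //.
- exact: weight_mono_kernel.
- exact: noetherian_kernel.
- move=> i; rewrite leq_eqVlt => /orP[/eqP si|si] g x [Gx Zx]; last exact: kill.
  by rewrite (_ : i = j) //; apply: val_inj.
have [||||||| [kI HI] bI] := IH G (kimage z dz G Z j) => //.
- exact: weight_mono_image.
- exact: noetherian_image.
- move=> i; rewrite leq_eqVlt => /orP[/eqP si|si] g x Gx; last exact/ZI/kill.
  rewrite (_ : i = j); last exact: val_inj.
  exists 0, x; split; rewrite ?add0r //; first exact: gsub0 sZ _.
  by rewrite addrK.
have high : exists k0 : int, forall (k w : int) m, k0 <= k -> Hvan z dz G Z m (k, w).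
  exists (Order.max kK kI) => k w m; rewrite ge_max => /andP[kk1 kk2].
  apply: (@Hvan_mul_iter _ _ _ _ _ _ _ _ j) => // [e|e m' _]; rewrite dzE.
    by apply: HK; lia.
  by apply: HI; lia.
split=> //; have [k0 Hk0] := high.
have low (l : nat) : exists w0 : int, forall (w : int) m, w < w0 -> Hvan z dz G Z m (k0 - l%:Z, w).
  elim: l => [|l [w0 Hw0]]; first by exists 0 => w m _; apply: Hk0; lia.
  have [wK HwK] := bK (k0 - l.+1%:Z); have [wI HwI] := bI (k0 - l%:Z).
  (* Multiplication by [z j] moves the weight by [om j], so the bounds of the cokernel and of the
     next degree are corrected by it. *)
  exists (Order.min wK (Order.min (wI - om j) (w0 - om j))) => w m.
  rewrite !lt_min => /and3P[w1 w2 w3].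
  have dzE1 : (k0 - l.+1%:Z, w) + dz j = (k0 - l%:Z, w + om j) :> D.
    by rewrite -[dz j]mulr1n dzE mulr1n; congr (_, _); lia.
  apply: (@Hvan_mul _ _ _ _ _ _ _ _ j) => //; first exact: HwK.
    by move=> m' _; rewrite dzE1; apply: HwI; lia.
  by rewrite dzE1; apply: Hw0; lia.
move=> k; have [kk|kk] := leP k0 k; first by exists 0 => w m _; apply: Hk0.
have [w0 Hw0] := low `|k0 - k|%N; exists w0 => w m ww.
by rewrite (_ : k = k0 - `|k0 - k|%N%:Z); [exact: Hw0 | lia].
Qed.

End SerreVanishing.

(** * Degrees of monomials and the semigroup K *)

Section Degrees.
Variables (n r : nat) (A : 'M[int]_(r, n)).
Implicit Types u v : 'X_{1..n}.

Lemma mon_degE u : mon_deg A u = \sum_i col i A *+ u i.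
Proof.
apply/colP=> i; rewrite /mon_deg mxE summxE; apply: eq_bigr => j _.
by rewrite !mxE mulmxnE mxE pmulrn mulrzz.
Qed.

Lemma mon_degD u v : mon_deg A (u + v)%MM = mon_deg A u + mon_deg A v.
Proof.
by rewrite !mon_degE -big_split; apply: eq_bigr => i _; rewrite /= mnmDE mulrnDr.
Qed.

Lemma mon_deg0 : mon_deg A 0%MM = 0.
Proof. by rewrite mon_degE big1 // => i _; rewrite mnm0E. Qed.

Lemma mon_degMn u k : mon_deg A (u *+ k)%MM = mon_deg A u *+ k.
Proof. by rewrite !mon_degE -sumrMnl; apply: eq_bigr => i _; rewrite mulmnE mulrnA. Qed.

Lemma mon_degU i : mon_deg A U_(i)%MM = col i A.
Proof.
rewrite mon_degE (bigD1 i) //= mnm1E eqxx mulr1n big1 ?addr0 // => j ji.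
by rewrite mnm1E eq_sym (negbTE ji).
Qed.

Lemma NAP (sigma : {set 'I_n}) p : NA A sigma p <->
  exists2 u, mon_deg A u = p & forall i, i \notin sigma -> u i = 0%N.
Proof.
split=> [[l ->]|[u <- u0]].
  exists [multinom (if i \in sigma then l i else 0)%N | i < n] => [|i ni]; last by rewrite mnmE (negbTE ni).
  by rewrite mon_degE [RHS]big_mkcond; apply: eq_bigr => i _; rewrite mnmE; case: ifP.
exists u; rewrite mon_degE [RHS]big_mkcond; apply: eq_bigr => i _.
by case: ifPn => // /u0 ->.
Qed.

Variable Delta : {set {set 'I_n}}.
Local Notation K := (Ksg A Delta).

Lemma Ksg0 : K 0.
Proof. by move=> s _; exists (fun=> 0%N); rewrite big1. Qed.

Lemma KsgD p q : K p -> K q -> K (p + q).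
Proof.
move=> Kp Kq s sD; have [l ->] := Kp s sD; have [l' ->] := Kq s sD.
by exists (fun i => l i + l' i)%N; rewrite -big_split; apply: eq_bigr => i _; rewrite mulrnDr.
Qed.

Lemma KsgMn p k : K p -> K (p *+ k).
Proof. by move=> Kp; elim: k => [|k IH]; [exact: Ksg0 | rewrite mulrS; exact: KsgD]. Qed.

Lemma Ksg_sum (I : finType) (P : pred I) f : (forall i, P i -> K (f i)) -> K (\sum_(i | P i) f i).
Proof. by move=> Kf; apply: big_ind => //; [exact: Ksg0 | exact: KsgD]. Qed.

End Degrees.

(** * Degrees on a complete smooth fan and the class [c] *)

Section Fan.
Variables (R : realType) (d n r : nat) (b : 'M[int]_(n, d)) (Delta : {set {set 'I_n}}).
Hypothesis hX : smooth_projective_fan R b Delta.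
Variable A : 'M[int]_(r, n).
Hypothesis hA : short_exact b A.
Local Notation K := (Ksg A Delta).
Local Notation deg := (mon_deg A).
Implicit Types u v : 'X_{1..n}.

(** Exponents of equal degree differ by an element of the image of [b], and a linear relation among
    the rays annihilates that image. *)
Lemma relation_fiber (rho : 'I_n -> R) u v :
  \sum_j rho j *: map_mx intr (row j b) = 0 :> 'rV[R]_d -> deg u = deg v ->
  \sum_j rho j * (u j)%:R = \sum_j rho j * (v j)%:R.
Proof.
move=> rb uv; have [_ exA _] := hA.
have /exA[m mE] : A *m (\col_i (u i)%:Z - \col_i (v i)%:Z) = 0.
  by rewrite mulmxBr -/(deg u) uv subrr.
apply/eqP; rewrite -subr_eq0 -sumrB; apply/eqP.
transitivity (\sum_l (\sum_j rho j * (b j l)%:~R) * (m l 0)%:~R).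
  under [RHS]eq_bigr do rewrite mulr_suml.
  rewrite exchange_big; apply: eq_bigr => j _ /=.
  have /colP/(_ j) := mE; rewrite !mxE -mulrBr => e.
  have -> : (u j)%:R - (v j)%:R = ((u j)%:Z - (v j)%:Z)%:~R :> R by rewrite rmorphB /=.
  rewrite e rmorph_sum mulr_sumr; apply: eq_bigr => l _.
  by rewrite /= rmorphM mulrA.
rewrite big1 // => l _; move/rowP/(_ l): rb; rewrite summxE mxE => e.
rewrite (_ : \sum_j _ = 0) ?mul0r // -[RHS]e; apply: eq_bigr => j _.
by rewrite !mxE.
Qed.

(** Completeness puts the opposite of ray [i] into a cone. This gives a nonnegative relation with
    coefficient at least 1 at [i]; being constant on the fiber, it bounds [u i]. *)
Lemma fiber_finite q : exists s : seq 'X_{1..n},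
  uniq s /\ forall u, (u \in s) = (deg u == q).
Proof.
have [[u0 u0q]|noq] := pselect (exists u, deg u = q); last first.
  exists [::]; split=> // u; rewrite in_nil; apply/esym/negbTE/eqP => uq.
  by apply: noq; exists u.
have bnd i : exists B : nat, forall u, deg u = q -> (u i <= B)%N.
  have [s sD [l [l0 lE]]] := fan_complete hX (- map_mx intr (row i b)).
  pose rho j : R := (j == i)%:R + (if j \in s then l j else 0).
  have rho0 j : 0 <= rho j by rewrite /rho addr_ge0 ?ler0n //; case: ifP.
  have rhob : \sum_j rho j *: map_mx intr (row j b) = 0 :> 'rV[R]_d.
    under eq_bigr do rewrite scalerDl.
    rewrite big_split /= (bigD1 i) //= eqxx scale1r big1 ?addr0; last first.
      by move=> j ji; rewrite (negbTE ji) scale0r.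
    apply/eqP; rewrite addr_eq0 -eqr_oppLR lE [X in X == _]big_mkcond; apply/eqP.
    by apply: eq_bigr => j _; case: ifP; rewrite ?scale0r.
  exists (Num.bound (\sum_j rho j * (u0 j)%:R)) => u uq.
  rewrite -(ler_nat R); apply: le_trans (ltW (archi_boundP _)); last first.
    by apply: sumr_ge0 => j _; rewrite mulr_ge0.
  rewrite -(relation_fiber rhob (etrans uq (esym u0q))) (bigD1 i) //=.
  apply: (@le_trans _ _ (rho i * (u i)%:R)); last first.
    by rewrite lerDl; apply: sumr_ge0 => j _; rewrite mulr_ge0.
  rewrite ler_peMl ?ler0n // /rho eqxx lerDl; by case: ifP.
have /choice[B BP] := bnd.
pose M := (\sum_i B i).+1%N.
exists (undup [seq u <- [seq bmnm y | y <- enum {: 'X_{1..n < M}}] | deg u == q]).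
split=> [|u]; first exact: undup_uniq.
rewrite mem_undup mem_filter; case: eqP => //= uq; apply/mapP.
have uM : (mdeg u < M)%N.
  by rewrite ltnS mdegE; apply: leq_sum => i _; apply: BP.
by exists (BMultinom uM); rewrite ?mem_enum.
Qed.

Variable c : 'cV[int]_r.
Hypothesis hc : forall i : 'I_n, K (c - col i A).

(** The rays of a face are linearly independent, whereas completeness yields a relation among all
    the rays with positive coefficients. *)
Lemma face_neqT sigma : sigma \in Delta -> (0 < n)%N -> exists i, i \notin sigma.
Proof.
move=> sD n0; apply/existsP; rewrite -negb_forall; apply/negP => /forallP sT.
have [W [f [Wu finj fW]]] := fan_smooth hX sD.
have [s _ [l [l0 lE]]] := fan_complete hX (- \sum_i map_mx intr (row i b)).
pose rho i : R := 1 + (if i \in s then l i else 0).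
have rhoW : \sum_i rho i *: map_mx intr (row (f i) W) = 0 :> 'rV[R]_d.
  under eq_bigr do rewrite scalerDl scale1r -fW ?sT //.
  rewrite big_split /= -[X in X + _]opprK lE addrC; apply/eqP; rewrite subr_eq0; apply/eqP.
  by rewrite [RHS]big_mkcond; apply: eq_bigr => i _; case: ifP; rewrite ?scale0r.
pose i0 := Ordinal n0.
have WR : map_mx intr W \in @unitmx R d.
  by rewrite unitmxE det_map_mx rmorph_unit // -unitmxE.
have : (\sum_i rho i *: map_mx intr (row (f i) W)) *m invmx (map_mx intr W) = 0 :> 'rV[R]_d.
  by rewrite rhoW mul0mx.
rewrite mulmx_suml => /rowP/(_ (f i0)); rewrite summxE [RHS]mxE.
rewrite (bigD1 i0) //= big1 ?addr0; last first.
  move=> i ii0; rewrite map_row -scalemxAl -row_mul mulmxV // !mxE.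
  rewrite (_ : f i == f i0 = false) ?mulr0 //; apply/negbTE.
  by apply: contraNneq ii0 => /finj ->; rewrite ?sT.
rewrite map_row -scalemxAl -row_mul mulmxV // !mxE eqxx mulr1 /rho => /eqP.
by rewrite gt_eqF // ltr_wpDr //; case: ifP.
Qed.

(** With [i] outside the face, both [c - col i A] and [col i A] lie in its semigroup. If there are
    no rays, the degree group is zero. *)
Lemma Ksg_c : K c.
Proof.
move=> s sD; have [n0|n0] := posnP n.
  have [_ _ surj] := hA; have [w ->] := surj c.
  exists (fun=> 0%N); rewrite [RHS]big1 //; apply/colP => i; rewrite !mxE big1 // => j.
  by case: j => j jn; exfalso; rewrite n0 in jn.
have [i ni] := face_neqT sD n0.
have /NAP[u uE u0] := hc i sD; apply/NAP; exists (u + U_(i))%MM.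
  by rewrite mon_degD uE mon_degU subrK.
move=> j; rewrite inE negbK => js; rewrite mnmDE u0 ?inE ?js // mnm1E.
by case: eqVneq => // ij; rewrite ij js in ni.
Qed.

(** The classes [c - col i A] for [i] outside [sigma], plus one [c] for each element of [sigma], sum
    to an element of K, which is the degree of a monomial avoiding [sigma]. Multiplying it by every
    variable outside [sigma] makes the support exact and the degree [c *+ n]. *)
Lemma face_monomial sigma : sigma \in Delta -> exists u,
  deg u = c *+ n /\ forall i, (u i == 0%N) = (i \in sigma).
Proof.
move=> sD.
have Kci : K (\sum_(i in ~: sigma) (c - col i A) + c *+ #|sigma|).
  by apply: KsgD; [apply: Ksg_sum => i _; exact: hc | apply: KsgMn; exact: Ksg_c].
have /NAP[u uE u0] := Kci _ sD.
exists (u + [multinom (i \notin sigma : nat) | i < n])%MM; split; last first.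
  move=> i; rewrite mnmDE mnmE addn_eq0; case: (boolP (i \in sigma)) => /= is_; last by rewrite andbF.
  by rewrite u0 ?inE ?is_.
rewrite mon_degD uE sumrB sumr_const; set x := mon_deg _ [multinom _ | _ < _].
suff -> : \sum_(i in ~: sigma) col i A = x.
  by rewrite addrAC subrK -mulrnDr addnC cardsC card_ord.
rewrite /x mon_degE [LHS]big_mkcond; apply: eq_bigr => i _; rewrite mnmE inE.
by case: (i \in sigma).
Qed.

(* Completeness puts the sum of the rays of small exponent into a cone sigma;
   pairing with the element of M that relates u to a divisor avoiding sigma
   shows that all these rays belong to sigma. *)
Lemma deep_degree (B : nat) : exists w, forall t, K (t - w) -> forall u, deg u = t ->
  exists2 sigma, sigma \in Delta & forall i, (u i < B)%N -> i \in sigma.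
Proof.
pose M := (B * n).+1.
exists (c *+ n *+ M) => t Kt u ut.
pose nu := [set i | (u i < B)%N].
have [s sD [l [l0 lE]]] := fan_complete hX (\sum_(i in nu) map_mx intr (row i b)).
exists s => // i iB; apply/negPn/negP => is_.
have [y [yc ys]] := face_monomial sD.
have /NAP[v vE v0] := Kt s sD.
(* A monomial of the same degree as [u], avoiding [s] and with exponent at least [M] at [i]. The
   relation [rho] takes a value at most [B * n] on [u] and at least [M] on [th], which is impossible
   for equal degrees. *)
pose th := (y *+ M + v)%MM.
have thE : deg u = deg th by rewrite mon_degD mon_degMn yc vE ut addrC subrK.
pose rho j : R := (j \in nu)%:R - (if j \in s then l j else 0).
have rhob : \sum_j rho j *: map_mx intr (row j b) = 0 :> 'rV[R]_d.
  under eq_bigr do rewrite scalerBl.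
  rewrite sumrB; apply/eqP; rewrite subr_eq0; apply/eqP.
  transitivity (\sum_(i in nu) map_mx intr (row i b) : 'rV[R]_d).
    rewrite [RHS]big_mkcond; apply: eq_bigr => j _.
    by case: (j \in nu); rewrite ?scale1r ?scale0r.
  by rewrite lE big_mkcond; apply: eq_bigr => j _; case: ifP; rewrite ?scale0r.
have := relation_fiber rhob thE.
have th0 j : j \in s -> th j = 0%N.
  by move=> js; rewrite mnmDE mulmnE (eqP (_ : y j == 0%N)) ?ys // v0 // inE js.
have lhs : \sum_j rho j * (u j)%:R <= (B * n)%:R.
  have -> : (B * n)%:R = \sum_(j < n) B%:R :> R by rewrite sumr_const card_ord natrM mulr_natr.
  apply: ler_sum => j _; rewrite /rho mulrBl lerBlDr -[X in X <= _]addr0 lerD //; last first.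
    by rewrite mulr_ge0 //; case: ifP.
  rewrite inE; case: ltnP => [uB|_]; rewrite ?mul1r ?mul0r ?ler0n // ler_nat; exact: ltnW.
have rhs : M%:R <= \sum_j rho j * (th j)%:R.
  have nn j : 0 <= rho j * (th j)%:R.
    rewrite /rho; case: ifPn => js; first by rewrite th0 // mulr0.
    by rewrite subr0 mulr_ge0.
  rewrite (bigD1 i) //=; apply: ler_wpDr; first by apply: sumr_ge0.
  rewrite /rho (negbTE is_) subr0 inE iB mul1r ler_nat mnmDE mulmnE.
  apply: leq_trans (leq_addr _ _); apply: leq_pmull.
  by rewrite lt0n ys.
by move=> e; move: rhs; rewrite -e => /le_trans/(_ lhs); rewrite ler_nat /M ltnn.
Qed.

(** The classes [p] with this property form a semigroup. It contains each [- col i A] because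
    [c - col i A] is in K, and each [col i A], which is [c] minus an effective class; together these
    generate the degree group. *)
Lemma Ksg_add_c p : exists k0 : nat, forall k, (k0 <= k)%N -> K (p + c *+ k).
Proof.
suff [k0 Kp] : exists k0 : nat, K (p + c *+ k0).
  exists k0 => k kk; rewrite -(subnKC kk) mulrnDr addrA.
  by apply: KsgD => //; apply: KsgMn; exact: Ksg_c.
pose P p := exists k0 : nat, K (p + c *+ k0).
have PD x y : P x -> P y -> P (x + y).
  move=> [k Kx] [l Ky]; exists (k + l)%N; rewrite mulrnDr addrACA; exact: KsgD.
have P0 : P 0 by exists 0%N; rewrite addr0; exact: Ksg0.
have PMn x l : P x -> P (x *+ l).
  by move=> Px; elim: l => // l IH; rewrite mulrS; apply: PD.
have Psum (I : finType) (f : I -> _) : (forall i, P (f i)) -> P (\sum_i f i).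
  by move=> Pf; apply: big_ind.
have PN i : P (- col i A) by exists 1%N; rewrite mulr1n addrC; exact: hc.
have Pc i : P (col i A).
  have -> : col i A = c - (c - col i A) by rewrite subKr.
  apply: PD; first by exists 0%N; rewrite addr0; exact: Ksg_c.
  have /NAP[u <- _] := hc i (fan_empty hX).
  rewrite mon_degE -sumrN; apply: Psum => j; rewrite -mulNrn; exact: PMn.
have [_ _ surj] := hA; have [w ->] := surj p; rewrite -/(P _).
have -> : A *m w = \sum_i (w i 0) *: col i A.
  apply/colP=> j; rewrite mxE summxE; apply: eq_bigr => i _.
  by rewrite !mxE mulrC.
apply: Psum => i; case: (w i 0) => l.
  by rewrite (_ : _ *: _ = col i A *+ l); [exact: PMn | rewrite -scaler_nat natz].
rewrite NegzE (_ : _ *: _ = (- col i A) *+ l.+1); [exact: PMn | by rewrite scaleNr mulNrn -scaler_nat natz].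
Qed.

Lemma deep_ex (ws : seq 'cV[int]_r) : exists k0 : nat, forall p, K p ->
  forall w, w \in ws -> K (c *+ k0 + p - w).
Proof.
elim: ws => [|w ws [k0 IH]]; first by exists 0%N.
have [k1 Kw] := Ksg_add_c (- w).
exists (k0 + k1)%N => p Kp x; rewrite inE => /orP[/eqP->|xs].
  by rewrite addrAC [_ - w]addrC; apply: KsgD => //; apply: Kw; exact: leq_addl.
rewrite mulrnDr -[_ + _ + p]addrA; apply: IH => //; apply: KsgD => //.
apply: KsgMn; exact: Ksg_c.
Qed.

End Fan.

(** * Dickson's lemma *)

Section Dickson.
Variable I : finType.
Implicit Types (E : (I -> nat) -> Prop) (f g : I -> nat).

(* Elements of E that do not dominate a fixed f0 in E have a coordinate with one
   of finitely many values; T is the set of the coordinates not yet fixed. *)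
Lemma dickson_on (T : {set I}) E :
  (forall f g i, E f -> E g -> i \notin T -> f i = g i) ->
  exists s : seq (I -> nat), (forall f, List.In f s -> E f) /\
    forall f, E f -> exists2 g, List.In g s & forall i, (g i <= f i)%N.
Proof.
move: {2}#|T|.+1 (ltnSn #|T|) => k; elim: k T E => // k IH T E cT ET.
have [[f0 Ef0]|noE] := pselect (exists f, E f); last first.
  by exists [::]; split=> // f Ef; case: noE; exists f.
have /choice[B BP] : forall ij : I * nat, exists s : seq (I -> nat), ij.1 \in T ->
    (forall f, List.In f s -> E f) /\
    forall f, E f -> f ij.1 = ij.2 -> exists2 g, List.In g s & forall i, (g i <= f i)%N.
  move=> [i j] /=; case: (boolP (i \in T)) => iT; last by exists [::].
  have [||s [sE sP]] := IH (T :\ i) (fun f => E f /\ f i = j).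
  - by move: cT; rewrite (cardsD1 i T) iT.
  - move=> f g i' [Ef fi] [Eg gi]; rewrite !inE negb_and negbK => /orP[/eqP->|]; first by rewrite fi gi.
    exact: ET.
  exists s => _; split=> [f /sE[]//|f Ef fi]; exact: sP.
pose s := flatten [seq flatten [seq B (i, j) | j <- iota 0 (f0 i)] | i <- enum T].
have inflat (X : eqType) (F : X -> seq (I -> nat)) (t : seq X) f :
    List.In f (flatten [seq F x | x <- t]) <-> exists2 x, x \in t & List.In f (F x).
  elim: t => [|x t IHt] /=; first by split=> // -[].
  rewrite List.in_app_iff IHt; split=> [[h|[y yt h]]|[y]].
  - by exists x; rewrite ?inE ?eqxx.
  - by exists y; rewrite ?inE ?yt ?orbT.
  - by rewrite inE => /orP[/eqP->|yt] h; [left | right; exists y].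
exists (f0 :: s); split=> [f /= [<-//|/inflat[i]]|f Ef].
  rewrite mem_enum => iT /inflat[j _]; by have [sE _] := BP (i, j) iT; apply: sE.
have [le|] := boolP [forall i, f0 i <= f i]%N.
  by exists f0; [left | apply/forallP].
rewrite negb_forall => /existsP[i]; rewrite -ltnNge => lt.
have iT : i \in T by apply/negPn/negP => /(ET f f0 i Ef Ef0) e; rewrite e ltnn in lt.
have [_ /(_ f Ef erefl)[g gs gf]] := BP (i, f i) iT.
exists g => //; right; apply/inflat; exists i; first by rewrite mem_enum.
by apply/inflat; exists (f i); rewrite ?mem_iota.
Qed.

Lemma dickson E : exists s : seq (I -> nat), (forall f, List.In f s -> E f) /\
  forall f, E f -> exists2 g, List.In g s & forall i, (g i <= f i)%N.
Proof. by apply: (@dickson_on setT) => f g i _ _; rewrite inE. Qed.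

End Dickson.

(** * Supports and filters of polynomials *)

Section Supports.
Variables (k : fieldType) (n : nat).
Local Notation S := {mpoly k[n]}.
Implicit Types (u v : 'X_{1..n}) (f : S) (P Q : 'X_{1..n} -> Prop).

Definition supported P f : Prop := forall u, f@_u != 0 -> P u.

Lemma supported0 P : supported P 0.
Proof. by move=> u; rewrite mcoeff0 eqxx. Qed.

Lemma supportedD P f g : supported P f -> supported P g -> supported P (f + g).
Proof.
move=> Pf Pg u; rewrite mcoeffD; have [f0|/Pf//] := eqVneq f@_u 0.
by rewrite f0 add0r => /Pg.
Qed.

Lemma supportedZ P a f : supported P f -> supported P (a *: f).
Proof.
move=> Pf u; rewrite mcoeffZ; have [->|/Pf//] := eqVneq f@_u 0.
by rewrite mulr0 eqxx.
Qed.

Lemma supportedN P f : supported P f -> supported P (- f).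
Proof. by move=> Pf; rewrite -scaleN1r; apply: supportedZ. Qed.

Lemma supportedB P f g : supported P f -> supported P g -> supported P (f - g).
Proof. by move=> Pf Pg; apply: supportedD => //; apply: supportedN. Qed.

Lemma supportedW P Q f : (forall u, P u -> Q u) -> supported P f -> supported Q f.
Proof. by move=> PQ Pf u /Pf/PQ. Qed.

Lemma supportedX P v : supported P 'X_[v] <-> P v.
Proof.
split=> [/(_ v)|Pv u]; first by rewrite mcoeffX eqxx oner_eq0; apply.
by rewrite mcoeffX; case: (eqVneq v u) => [<- //|]; rewrite eqxx.
Qed.

Lemma mcoeffXM v f u : ('X_[v] * f)@_u = if (v <= u)%MM then f@_(u - v) else 0.
Proof.
case: ifPn => vu.
  by rewrite -{1}(submK vu) addmC mulrC mcoeffMX.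
apply/eqP; rewrite mcoeff_eq0; apply: contra vu => /msuppM_le/allpairsP[[x y] /= [xv yf ->]].
by move: xv; rewrite msuppX inE => /eqP->; apply: lem_addr.
Qed.

Lemma supportedXM P Q v f : supported P f -> (forall u, P u -> Q (v + u)%MM) ->
  supported Q ('X_[v] * f).
Proof.
move=> Pf PQ u; rewrite mcoeffXM; case: ifPn => [vu|]; last by rewrite eqxx.
by move=> /Pf/PQ; rewrite addmC submK.
Qed.

Lemma homogeneousP r (A : 'M[int]_(r, n)) p f :
  homogeneous A p f <-> supported (fun u => mon_deg A u = p) f.
Proof. by split=> h u; [rewrite -mcoeff_msupp | rewrite mcoeff_msupp]; apply: h. Qed.

Definition mfilter (P : pred 'X_{1..n}) f : S := \sum_(u <- msupp f | P u) f@_u *: 'X_[u].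

Implicit Types (C E : pred 'X_{1..n}).

Lemma mcoeff_filter C f u : (mfilter C f)@_u = if C u then f@_u else 0.
Proof.
rewrite /mfilter -big_filter linear_sum /=.
have [uf|uf] := boolP (u \in [seq v <- msupp f | C v]).
  rewrite (bigD1_seq u) ?filter_uniq ?msupp_uniq //= mcoeffZ mcoeffX eqxx mulr1.
  rewrite big1 ?addr0; last by move=> v vu; rewrite mcoeffZ mcoeffX (negbTE vu) mulr0.
  by move: uf; rewrite mem_filter => /andP[->].
rewrite big1_seq => [|v /andP[_ vf]]; last first.
  by rewrite mcoeffZ mcoeffX; have [vu|_] := eqVneq v u; [rewrite -vu vf in uf | rewrite mulr0].
move: uf; rewrite mem_filter negb_and => /orP[/negbTE->//|].
by case: (C u) => //; rewrite -mcoeff_eq0 => /eqP.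
Qed.

Lemma mfilterD C f g : mfilter C (f + g) = mfilter C f + mfilter C g.
Proof. by apply/mpolyP=> u; rewrite mcoeffD !mcoeff_filter mcoeffD; case: ifP; rewrite ?addr0. Qed.

Lemma mfilterZ C a f : mfilter C (a *: f) = a *: mfilter C f.
Proof. by apply/mpolyP=> u; rewrite mcoeffZ !mcoeff_filter mcoeffZ; case: ifP; rewrite ?mulr0. Qed.

Lemma mfilterXM C E v f : (forall u, C (v + u)%MM = E u) ->
  mfilter C ('X_[v] * f) = 'X_[v] * mfilter E f.
Proof.
move=> CE; apply/mpolyP=> u; rewrite mcoeff_filter !mcoeffXM; case: (boolP (v <= u)%MM) => vu; last by case: ifP.
by rewrite mcoeff_filter -CE addmC submK.
Qed.

Lemma mlead_reduce (f g : S) : f != 0 -> g != 0 -> mlead f = mlead g ->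
  let h := f - (f@_(mlead f) / g@_(mlead g)) *: g in h = 0 \/ (mlead h < mlead f)%O.
Proof.
move=> f0 g0 fg h; have [|h0] := eqVneq h 0; [by left | right].
have hu : h@_(mlead f) = 0.
  by rewrite /h mcoeffB mcoeffZ fg mulfVK ?subrr // mleadc_eq0.
rewrite lt_neqAle; apply/andP; split.
  by apply: contraTneq (mlead_supp h0) => ->; rewrite -mcoeff_eq0 hu.
apply: le_trans (mleadB_le _ _) _; rewrite leUx lexx /=.
by apply: le_trans (mleadZ_le _ _) _; rewrite fg.
Qed.

End Supports.

(** * Degeneration to the initial ideal of a variable *)

Section Rees.
Variables (k : fieldType) (n r : nat) (A : 'M[int]_(r, n)).
Local Notation S := {mpoly k[n]}.
Local Notation deg := (mon_deg A).
Local Notation D := (int * int)%type.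
Variables (N : nat) (eta : 'I_N -> 'X_{1..n}) (alpha : 'cV[int]_r).
Hypothesis deg_eta : forall j, deg (eta j) = alpha.
Hypothesis fib : forall q, exists s : seq 'X_{1..n}, uniq s /\ forall u, (u \in s) = (deg u == q).
Hypothesis divis : forall p, exists k0 : nat, forall m, (k0 <= m)%N ->
  forall u, deg u = p + alpha *+ m -> exists j, (eta j <= u)%MM.
Variables (p : 'cV[int]_r) (l : 'I_n).
Implicit Types (u v : 'X_{1..n}) (g : D) (f : S) (I : S -> Prop).

Definition ymon (j : 'I_N) : S := 'X_[eta j].
Definition yweight (j : 'I_N) : int := (eta j l)%:Z.
Definition ydeg (j : 'I_N) : D := (1, yweight j).

(** In degree (m, w) the Rees module has the forms of degree [p + alpha *+ m] and of degree at most
    [w] in [x_l]. It is cut off at [m = 0], for finite generation. *)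
Definition rees_mon (g : D) u : Prop :=
  exists m : nat, [/\ g.1 = m%:Z, deg u = p + alpha *+ m & (u l)%:Z <= g.2].

Definition rees (g : D) (f : S) : Prop := supported (rees_mon g) f.

Lemma rees_monD g j u : rees_mon g u -> rees_mon (g + ydeg j) (eta j + u)%MM.
Proof.
case: g => a w [m /= [am um uw]]; exists m.+1; split=> /=.
- by rewrite am -addn1 PoszD.
- by rewrite mon_degD deg_eta um mulrS addrCA.
- by rewrite mnmDE PoszD addrC lerD2r.
Qed.

Lemma gsub_rees : gsub ymon ydeg rees.
Proof.
split=> [g|g x y|g a x|g j x Gx]; [exact: supported0|exact: supportedD|exact: supportedZ|].
by apply: supportedXM Gx _ => u; apply: rees_monD.
Qed.

Lemma rees_mono : weight_mono rees.
Proof.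
move=> g x; apply: supportedW => u [m [gm um uw]]; exists m; split=> //=; first by rewrite addr0.
by apply: le_trans uw _; rewrite lerDl.
Qed.

(** [None] is reserved for the exponent of the Rees parameter, which does not show in the monomial;
    a single index type lets Dickson's lemma treat both kinds of exponents. *)
Definition ymonom (nu : option 'I_N -> nat) : 'X_{1..n} :=
  (\sum_j eta j *+ nu (Some j))%MM.

(** Finite generation over k[y]: beyond [k0] some [eta j] can be divided off, and each of the
    remaining degrees has finitely many monomials. *)
Lemma rees_decomp : exists U : seq ('X_{1..n} * nat),
  forall m u, deg u = p + alpha *+ m -> exists u0 m0 (nu : option 'I_N -> nat),
    [/\ (u0, m0) \in U, u = (u0 + ymonom nu)%MM & m = (m0 + \sum_j nu (Some j))%N].
Proof.
have [k0 gen] := divis p; have /choice[fb fbP] := fib.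
exists (flatten [seq [seq (u, m) | u <- fb (p + alpha *+ m)] | m <- iota 0 k0.+1]).
have small m u : (m <= k0)%N -> deg u = p + alpha *+ m ->
    exists u0 m0 (nu : option 'I_N -> nat),
    [/\ (u0, m0) \in flatten [seq [seq (u, m) | u <- fb (p + alpha *+ m)] | m <- iota 0 k0.+1],
      u = (u0 + ymonom nu)%MM & m = (m0 + \sum_j nu (Some j))%N].
  move=> mk um; exists u, m, (fun=> 0%N); split.
  - apply/flatten_mapP; exists m; first by rewrite mem_iota.
    by apply/mapP; exists u => //; have [_ ->] := fbP (p + alpha *+ m); apply/eqP.
  - by rewrite /ymonom big1 ?addm0 // => j _; rewrite mulm0n.
  - by rewrite big1 ?addn0.
elim=> [|m IH] u um; first exact: small.
have [mk|km] := leqP m.+1 k0; first exact: small.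
have [j ju] := gen m.+1 (ltnW km) u um.
have [|u0 [m0 [nu [U0 uE mE]]]] := IH (u - eta j)%MM.
  apply: (addIr alpha); rewrite -{1}(deg_eta j) -mon_degD submK // um.
  by rewrite mulrSr addrA.
exists u0, m0, (fun i => nu i + (i == Some j))%N; split=> //.
  rewrite -(submK ju) uE -addmA; congr (_ + _)%MM; rewrite /ymonom.
  rewrite [RHS](bigD1 j) //= [in LHS](bigD1 j) //= eqxx addn1 mulmS [LHS]addmC addmA.
  by congr (_ + _)%MM; apply: eq_bigr => i ij;
    rewrite (_ : Some i == Some j = false) ?addn0 //; apply/eqP => -[e]; rewrite e eqxx in ij.
rewrite mE -addnS; congr (_ + _)%N.
rewrite [RHS](bigD1 j) //= eqxx addn1 [in LHS](bigD1 j) //= addSn; congr (_ + _).+1.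
by apply: eq_bigr => i ij;
    rewrite (_ : Some i == Some j = false) ?addn0 //; apply/eqP => -[e]; rewrite e eqxx in ij.
Qed.

Lemma gsub_ymonom L g x (nu : option 'I_N -> nat) : gsub ymon ydeg L -> L g x ->
  L (g + \sum_j ydeg j *+ nu (Some j)) ('X_[ymonom nu] * x).
Proof.
move=> sL; rewrite /ymonom -mprodXnE.
elim/big_rec2: _ x => [|j d q _ IH] x Lx; first by rewrite addr0 mul1r.
rewrite -mulrA [_ + d]addrC addrA; apply: (@gsub_exp _ _ _ _ ymon ydeg L _ j) => //; exact: IH.
Qed.

Lemma ydeg_sum (nu : option 'I_N -> nat) :
  \sum_j ydeg j *+ nu (Some j) = ((\sum_j nu (Some j))%N%:Z, (ymonom nu l)%:Z).
Proof.
rewrite /ymonom mnm_sumE.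
elim/big_rec3: _ => [//|j a b c _ ->].
have -> : ydeg j *+ nu (Some j) = ((nu (Some j))%:Z, (eta j l)%:Z *+ nu (Some j)).
  elim: (nu _) => [//|m IH]; rewrite !mulrSr IH -addn1 PoszD; by [].
rewrite mulmnE !PoszD PoszM -mulrzz -pmulrn.
by [].
Qed.

Lemma weight_mono_add (L : D -> S -> Prop) g x e : weight_mono L -> L g x -> L (g + (0, e%:Z)) x.
Proof.
move=> tL Lx; elim: e => [|e IH]; first by rewrite addr0.
rewrite (_ : (0, e.+1%:Z) = (0, e%:Z) + (0, 1) :> D) ?addrA; first exact: tL.
by congr (_, _); rewrite -addn1 PoszD.
Qed.

(** The bidegree of an element with leading monomial [x.1 + ymonom nu], where [nu None] is the
    excess of its weight over the [x_l]-exponent of that monomial. *)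
Definition lead_deg (x : 'X_{1..n} * nat) (nu : option 'I_N -> nat) : D :=
  ((x.2 + \sum_j nu (Some j))%N%:Z, ((x.1 + ymonom nu)%MM l)%:Z + (nu None)%:Z).

(** A Groebner basis argument. The finite set [U] sorts the leading monomials into classes,
    Dickson's lemma gives finitely many minimal exponents in each, and reduction ends because the
    order of monomials is well founded. *)
Lemma rees_noetherian Z : noetherian ymon yweight rees Z.
Proof.
move=> L sL tL ZL LG; have [U UP] := rees_decomp.
pose lm (x : 'X_{1..n} * nat) nu := (x.1 + ymonom nu)%MM.
have /choice[gl glP] : forall x : 'X_{1..n} * nat, exists gl : seq (D * S),
    (forall y, y \in gl -> L y.1 y.2) /\
    forall nu f, f != 0 -> mlead f = lm x nu -> L (lead_deg x nu) f ->
      exists nu' f', [/\ forall i, (nu' i <= nu i)%N, f' != 0, mlead f' = lm x nu'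
        & (lead_deg x nu', f') \in gl].
  move=> x; have [s [sE sP]] := dickson (fun nu => exists f,
    [/\ f != 0, mlead f = lm x nu & L (lead_deg x nu) f]).
  have [gl [glL glP]] : exists gl : seq (D * S), (forall y, y \in gl -> L y.1 y.2) /\
      forall nu, List.In nu s -> exists f, [/\ f != 0, mlead f = lm x nu & (lead_deg x nu, f) \in gl].
    elim: s sE {sP} => [|nu s IH] sE; first by exists [::].
    have [|gl [glL glP]] := IH; first by move=> f fs; apply: sE; right.
    have [f [f0 fl fL]] := sE nu (or_introl erefl).
    exists ((lead_deg x nu, f) :: gl); split=> [y|nu' [<-|/glP[f' [f'0 f'l f'L]]]].
    - by rewrite inE => /orP[/eqP->|/glL].
    - by exists f; rewrite inE eqxx.
    - by exists f'; rewrite inE f'L orbT.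
  exists gl; split=> // nu f f0 fl fL; have [|nu' nus le] := sP nu; first by exists f.
  by have [f' [f'0 f'l f'L]] := glP nu' nus; exists nu', f'.
exists (flatten [seq gl x | x <- U]); split=> [y /flatten_mapP[x xU yx]|L' sL' tL' ZL' LG' gL'].
  by have [glL _] := glP x; apply: glL.
suff main u g x : mlead x = u -> L g x -> L' g x by move=> g x; exact: main.
elim/(well_founded_ind (@ltom_wf n)): u g x => u IH g x xu Lx.
have [->|x0] := eqVneq x 0; first exact: (gsub0 sL').
have [] := LG _ _ Lx (mlead x); first by rewrite mleadc_eq0.
case: g Lx => [a w] Lx m /= [am um uw].
have [u0 [m0 [nu [U0 uE mE]]]] := UP m (mlead x) um.
pose nu1 i := if i is Some j then nu (Some j) else `|w - (mlead x l)%:Z|%N.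
have ymE : ymonom nu1 = ymonom nu by [].
have gE : (a, w) = lead_deg (u0, m0) nu1.
  rewrite /lead_deg ymE /= -uE -mE -am; congr (_, _).
  by rewrite gez0_abs ?subr_ge0 // addrCA subrr addr0.
have [_ /(_ nu1 x x0)] := glP (u0, m0); rewrite {1}/lm ymE -gE => /(_ uE Lx).
move=> [nu' [f [le f0 fl fgl]]].
pose mu i := (nu1 i - nu' i)%N.
pose h : S := 'X_[ymonom mu] * f.
have ymD : ymonom nu1 = (ymonom nu' + ymonom mu)%MM.
  rewrite /ymonom -big_split; apply: eq_bigr => j _; apply/mnmP=> i.
  by rewrite mnmDE !mulmnE -mulnDr subnKC.
have Lh (M : D -> S -> Prop) : gsub ymon ydeg M -> weight_mono M ->
    M (lead_deg (u0, m0) nu') f -> M (a, w) h.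
  move=> sM tM Mf; have := weight_mono_add (mu None) tM (gsub_ymonom mu sM Mf).
  have sE : (\sum_j nu1 (Some j) = \sum_j nu' (Some j) + \sum_j mu (Some j))%N.
    by rewrite -big_split; apply: eq_bigr => j _; rewrite /= subnKC // (le (Some j)).
  have nE : nu1 None = (nu' None + mu None)%N by rewrite subnKC.
  congr M; rewrite gE ydeg_sum /lead_deg ymD !mnmDE sE nE.
  rewrite [LHS]surjective_pairing; congr (_, _) => /=; clear; lia.
have X0 : 'X_[ymonom mu] != 0 :> S by rewrite -msupp_eq0 msuppX.
have h0 : h != 0 by rewrite mulf_neq0.
have hl : mlead h = mlead x.
  by rewrite mleadM // mleadXm fl uE -ymE ymD /lm /= addmC addmA.
have L'f : L' (lead_deg (u0, m0) nu') f.
  by apply: (gL' (lead_deg (u0, m0) nu', f)); apply/flatten_mapP; exists (u0, m0).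
have Lf : L (lead_deg (u0, m0) nu') f.
  by have [glL _] := glP (u0, m0); apply: (glL _ fgl).
set a1 := x@_(mlead x) / h@_(mlead h).
have -> : x = (x - a1 *: h) + a1 *: h by rewrite subrK.
apply: (gsubD sL'); last by apply: (gsubZ sL'); apply: Lh.
have [->|lt] := mlead_reduce x0 h0 (esym hl); first exact: (gsub0 sL').
apply: (IH (mlead (x - a1 *: h))) => //; first by rewrite -xu.
by apply: (gsubB sL) => //; apply: (gsubZ sL); apply: Lh.
Qed.

End Rees.

(** * From the initial ideal back to the ideal *)

Section InitialIdeal.
Variables (k : fieldType) (n r : nat) (A : 'M[int]_(r, n)).
Local Notation S := {mpoly k[n]}.
Local Notation deg := (mon_deg A).
Implicit Types (u v : 'X_{1..n}) (f : S) (I : S -> Prop).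

Record is_ideal I : Prop := {
  is_ideal0 : I 0;
  is_idealD : forall f g, I f -> I g -> I (f + g);
  is_idealM : forall a f, I f -> I (a * f)
}.

Lemma is_idealZ I a f : is_ideal I -> I f -> I (a *: f).
Proof. by move=> iI If; rewrite -mul_mpolyC; apply: is_idealM. Qed.

(** With [w] the degree this is homogeneity; with [w] an exponent it is homogeneity in one
    variable. *)
Definition stable_filter (T : eqType) (w : 'X_{1..n} -> T) I : Prop :=
  forall f t, I f -> I (mfilter (fun u => w u == t) f).

Definition hpoly (p : 'cV[int]_r) f : Prop := supported (fun u => deg u = p) f.
Definition hideal I (p : 'cV[int]_r) f : Prop := hpoly p f /\ I f.

Lemma gsub_hpoly N (eta : 'I_N -> 'X_{1..n}) (dz : 'I_N -> 'cV[int]_r) :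
  (forall j, deg (eta j) = dz j) -> gsub (fun j => 'X_[eta j] : S) dz hpoly.
Proof.
move=> de; split=> [g|g x y|g a x|g j x Gx]; [exact: supported0|exact: supportedD|exact: supportedZ|].
by apply: supportedXM Gx _ => u <-; rewrite mon_degD de addrC.
Qed.

Lemma gsub_hideal I N (eta : 'I_N -> 'X_{1..n}) (dz : 'I_N -> 'cV[int]_r) : is_ideal I ->
  (forall j, deg (eta j) = dz j) -> gsub (fun j => 'X_[eta j] : S) dz (hideal I).
Proof.
move=> iI de; have sG := gsub_hpoly de.
split=> [g|g x y [? ?] [? ?]|g a x [? ?]|g j x [? ?]].
- by split; [exact: (gsub0 sG)|exact: is_ideal0].
- by split; [exact: (gsubD sG)|exact: is_idealD].
- by split; [exact: (gsubZ sG)|exact: is_idealZ].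
- by split; [exact: (gsubM sG)|exact: is_idealM].
Qed.

Variable l : 'I_n.

(* The span of the forms of highest degree in x_l of the elements of I. *)
Definition init_ideal I f : Prop := forall w : nat, exists g,
  [/\ I g, supported (fun u => (u l <= w)%N) g & forall u, u l = w -> g@_u = f@_u].

Lemma mpoly_ideal_ind I : I 0 -> (forall f g, I f -> I g -> I (f + g)) ->
  (forall a f, I f -> I (a *: f)) -> (forall u f, I f -> I ('X_[u] * f)) -> is_ideal I.
Proof.
move=> I0 ID IZ IX; split=> // a f If; rewrite [a]mpolyE mulr_suml.
by apply: big_ind => // u _; rewrite -scalerAl; apply: IZ; apply: IX.
Qed.

Lemma init_is_ideal I : is_ideal I -> is_ideal (init_ideal I).
Proof.
move=> iI; apply: mpoly_ideal_ind => [w|f g If Ig w|a f If w|v f If w].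
- by exists 0; split=> [||//]; [exact: is_ideal0 | exact: supported0].
- have [f' [If' sf ff]] := If w; have [g' [Ig' sg gg]] := Ig w.
  exists (f' + g'); split; [exact: is_idealD|exact: supportedD|].
  by move=> u uw; rewrite !mcoeffD ff // gg.
- have [f' [If' sf ff]] := If w; exists (a *: f').
  split; [exact: is_idealZ|exact: supportedZ|by move=> u uw; rewrite !mcoeffZ ff].
have [vw|wv] := leqP (v l) w; last first.
  exists 0; split=> [||u uw]; [exact: is_ideal0 | exact: supported0 |].
  rewrite mcoeff0 mcoeffXM; case: ifP => // /mnm_lepP/(_ l).
  by rewrite uw leqNgt wv.
have [f' [If' sf ff]] := If (w - v l)%N; exists ('X_[v] * f').
split; [exact: is_idealM| |].
  by apply: supportedXM sf _ => u ul; rewrite mnmDE -leq_subRL.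
move=> u uw; rewrite !mcoeffXM; case: ifP => // vu; apply: ff.
by rewrite mnmBE uw.
Qed.

Lemma init_stable (T : eqType) (w : 'X_{1..n} -> T) I :
  stable_filter w I -> stable_filter w (init_ideal I).
Proof.
move=> sI f t If m; have [g [Ig sg gf]] := If m.
exists (mfilter (fun u => w u == t) g); split; first exact: sI.
  by move=> u; rewrite mcoeff_filter; case: ifP => _; [exact: sg | rewrite eqxx].
by move=> u um; rewrite !mcoeff_filter gf.
Qed.

Lemma init_stable_self I : is_ideal I -> stable_filter (fun u => u l) (init_ideal I).
Proof.
move=> iI f t If m; have [tm|tm] := eqVneq t m; last first.
  exists 0; split=> [||u um]; [exact: is_ideal0 | exact: supported0 |].
  by rewrite mcoeff0 mcoeff_filter um eq_sym (negbTE tm).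
have [g [Ig sg gf]] := If m; exists g; split=> // u um.
by rewrite mcoeff_filter um tm eqxx gf.
Qed.

Variables (N : nat) (eta : 'I_N -> 'X_{1..n}) (alpha : 'cV[int]_r).
Hypothesis deg_eta : forall j, deg (eta j) = alpha.
Hypothesis fib : forall q, exists s : seq 'X_{1..n}, uniq s /\ forall u, (u \in s) = (deg u == q).
Hypothesis divis : forall p, exists k0 : nat, forall m, (k0 <= m)%N ->
  forall u, deg u = p + alpha *+ m -> exists j, (eta j <= u)%MM.
Variable p : 'cV[int]_r.
Local Notation y := (ymon k eta).
Local Notation wt := (yweight eta l).
Local Notation dy := (ydeg eta l).
Local Notation da := (fun _ : 'I_N => alpha).
Local Notation G := (rees (k := k) A alpha p l).

Definition rees_ideal I (g : int * int) f : Prop := G g f /\ I f.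

Let wJ (J : {set 'I_N}) : int := \sum_(j in J) wt j.

Lemma reesE (w : int) (J : {set 'I_N}) a f :
  G ((0, w) + kdeg dy J *+ a) f <->
  supported (fun u => deg u = p + kdeg da J *+ a /\ (u l)%:Z <= w + wJ J *+ a) f.
Proof.
have -> : (0, w) + kdeg dy J *+ a = ((#|J| * a)%N%:Z, w + wJ J *+ a) :> (int * int)%type.
  have -> : kdeg dy J = (#|J|%:Z, wJ J).
    rewrite /kdeg /wJ -sum1_card; elim/big_rec3: _ => [//|j x1 x2 x3 _ ->].
    by rewrite PoszD.
  elim: a => [|a IH]; first by rewrite muln0 !mulr0n !addr0.
  rewrite !mulrSr !addrA IH mulnS PoszD [RHS]surjective_pairing /=.
  by congr (_, _); rewrite addrC.
have E : kdeg da J *+ a = alpha *+ (#|J| * a) by rewrite /kdeg sumr_const mulrnA.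
rewrite E; split; apply: supportedW => u.
  by move=> [m /= [[<-] um uw]].
by move=> [um uw]; exists (#|J| * a)%N.
Qed.

Let flt (w : int) : S -> S := mfilter (fun u => (u l)%:Z == w).

Lemma flt_kdiff w a c (J : {set 'I_N}) :
  flt (w + wJ J *+ a) (kdiff y a c J) =
  kdiff y a (fun J => flt (w + wJ J *+ a) (c J)) J.
Proof.
rewrite /kdiff /flt (big_morph _ (mfilterD _) (_ : mfilter _ 0 = 0)); last first.
  by apply/mpolyP=> u; rewrite mcoeff_filter mcoeff0; case: ifP.
apply: eq_bigr => j jJ.
have sE x : ksign S j J * x = ((-1) ^+ #|[set j' in J | (j' < j)%N]| : k) *: x.
  by rewrite /ksign -mul_mpolyC rmorphXn /= mpolyCN mpolyC1.
rewrite !sE mfilterZ; congr (_ *: _); rewrite /ymon mpolyXn; apply: mfilterXM => u.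
rewrite mnmDE mulmnE PoszD /wJ (big_setD1 j) //= mulrnDl addrCA PoszM -mulrzz -pmulrn.
by rewrite (inj_eq (addrI _)).
Qed.

Lemma flt_raise w a e x (J : {set 'I_N}) :
  flt (w + wJ J *+ (a + e)) (kprod y J ^+ e * x) = kprod y J ^+ e * flt (w + wJ J *+ a) x.
Proof.
have -> : kprod y J = 'X_[(\sum_(j in J) eta j)%MM] by rewrite /kprod -mprodXE.
rewrite mpolyXn; apply: mfilterXM => u.
rewrite mnmDE mulmnE mnm_sumE PoszD PoszM -mulrzz -pmulrn mulrnDr.
have -> : Posz (\sum_(j in J) eta j l) = wJ J by rewrite /wJ (big_morph Posz PoszD erefl).
by rewrite addrA [X in X == _]addrC (inj_eq (addIr _)).
Qed.

Lemma gsub_reesI I : is_ideal I -> gsub y dy (rees_ideal I).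
Proof.
move=> iI; have sG := @gsub_rees k n r A N eta alpha deg_eta p l.
split=> [g|g x x' [? ?] [? ?]|g a x [? ?]|g j x [? ?]].
- by split; [exact: (gsub0 sG)|exact: is_ideal0].
- by split; [exact: (gsubD sG)|exact: is_idealD].
- by split; [exact: (gsubZ sG)|exact: is_idealZ].
- by split; [exact: (gsubM sG)|exact: is_idealM].
Qed.

(** The Rees module of [I] plus the Rees parameter times [G]: modulo this, [G] is the associated
    graded module of S/I. *)
Definition rees_init I (g : int * int) f : Prop :=
  exists x1 x2, [/\ rees_ideal I g x1, G (g - (0, 1)) x2 & f = x1 + x2].

Lemma gsub_rees_init I : is_ideal I -> gsub y dy (rees_init I).
Proof.
move=> iI; have sG := @gsub_rees k n r A N eta alpha deg_eta p l.
have sZ := gsub_reesI iI.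
split=> [g|g x x' [u [v [? ? ->]]] [u' [v' [? ? ->]]]|g a x [u [v [? ? ->]]]|g j x [u [v [? ? ->]]]].
- by exists 0, 0; split; [exact: (gsub0 sZ)|exact: (gsub0 sG)|rewrite addr0].
- by exists (u + u'), (v + v'); split; [exact: (gsubD sZ)|exact: (gsubD sG)|rewrite addrACA].
- by exists (a *: u), (a *: v); split; [exact: (gsubZ sZ)|exact: (gsubZ sG)|rewrite scalerDr].
- exists (y j * u), (y j * v); split; [exact: (gsubM sZ)| |by rewrite mulrDr].
  by rewrite addrAC; exact: (gsubM sG).
Qed.

Lemma rees_lower (w : int) f P : supported (fun u => deg u = P /\ (u l)%:Z <= w) f ->
  supported (fun u => deg u = P /\ (u l)%:Z <= w - 1) (f - flt w f).
Proof.
move=> sf u; rewrite mcoeffB mcoeff_filter; case: ifPn => [_|uw]; first by rewrite subrr eqxx.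
by rewrite subr0 => /sf[-> uw']; split=> //; lia.
Qed.

(* In weight w, the graded piece of S/I for the filtration by degree in x_l is
   the weight w part of the quotient by the initial ideal. *)
Lemma Hvan_gr I m w : is_ideal I -> stable_filter deg I ->
  Hvan y da hpoly (hideal (init_ideal I)) m p -> Hvan y dy G (rees_init I) m (0, w).
Proof.
move=> iI hI H a c Gc Wc.
have reesB1 (w' : int) (J : {set 'I_N}) a' f : G ((0, w') + kdeg dy J *+ a' - (0, 1)) f <->
    supported (fun u => deg u = p + kdeg da J *+ a' /\ (u l)%:Z <= w' + wJ J *+ a' - 1) f.
  have -> : (0, w') + kdeg dy J *+ a' - (0, 1) = (0, w' - 1) + kdeg dy J *+ a' :> (int * int)%type.
    by rewrite addrAC.
  by rewrite [w' + _ - 1]addrAC; apply: reesE.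
(* The part of the numerator whose fraction has weight exactly [w], the denominator accounting for
   the shift by [wJ J *+ a]. *)
pose c' J := flt (w + wJ J *+ a) (c J).
have [||e [b [Gb Zb]]] := H a c'.
- move=> J cJ u; rewrite mcoeff_filter; case: ifP => _; last by rewrite eqxx.
  by move=> /(proj1 (reesE _ _ _ _) (Gc J cJ) u)[].
- move=> J cJ; rewrite -flt_kdiff; have [x1 [x2 [[/reesE Gx1 Ix1] /reesB1 Gx2 ->]]] := Wc J cJ.
  have -> : flt (w + wJ J *+ a) (x1 + x2) = flt (w + wJ J *+ a) x1.
    apply/mpolyP => u; rewrite !mcoeff_filter mcoeffD; case: eqVneq => // uw.
    have [->|/Gx2[_]] := eqVneq x2@_u 0; first by rewrite addr0.
    by rewrite uw; lia.
  split=> [u|w'].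
    by rewrite mcoeff_filter; case: ifP => _; [move=> /Gx1[] | rewrite eqxx].
  have [ww|ww] := eqVneq (w + wJ J *+ a) w'%:Z.
    exists x1; split=> //; first by apply: supportedW Gx1 => u [_]; rewrite ww.
    by move=> u uw; rewrite mcoeff_filter uw ww eqxx.
  exists 0; split; [exact: is_ideal0 | exact: supported0 |].
  by move=> u uw; rewrite mcoeff0 mcoeff_filter uw eq_sym (negbTE ww).
pose b' J := flt (w + wJ J *+ (a + e)) (b J).
exists e, b'; split=> J cJ.
  apply/reesE => u; rewrite mcoeff_filter; case: ifPn => [/eqP->|_]; last by rewrite eqxx.
  by move=> /(Gb J cJ u).
pose W := w + wJ J *+ (a + e); pose P := p + kdeg da J *+ (a + e).
have [hX IX] := Zb J cJ; set X := _ - _ in hX IX.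
have FX : flt W X = kprod y J ^+ e * c' J - kdiff y (a + e) b' J.
  have cc : flt (w + wJ J *+ a) (c' J) = c' J.
    by apply/mpolyP=> u; rewrite /c' !mcoeff_filter; case: ifP => // ->.
  have fB x1 x2 : flt W (x1 - x2) = flt W x1 - flt W x2.
    by rewrite /flt mfilterD -scaleN1r mfilterZ scaleN1r.
  by rewrite /X fB flt_raise cc flt_kdiff.
have -> : kprod y J ^+ e * c J - kdiff y (a + e) b' J =
    kprod y J ^+ e * (c J - c' J) + flt W X by rewrite FX; ring.
have low : supported (fun u => deg u = P /\ (u l)%:Z <= W - 1) (kprod y J ^+ e * (c J - c' J)).
  rewrite mulrBr /c' -flt_raise; apply: (@rees_lower W).
  have : G ((0, w) + kdeg dy J *+ (a + e)) (kprod y J ^+ e * c J).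
    by rewrite mulrnDr addrA; apply: gsub_kprod (Gc J cJ); exact: gsub_rees.
  by move/reesE.
(* A negative weight is the exponent of no monomial, and then the top part is zero. *)
have [[w' Ww]|nW] := pselect (exists w' : nat, W = w'%:Z); last first.
  have -> : flt W X = 0.
    apply/mpolyP=> u; rewrite mcoeff_filter mcoeff0; case: eqVneq => // uW.
    by case: nW; exists (u l).
  exists 0, (kprod y J ^+ e * (c J - c' J)); rewrite addr0 add0r; split=> //.
    exact: (gsub0 (gsub_reesI iI)).
  exact/reesB1.
(* An element of [I] with the same top form as the error; their difference has lower weight and is
   absorbed by the Rees parameter. *)
have [g [Ig sg gX]] := IX w'.
pose g' := mfilter (fun u => deg u == P) g.
exists g', (kprod y J ^+ e * (c J - c' J) + (flt W X - g')); split.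
- split; last exact: hI.
  apply/reesE => u; rewrite mcoeff_filter; case: ifPn => [/eqP->|_]; last by rewrite eqxx.
  by move=> /sg; rewrite -/W Ww.
- apply/reesB1; apply: supportedD => // u; rewrite mcoeffB !mcoeff_filter.
  have [uP|nP] := eqVneq (deg u) P; last first.
    have [X0|/hX//] := eqVneq X@_u 0.
      by rewrite X0 subr0; case: ifP; rewrite eqxx.
    by move=> e'; case/eqP: nP.
  case: ifPn => [/eqP uW|uW]; first by rewrite gX ?subrr ?eqxx //; move: uW; rewrite Ww => -[].
  rewrite sub0r oppr_eq0 => /sg ul; split=> //; rewrite -/W; lia.
- by rewrite addrCA [g' + _]addrC subrK.
Qed.

(** Induction on the weight: [rees_init] modulo [rees_ideal] is a copy of the module one weight
    lower, and the quotient by [rees_init] is covered by [Hvan_gr]. Low weights start the induction,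
    and any given cochain lives in some finite weight. *)
Theorem Hvan_init I m : is_ideal I -> stable_filter deg I ->
  Hvan y da hpoly (hideal (init_ideal I)) m p -> Hvan y da hpoly (hideal I) m p.
Proof.
move=> iI hI H.
have sG := @gsub_rees k n r A N eta alpha deg_eta p l; have sZ := gsub_reesI iI.
have sW := gsub_rees_init iI.
have tG := @rees_mono k n r A alpha p l.
have tZ : weight_mono (rees_ideal I) by move=> g x [Gx Ix]; split=> //; apply: tG.
have [|_ /(_ 0)[w0 low]] := Hvan_high_low (s := N) sG sZ (fun g x => @proj1 _ _) tG tZ
    (@rees_noetherian k n r A N eta alpha deg_eta fib divis p l _).
  by move=> j; rewrite leqNgt ltn_ord.
have all_w (e : nat) : Hvan y dy G (rees_ideal I) m (0, w0 - 1 + e%:Z).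
  elim: e => [|e IH]; first by apply: low; lia.
  have dE : (0, w0 - 1 + e.+1%:Z) = (0, w0 - 1 + e%:Z) + (0, 1) :> (int * int)%type.
    by rewrite [RHS]surjective_pairing /= addr0; congr (_, _); lia.
  apply: (@Hvan_ext _ _ _ _ _ _ _ (rees_init I)) => //.
  - by move=> g x Zx; exists x, 0; split=> //; [exact: (gsub0 sG)|rewrite addr0].
  - move=> g x [x1 [x2 [[Gx1 _] Gx2 ->]]]; apply: (gsubD sG) => //.
    by rewrite -[g](subrK (0, 1)); apply: tG.
  - rewrite dE; apply: (@Hvan_iso _ _ _ _ _ _ G (rees_ideal I) _ _ 1) => //.
    + move=> g x Gx; rewrite mul1r; exists 0, x; split; rewrite ?addrK ?add0r //.
      exact: (gsub0 sZ).
    + move=> g x [x1 [x2 [Zx1 Gx2 ->]]]; exists x2; first by rewrite addrK in Gx2.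
      by rewrite mul1r addrK.
    + by move=> g x Gx; rewrite mul1r; split=> -[? ?]; split=> //; apply: tG.
  - exact: Hvan_gr.
move=> a c Gc Zc.
(* [M] bounds the [x_l]-exponents of all the values of [c], so that [c] is a cochain of weight
   [w]. *)
pose M := (\sum_(J : {set 'I_N}) \sum_(u <- msupp (c J)) u l)%N.
pose w := w0 - 1 + (M + `|w0 - 1|)%N%:Z.
have wJ0 J : 0 <= wJ J by apply: sumr_ge0.
have Gc' : kcochain dy G m (0, w) a c.
  move=> J cJ; apply/reesE => u cu; split; first exact: (Gc J cJ).
  have : (u l <= M)%N.
    rewrite /M (bigD1 J) //= (bigD1_seq u) ?msupp_uniq ?mcoeff_msupp //=.
    by rewrite -addnA; apply: leq_addr.
  have : 0 <= wJ J *+ a by rewrite mulrn_wge0.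
  rewrite /w; lia.
have [||e [b [Gb Zb]]] := all_w (M + `|w0 - 1|)%N a c => //.
  move=> J cJ; split; last by have [] := Zc J cJ.
  apply: gsub_kdiff => // j jJ; apply: Gc'; exact: card_setD1 cJ.
exists e, b; split=> J cJ.
  by move=> u bu; have /reesE/(_ u bu)[] := Gb J cJ.
have [/reesE h Ix] := Zb J cJ; split=> // u /h[] //.
Qed.

End InitialIdeal.

(** * Monomial bases *)

Section MonomialBasis.
Variables (k : fieldType) (n r : nat) (A : 'M[int]_(r, n)).
Local Notation S := {mpoly k[n]}.
Local Notation deg := (mon_deg A).
Implicit Types (u v : 'X_{1..n}) (f g : S) (I J : S -> Prop).

Definition monomial_basis I t (U : seq 'X_{1..n}) : Prop :=
  (forall f, hpoly A t f -> exists2 g, supported (fun u => u \in U) g & I (f - g)) /\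
  (forall g, supported (fun u => u \in U) g -> I g -> g = 0).

Lemma supported_filter P (C : pred 'X_{1..n}) f :
  supported P f -> supported P (mfilter C f : S).
Proof. by move=> Pf u; rewrite mcoeff_filter; case: ifP => _; [exact: Pf | rewrite eqxx]. Qed.

(** Macaulay's argument, with degree in [x_l] in place of a term order: the top form of a relation
    lies in the initial ideal, and top forms are removed one after the other to prove generation. *)
Lemma monomial_basis_init l I t U : is_ideal I -> stable_filter deg I ->
  (forall u, u \in U -> deg u = t) ->
  monomial_basis (init_ideal l I) t U -> monomial_basis I t U.
Proof.
move=> iI hI Ut [span indep]; split; last first.
  move=> g gU Ig; apply/eqP; apply: contraT => g0.
  pose w := (\max_(u <- msupp g) u l)%N.
  have [u ug uw] : exists2 u, u \in msupp g & u l = w.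
    have := mlead_supp g0; move: (mlead g) => v vg.
    have : (0 < size (msupp g))%N by case: (msupp g) vg.
    rewrite /w; elim: (msupp g) => // x s IH _.
    case: s IH => [|y s] IH; first by exists x; rewrite ?inE // big_seq1.
    rewrite big_cons; have [//|u us <-] := IH.
    have [le|lt] := leqP (x l) (u l).
      by exists u => //; rewrite in_cons us orbT.
    by exists x => //; rewrite in_cons eqxx.
  have : mfilter (fun u => u l == w) g = 0.
    apply: indep; first exact: supported_filter.
    move=> w'; have [->|nw] := eqVneq w' w; last first.
      exists 0; split; [exact: is_ideal0|exact: supported0|].
      by move=> v vw; rewrite mcoeff0 mcoeff_filter vw (negbTE nw).
    exists g; split=> //.
      by move=> v; rewrite -mcoeff_msupp => vg; apply: leq_bigmax_seq.
    by move=> v vw; rewrite mcoeff_filter vw eqxx.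
  move/mpolyP/(_ u); rewrite mcoeff_filter uw eqxx mcoeff0 => /eqP.
  by rewrite mcoeff_eq0 ug.
move=> f ft.
have [W] : exists W, supported (fun u => (u l < W)%N) f.
  exists (\sum_(u <- msupp f) u l).+1%N => u; rewrite -mcoeff_msupp => uf.
  by rewrite ltnS (big_rem u) //= leq_addr.
elim: W f ft => [|W IH] f ft fW.
  exists 0; first exact: supported0.
  rewrite subr0 (_ : f = 0); first exact: is_ideal0.
  by apply/mpolyP=> u; rewrite mcoeff0; apply/eqP; apply: contraT => /fW.
pose fW' := mfilter (fun u => u l == W) f.
have [|g0 g0U Ig0] := span fW'; first exact: supported_filter.
(* Only the part of degree [W] in [x_l] is kept, so that the next remainder has degree below [W]. *)
pose g1 := mfilter (fun u => u l == W) g0.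
have g1U : supported (fun u => u \in U) g1 by exact: supported_filter.
have : init_ideal l I (fW' - g1).
  have := @init_stable_self _ _ l _ iI _ W Ig0; congr init_ideal.
  apply/mpolyP=> u; rewrite !(mcoeffB, mcoeff_filter).
  by case: eqVneq; rewrite ?subr0.
move=> /(_ W)[h [Ih hW hE]].
pose h' := mfilter (fun u => deg u == t) h.
have Ih' : I h' by exact: hI.
have g1t : hpoly A t g1 by apply: supportedW g1U.
have h't : hpoly A t h'.
  by move=> u; rewrite mcoeff_filter; case: ifPn => [/eqP//|_]; rewrite eqxx.
have [||g2 g2U Ig2] := IH (f - g1 - h').
- by do 2?apply: supportedB.
- move=> u u0; rewrite ltn_neqAle.
  have [ut|/eqP nt] := eqVneq (deg u) t; last first.
    by case: nt; move: u0; apply: (_ : hpoly A t _); do 2?apply: supportedB.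
  apply/andP; split; last first.
    move: u0; apply: (_ : supported (fun u => (u l <= W)%N) _).
    apply: supportedB; last exact: supported_filter.
    apply: supportedB => // v; rewrite mcoeff_filter; case: ifPn => [/eqP->//|_].
    by rewrite eqxx.
  apply: contraNneq u0 => uW; rewrite !mcoeffB mcoeff_filter uW eqxx mcoeff_filter ut eqxx.
  by rewrite hE // mcoeffB !mcoeff_filter uW eqxx subrr.
exists (g1 + g2); first exact: supportedD.
have -> : f - (g1 + g2) = (f - g1 - h' - g2) + h' by ring.
exact: is_idealD.
Qed.

Definition init_seq I (ls : seq 'I_n) : S -> Prop := foldl (fun I l => init_ideal l I) I ls.

Lemma init_seq_ideal I ls : is_ideal I -> stable_filter deg I ->
  [/\ is_ideal (init_seq I ls), stable_filter deg (init_seq I ls)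
    & forall l, l \in ls -> stable_filter (fun u => u l) (init_seq I ls)].
Proof.
rewrite /init_seq; elim/last_ind: ls => // ls l IH iI hI; rewrite foldl_rcons.
have [iI' hI' sI'] := IH iI hI; split; [exact: init_is_ideal|exact: init_stable|].
move=> l'; rewrite mem_rcons inE => /orP[/eqP->|/sI' s]; first exact: init_stable_self.
exact: init_stable.
Qed.

Lemma monomial_basis_seq I ls t U : is_ideal I -> stable_filter deg I ->
  (forall u, u \in U -> deg u = t) ->
  monomial_basis (init_seq I ls) t U -> monomial_basis I t U.
Proof.
rewrite /init_seq; elim: ls I => //= l ls IH I iI hI Ut H.
apply: (monomial_basis_init (l := l)) => //; apply: IH => //; [exact: init_is_ideal|exact: init_stable].
Qed.

(** Projecting onto the exponents of [v], one variable at a time, isolates the term at [v]. *)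
Lemma stable_monomial J f v : is_ideal J -> (forall l, stable_filter (fun u => u l) J) ->
  J f -> f@_v != 0 -> J 'X_[v].
Proof.
move=> iJ sJ Jf fv.
have Js ls : J (mfilter (fun u => all (fun l => u l == v l) ls) f).
  elim: ls => [|l ls IH].
    suff -> : mfilter (fun u => all (fun l => u l == v l) [::]) f = f by [].
    by apply/mpolyP=> u; rewrite mcoeff_filter.
  have := sJ l _ (v l) IH; congr J; apply/mpolyP=> u; rewrite !mcoeff_filter /=.
  by case: eqP.
have := Js (enum 'I_n).
have -> : mfilter (fun u => all (fun l => u l == v l) (enum 'I_n)) f = f@_v *: 'X_[v].
  apply/mpolyP=> u; rewrite mcoeff_filter mcoeffZ mcoeffX.
  case: ifPn => [/allP uv|nuv].
    have -> : u = v by apply/mnmP => l; apply/eqP/uv; rewrite mem_enum.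
    by rewrite eqxx mulr1.
  case: eqVneq => [e|_]; last by rewrite mulr0.
  by case/allP: nuv => l _; rewrite e.
by move=> /(is_idealZ (f@_v)^-1 iJ); rewrite scalerA mulVf // scale1r.
Qed.

Lemma monomial_basis_mon J t U : is_ideal J -> (forall l, stable_filter (fun u => u l) J) ->
  (forall u, (u \in U) <-> (deg u = t /\ ~ J 'X_[u])) -> monomial_basis J t U.
Proof.
move=> iJ sJ UP; split=> [f ft|g gU Jg]; last first.
  apply/mpolyP=> u; rewrite mcoeff0; apply/eqP; apply: contraT => gu.
  have [_ []] := proj1 (UP u) (gU u gu); exact: stable_monomial gu.
exists (mfilter (fun u => u \in U) f).
  by move=> u; rewrite mcoeff_filter; case: ifP => //; rewrite eqxx.
set h := f - _; rewrite [h]mpolyE big_seq; apply: big_ind; [exact: is_ideal0|exact: is_idealD|].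
move=> u; rewrite mcoeff_msupp => hu; apply: is_idealZ => //.
move: hu; rewrite /h mcoeffB mcoeff_filter; case: ifPn => [_|nu]; first by rewrite subrr eqxx.
rewrite subr0 => /ft ut; apply: contrapT => nJ; case/negP: nu; exact/UP.
Qed.

End MonomialBasis.

Section Dimension.
Variables (k : fieldType) (n r : nat) (A : 'M[int]_(r, n)) (I : ideal k n).
Local Notation S := {mpoly k[n]}.

Lemma ideal_is_ideal : is_ideal (fun f : S => f \in I).
Proof.
split; [exact: (rpred0 I)|by move=> f g; apply: rpredD|].
by move=> a f If; exact: (@rpredZ _ _ I a f If).
Qed.

Lemma quot_pi0 (f : S) : quot_pi I f = 0 <-> f \in I.
Proof.
have {2}-> : f = f - 0 by rewrite subr0.
by rewrite -quot_piP /quot_pi raddf0.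
Qed.

Lemma quot_pi_sum (N : nat) (a : 'I_N -> k) (f : 'I_N -> S) :
  \sum_i (a i)%:MP *: quot_pi I (f i) = quot_pi I (\sum_i a i *: f i).
Proof.
rewrite /quot_pi raddf_sum; apply: eq_bigr => i _; rewrite -mul_mpolyC.
exact: quot_scaleE.
Qed.

(** [B] holds the coordinates of the given vectors in the monomial basis: uniqueness of expression
    makes it row free, and generation gives it a left inverse. *)
Lemma has_dim_basis t U N : uniq U -> (forall u, u \in U -> mon_deg A u = t) ->
  monomial_basis A (fun f : S => f \in I) t U ->
  has_dim (quot_grading A (I := I) t) N -> N = size U.
Proof.
move=> uU Ut [span indep] [v [vt vP]].
have iI := ideal_is_ideal.
have /choice[f fP] : forall i, exists f, homogeneous A t f /\ v i = quot_pi I f.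
  by move=> i; have [f ft ->] := vt i; exists f.
have /choice[g gP] : forall i, exists g, supported (fun u => u \in U) g /\ f i - g \in I.
  by move=> i; have [|g gU Ig] := span (f i); [apply/homogeneousP; case: (fP i) | exists g].
have vE i : v i = quot_pi I (g i).
  by have [_ ->] := fP i; apply/quot_piP; case: (gP i).
pose Uj (j : 'I_(size U)) := nth 0%MM U j.
pose B := \matrix_(i < N, j < size U) (g i)@_(Uj j).
have supp_eq h h' : supported (fun u => u \in U) h -> supported (fun u => u \in U) h' ->
    (forall j, h@_(Uj j) = h'@_(Uj j)) -> h = h'.
  move=> hU hU' e; apply/mpolyP=> u; have [uUu|nu] := boolP (u \in U).
    have ju : (index u U < size U)%N by rewrite index_mem.
    by have := e (Ordinal ju); rewrite /Uj /= nth_index.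
  have z h1 : supported (fun u => u \in U) h1 -> h1@_u = 0.
    by move=> h1U; apply/eqP; apply: contraNT nu => /h1U.
  by rewrite !z.
have sumU (a : 'I_N -> k) : supported (fun u => u \in U) (\sum_i a i *: g i).
  apply: big_ind => [|x y|i _]; [exact: supported0|exact: supportedD|].
  by apply: supportedZ; case: (gP i).
have vsum (a : 'rV_N) : \sum_i (a 0 i)%:MP *: v i = quot_pi I (\sum_i a 0 i *: g i).
  by rewrite -quot_pi_sum; apply: eq_bigr => i _; rewrite vE.
have freeB : row_free B.
  apply/inj_row_free => a aB.
  have V0 : quot_grading A (I := I) t 0.
    exists 0; last by rewrite /quot_pi raddf0.
    by apply/homogeneousP; exact: supported0.
  have [a0 [_ uniq0]] := vP 0 V0.
  have s0 : \sum_i a 0 i *: g i = 0.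
    apply: supp_eq => // [|j]; first exact: supported0.
    rewrite mcoeff0 linear_sum /=; transitivity ((a *m B) 0 j); last by rewrite aB mxE.
    by rewrite mxE; apply: eq_bigr => i _; rewrite mcoeffZ mxE.
  rewrite -(uniq0 a) ?(uniq0 0) //.
    by rewrite big1 // => i _; rewrite mxE scale0r.
  by rewrite vsum s0 /quot_pi raddf0.
have [C CB] : exists C, C *m B = 1%:M.
  have /choice[C CP] : forall j, exists a : 'rV[k]_N, quot_pi I 'X_[Uj j] = \sum_i (a 0 i)%:MP *: v i.
    move=> j; have [|a [aE _]] := vP (quot_pi I 'X_[Uj j]); last by exists a.
    exists 'X_[Uj j] => //; apply/homogeneousP; apply/supportedX; apply: Ut.
    by rewrite mem_nth.
  exists (\matrix_j C j); apply/row_matrixP => j; rewrite row_mul rowK.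
  have e : \sum_i (C j) 0 i *: g i = 'X_[Uj j].
    apply/eqP; rewrite -subr_eq0; apply/eqP; apply: indep.
      by apply: supportedB => //; apply/supportedX; rewrite mem_nth.
    by apply/quot_piP; rewrite -vsum -CP.
  apply/rowP=> j'; rewrite !mxE.
  have /mpolyP/(_ (Uj j')) := e; rewrite linear_sum mcoeffX /= => e'.
  rewrite (_ : \sum_i _ = \sum_i ((C j) 0 i *: g i)@_(Uj j')); last first.
    by apply: eq_bigr => i _; rewrite mcoeffZ mxE.
  by rewrite e' nth_uniq // -val_eqE.
apply/eqP; rewrite eqn_leq; apply/andP; split.
  by move: freeB; rewrite /row_free => /eqP <-; exact: rank_leq_col.
by rewrite -(mxrank1 k (size U)) -CB; apply: leq_trans (mxrankM_maxr _ _) (rank_leq_row _).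
Qed.

End Dimension.

(** * Stanley filtrations of monomial ideals *)

Section MonomialIdeals.
Variables (k : fieldType) (n r : nat) (A : 'M[int]_(r, n)).
Local Notation S := {mpoly k[n]}.
Local Notation deg := (mon_deg A).
Implicit Types (u v : 'X_{1..n}) (f g : S) (K : 'X_{1..n} -> Prop) (i : 'I_n).

Definition upset K : Prop := forall u v, K u -> K (u + v)%MM.

Lemma upset_le K u v : upset K -> (u <= v)%MM -> K u -> K v.
Proof. by move=> uK uv Ku; rewrite -(submK uv) addmC; apply: uK. Qed.

Lemma upset_is_ideal K : upset K -> is_ideal (supported K : S -> Prop).
Proof.
move=> uK; apply: mpoly_ideal_ind => [|f g|a f|u f Kf]; [exact: supported0|exact: supportedD|exact: supportedZ|].
by apply: supportedXM Kf _ => v; rewrite addmC; apply: uK.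
Qed.

Definition coord_upset (tau : {set 'I_n}) u : Prop := exists2 i, i \notin tau & u i != 0%N.

Lemma coord_upset_upset tau : upset (coord_upset tau).
Proof. by move=> u v [i it ui]; exists i => //; rewrite mnmDE addn_eq0 (negbTE ui). Qed.

Definition colon_var K i u : Prop := K (u + U_(i))%MM.
Definition add_var K i u : Prop := K u \/ u i != 0%N.

Lemma colon_upset K i : upset K -> upset (colon_var K i).
Proof. by move=> uK u v Ku; rewrite /colon_var -addmA [(v + _)%MM]addmC addmA; apply: uK. Qed.

Lemma add_upset K i : upset K -> upset (add_var K i).
Proof.
move=> uK u v [Ku|ui]; first by left; apply: uK.
by right; rewrite mnmDE addn_eq0 (negbTE ui).
Qed.

Lemma divide_var i f : supported (fun u => u i != 0%N) f ->
  exists2 g, f = 'X_i * g & forall u, g@_u = f@_(u + U_(i)).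
Proof.
move=> fi; pose g : S := \sum_(u <- msupp f) f@_u *: 'X_[u - U_(i)].
have ui u : u \in msupp f -> (U_(i) <= u)%MM.
  by rewrite lep1mP mcoeff_msupp => /fi.
have fE : f = 'X_i * g.
  rewrite {1}[f]mpolyE /g mulr_sumr big_seq [RHS]big_seq; apply: eq_bigr => u uf.
  by rewrite -scalerAr -mpolyXD addmC submK // ui.
exists g => // u; rewrite fE mcoeffXM addmC lem_addr.
by congr (_@__); apply/mnmP=> j; rewrite mnmBE mnmDE addKn.
Qed.

Variables (N : nat) (eta : 'I_N -> 'X_{1..n}) (dz : 'I_N -> 'cV[int]_r).
Hypothesis deg_eta : forall j, deg (eta j) = dz j.
Local Notation z := (fun j => 'X_[eta j] : S).
Local Notation HK K := (Hvan z dz (hpoly A) (hideal A (supported K))).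

Lemma eq_HK K K' m p : (forall u, K u <-> K' u) -> HK K m p -> HK K' m p.
Proof.
move=> KK; apply: eq_Hvan => // g x; split=> -[gx Kx]; split=> //;
  by apply: supportedW Kx => u /KK.
Qed.

(** The exact sequence with submodule S/(K : x_i), shifted by the degree of x_i, middle term S/K and
    quotient S/(K + x_i). *)
Lemma Hvan_var_ext K i m p : upset K ->
  HK (colon_var K i) m (p - col i A) -> HK (add_var K i) m p -> HK K m p.
Proof.
move=> uK H1 H2.
have sG := @gsub_hpoly k n r A N eta dz deg_eta.
have sZ K' (uK' : upset K') := gsub_hideal (upset_is_ideal uK') deg_eta.
have uA := add_upset (i := i) uK; have uC := colon_upset (i := i) uK.
apply: (@Hvan_ext _ _ _ _ _ _ _ (hideal A (supported (add_var K i)))) => //; try exact: sZ.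
- by move=> g x [gx Kx]; split=> //; apply: supportedW Kx => u; left.
- by move=> g x [].
rewrite -[p](subrK (col i A)).
apply: (@Hvan_iso _ _ _ _ _ _ (hpoly A) (hideal A (supported (colon_var K i))) _ _ ('X_i)) H1 => //;
  try exact: sZ.
- move=> g x gx; split; last first.
    apply: (@supportedXM _ _ (fun=> True)) => // u _; right.
    by rewrite mnmDE mnm1E eqxx addn_eq0.
  by apply: supportedXM gx _ => u <-; rewrite mon_degD mon_degU addrC.
- move=> g x [gx Ax]; pose x1 := mfilter (fun u => u i != 0%N) x.
  have [|y x1E yE] := @divide_var i x1.
    by move=> u; rewrite mcoeff_filter; case: ifP => // _; rewrite eqxx.
  exists y.
    move=> u; rewrite yE mcoeff_filter; case: ifP => [_|_]; last by rewrite eqxx.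
    by move=> /gx; rewrite mon_degD mon_degU => /addIr.
  rewrite -x1E; split.
    by apply: supportedB => //; apply: supported_filter.
  move=> u; rewrite mcoeffB mcoeff_filter; case: ifPn => [_|]; first by rewrite subrr eqxx.
  by rewrite negbK subr0 => /eqP ui /Ax[//|]; rewrite ui eqxx.
- move=> g x gx; split=> -[hx Kx]; split=> //.
  + move=> u xu; have := Kx (U_(i) + u)%MM; rewrite mcoeffXM lem_addr.
    rewrite (_ : (U_(i) + u - U_(i))%MM = u) ?(addmC U_(i)%MM) => [|]; last by rewrite addmK.
    exact.
  + by apply: supportedXM hx _ => u <-; rewrite mon_degD mon_degU addrC.
  + by apply: supportedXM Kx _ => u; rewrite /colon_var addmC.
Qed.

Variable F : 'cV[int]_r -> seq 'X_{1..n}.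
Hypothesis FP : forall q, uniq (F q) /\ forall u, (u \in F q) = (deg u == q).

Definition cnt K t : nat := count (fun u => `[< ~ K u >]) (F t).

Lemma cnt_var K i t : cnt K t = (cnt (add_var K i) t + cnt (colon_var K i) (t - col i A))%N.
Proof.
rewrite /cnt.
have -> : count (fun u => `[< ~ add_var K i u >]) (F t) =
    count (fun u => `[< ~ K u >]) [seq u : 'X_{1..n} <- F t | u i == 0%N].
  rewrite count_filter; apply: eq_count => u /=; apply/asboolP/andP.
    by move=> nA; split; [apply/asboolP => Ku; apply: nA; left | apply/negPn/negP => ui; apply: nA; right].
  by move=> [/asboolP nK ui] [//|]; rewrite ui.
have -> : count (fun u => `[< ~ colon_var K i u >]) (F (t - col i A)) =
    count (fun u => `[< ~ K u >]) [seq u : 'X_{1..n} <- F t | u i != 0%N].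
  rewrite -(@count_map _ _ (fun u => u + U_(i))%MM (fun u => `[< ~ K u >])).
  apply/permP: (fun u => `[< ~ K u >]); apply: uniq_perm.
  - by rewrite map_inj_uniq; [case: (FP (t - col i A)) | exact: addIm].
  - by rewrite filter_uniq //; case: (FP t).
  - move=> u; rewrite mem_filter; have [_ ->] := FP t; apply/mapP/andP.
      move=> [v]; have [_ ->] := FP (t - col i A) => /eqP vt ->.
      rewrite mnmDE mnm1E eqxx addn1; split=> //.
      by rewrite mon_degD mon_degU vt subrK.
    move=> [ui /eqP ut]; exists (u - U_(i))%MM; last by rewrite submK // lep1mP.
    have [_ ->] := FP (t - col i A); apply/eqP.
    by rewrite -ut -{2}(@submK _ U_(i)%MM u) ?lep1mP // mon_degD mon_degU addrK.
rewrite -count_cat; apply/permP; rewrite perm_sym.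
by rewrite (perm_filterC (fun u : 'X_{1..n} => u i == 0%N)).
Qed.

End MonomialIdeals.

Lemma cat_eq_cat_cons (T : Type) (s1 s2 t1 t2 : seq T) x : s1 ++ s2 = t1 ++ x :: t2 ->
  (exists t2', s1 = t1 ++ x :: t2') \/ (exists2 t1', t1 = s1 ++ t1' & s2 = t1' ++ x :: t2).
Proof.
elim: s1 t1 => [|y s1 IH] t1 /=; first by move=> ->; right; exists t1.
case: t1 => [[-> _]|y' t1 /= [-> /IH[[t2' ->]|[t1' -> ->]]]]; first by left; exists s1.
  by left; exists t2'.
by right; exists t1'.
Qed.

Lemma map_eq_cat_cons (T U : Type) (f : T -> U) s t1 x t2 : map f s = t1 ++ x :: t2 ->
  exists s1 y s2, [/\ s = s1 ++ y :: s2, map f s1 = t1 & f y = x].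
Proof.
elim: t1 s => [|z1 t1 IH] [|y s] //= [<- e]; first by exists [::], y, s.
by have [s1 [y' [s2 [-> <- <-]]]] := IH s e; exists (y :: s1), y', s2.
Qed.

Section Stanley.
Variables (k : fieldType) (n r : nat) (A : 'M[int]_(r, n)) (Delta : {set {set 'I_n}}).
Local Notation S := {mpoly k[n]}.
Local Notation deg := (mon_deg A).
Local Notation mpair := ('X_{1..n} * {set 'I_n})%type.
Implicit Types (u v : 'X_{1..n}) (K : 'X_{1..n} -> Prop) (i : 'I_n) (tau : {set 'I_n}).
Implicit Types (x y : mpair) (L : seq mpair).

(** For an upset, the second condition says that [K] lies in the prime [coord_upset tau]. *)
Definition face_option K tau : Prop :=
  ~: tau \in Delta /\ forall u, (forall i, i \notin tau -> u i = 0%N) -> ~ K u.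

Definition mnm_min (B : nat) u : 'X_{1..n} := [multinom minn (u i) B | i < n].

(** Membership depends only on the exponents cut off at [B]. Adding or dividing by a variable keeps
    the same box, whose finitely many monomials outside [K] then serve as a termination measure. *)
Definition boxed (B : nat) K : Prop := forall u, K u <-> K (mnm_min B u).

Lemma upset_boxed K : upset K -> exists2 B, (0 < B)%N & boxed B K.
Proof.
move=> uK.
have [s [sK sP]] := dickson (fun f : 'I_n -> nat => K [multinom f i | i < n]).
have [B BP] : exists B, forall g, List.In g s -> forall i, (g i <= B)%N.
  elim: s {sK sP} => [|g s [B IH]]; first by exists 0%N.
  exists (B + \sum_i g i)%N => h [<-|hs] i; last exact: leq_trans (IH h hs i) (leq_addr _ _).
  by rewrite (bigD1 i) //= addnCA leq_addr.
exists B.+1 => // u; split=> [Ku|]; last first.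
  by apply: upset_le => //; apply/mnm_lepP => i; rewrite mnmE geq_minl.
have [|g gs gu] := sP (fun i => u i).
  by rewrite (_ : [multinom _ | _ < _] = u) //; apply/mnmP => i; rewrite mnmE.
apply: upset_le (sK g gs) => //; apply/mnm_lepP => i; rewrite !mnmE leq_min gu /=.
by rewrite leqW // BP.
Qed.

Lemma boxed_colon B K i : boxed B K -> boxed B (colon_var K i).
Proof.
move=> bK u; rewrite /colon_var.
have mE : mnm_min B (u + U_(i))%MM = mnm_min B (mnm_min B u + U_(i))%MM.
  by apply/mnmP=> j; rewrite !(mnmE, mnmDE); lia.
by split=> /bK h; apply/bK; [rewrite -mE | rewrite mE].
Qed.

Lemma boxed_add B K i : (0 < B)%N -> boxed B K -> boxed B (add_var K i).
Proof.
move=> B0 bK u; rewrite /add_var mnmE.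
have -> : (minn (u i) B != 0%N) = (u i != 0%N) by lia.
have [b1 b2] := bK u.
by split=> -[h|h]; [left; exact: b1|right|left; exact: b2|right].
Qed.

Definition box_measure B K : nat :=
  #|[set h : {ffun 'I_n -> 'I_B.+1} | `[< ~ K [multinom (h i : nat) | i < n] >]]|.

Lemma box_measure_lt B K K' u : boxed B K -> boxed B K' ->
  (forall v, K v -> K' v) -> K' u -> ~ K u -> (box_measure B K' < box_measure B K)%N.
Proof.
move=> bK bK' KK' K'u nKu; apply: proper_card; apply/properP; split.
  by apply/subsetP => h; rewrite !inE => /asboolP nK; apply/asboolP => /KK'.
pose h := [ffun i => inord (minn (u i) B)] : {ffun 'I_n -> 'I_B.+1}.
have hE : [multinom (h i : nat) | i < n] = mnm_min B u.
  by apply/mnmP=> i; rewrite !mnmE ffunE inordK // ltnS geq_minr.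
exists h; rewrite inE hE; first by apply/asboolP; rewrite -bK.
by apply/negP => /asboolP; apply; rewrite -bK'.
Qed.

Hypothesis fsub : forall sigma tau : {set 'I_n}, tau \subset sigma -> sigma \in Delta -> tau \in Delta.
Variable prec : rel {set 'I_n}.
Hypothesis prec_anti : {in Delta &, antisymmetric prec}.
Hypothesis prec_trans : {in Delta & &, transitive prec}.
Hypothesis prec_total : {in Delta &, total prec}.
Hypothesis prec_incl : forall tau i, i \notin tau -> ~: tau \in Delta -> prec (~: (i |: tau)) (~: tau).
Hypothesis deep : forall B, exists w, forall t, Ksg A Delta (t - w) -> forall u, deg u = t ->
  exists2 sigma, sigma \in Delta & forall i, (u i < B)%N -> i \in sigma.
Variables (N : nat) (eta : 'I_N -> 'X_{1..n}) (dz : 'I_N -> 'cV[int]_r).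
Hypothesis deg_eta : forall j, deg (eta j) = dz j.
Hypothesis eta_face : forall j, exists2 sigma, sigma \in Delta & forall i, (eta j i == 0%N) = (i \in sigma).
Local Notation z := (fun j => 'X_[eta j] : S).
Local Notation HK K := (Hvan z dz (hpoly A) (hideal A (supported K))).
Variable F : 'cV[int]_r -> seq 'X_{1..n}.
Hypothesis FP : forall q, uniq (F q) /\ forall u, (u \in F q) = (deg u == q).
Local Notation cnt := (cnt F).

Lemma option_min K : (exists tau, face_option K tau) -> exists2 tau, face_option K tau &
  forall tau', face_option K tau' -> prec (~: tau) (~: tau').
Proof.
move=> [tau0 o0].
have [tau [ot tP]] : exists tau, face_option K tau /\
    forall tau', tau' \in enum {: {set 'I_n}} -> face_option K tau' -> prec (~: tau) (~: tau').
  elim: (enum _) => [|tau1 s [tau [ot tP]]]; first by exists tau0.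
  have [o1|n1] := pselect (face_option K tau1); last first.
    by exists tau; split=> // tau'; rewrite inE => /orP[/eqP->//|/tP].
  have [le|le] := orP (prec_total (proj1 ot) (proj1 o1)).
    by exists tau; split=> // tau'; rewrite inE => /orP[/eqP->//|/tP].
  exists tau1; split=> // tau'; rewrite inE => /orP[/eqP-> _|ts o'].
    by have := prec_total (proj1 o1) (proj1 o1); rewrite orbb.
  exact: prec_trans (proj1 ot) (proj1 o1) (proj1 o') le (tP _ ts o').
by exists tau => // tau'; apply: tP; rewrite mem_enum.
Qed.

(** For every face, [K] contains a monomial in the variables outside it, and this monomial divides a
    power of the [eta j] whose support is the complement of that face. *)
Lemma no_option_torsion K m p : upset K -> (forall tau, ~ face_option K tau) -> HK K m.+1 p.
Proof.
move=> uK no; have sG := @gsub_hpoly k n r A N eta dz deg_eta.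
have sZ := gsub_hideal (upset_is_ideal k uK) deg_eta.
apply: Hvan_torsion => // g x j gx; have [s sD es] := eta_face j.
have [u [us Ku]] : exists u, (forall i, i \in s -> u i = 0%N) /\ K u.
  apply: contrapT => nu; apply: (no (~: s)); split; first by rewrite setCK.
  move=> u us Ku; apply: nu; exists u; split=> // i is_; apply: us.
  by rewrite inE is_.
exists (\sum_i u i)%N; split; first exact: (gsub_exp j _ sG gx).
rewrite mpolyXn; apply: (@supportedXM _ _ (fun=> True)) => // v _.
apply: (uK _ v); apply: (upset_le uK _ Ku); apply/mnm_lepP => i; rewrite mulmnE.
have [is_|ns] := boolP (i \in s); first by rewrite us.
by rewrite (bigD1 i) //= mulnDr; apply: leq_trans (leq_addr _ _); apply: leq_pmull; rewrite lt0n es.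
Qed.

(** A monomial of deep degree has large exponents off some face, hence is divisible by the monomial
    of [K] found there. *)
Lemma no_option_cnt K : upset K -> (forall tau, ~ face_option K tau) ->
  exists w, forall t, Ksg A Delta (t - w) -> cnt K t = 0%N.
Proof.
move=> uK no.
have /choice[uf ufP] : forall s : {set 'I_n}, exists u, s \in Delta ->
    (forall i, i \in s -> u i = 0%N) /\ K u.
  move=> s; have [sD|] := boolP (s \in Delta); last by exists 0%MM.
  apply: contrapT => nu; apply: (no (~: s)); split; first by rewrite setCK.
  move=> u us Ku; apply: nu; exists u; split=> // i is_; apply: us.
  by rewrite inE is_.
pose B := (\sum_s \sum_i uf s i)%N.
have [w wP] := deep B; exists w => t Kt; apply/eqP; rewrite -leqn0 leqNgt -has_count.
apply/hasP => -[u]; have [_ ->] := FP t => /eqP ut /asboolP; apply.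
have [s sD us] := wP t Kt u ut; have [ufs Ku] := ufP s sD.
apply: (upset_le uK _ Ku); apply/mnm_lepP => i.
have [is_|ns] := boolP (i \in s); first by rewrite ufs.
have : (B <= u i)%N by rewrite leqNgt; apply: contra ns; apply: us.
by apply: leq_trans; rewrite /B (bigD1 s) //= (bigD1 i) //= -addnA leq_addr.
Qed.

Definition parent y x : Prop := prec (~: y.2) (~: x.2) /\
  exists2 l, l \notin y.2 & x.1 = (y.1 + U_(l))%MM.

Definition deep_for (ws : seq 'cV[int]_r) t : Prop := forall w, w \in ws -> Ksg A Delta (t - w).

(** The list is in order of construction, not yet sorted by [prec]. Torsion pieces leave no pair, so
    cohomology is controlled from degree 1 on and the Hilbert function only in deep degrees. *)
Record stanley K L : Prop := {
  st_option : forall x, x \in L -> face_option K x.2;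
  st_head : forall x L', L = x :: L' -> x.1 = 0%MM;
  st_parent : forall L1 x L2, L = L1 ++ x :: L2 -> L1 <> [::] -> exists2 y, y \in L1 & parent y x;
  st_coh : forall m p, (forall x, x \in L -> HK (coord_upset x.2) m.+1 (p - deg x.1)) -> HK K m.+1 p;
  st_cnt : exists ws, forall t, deep_for ws t ->
    cnt K t = (\sum_(x <- L) cnt (coord_upset x.2) (t - deg x.1)%R)%N
}.

Definition shift_pairs i L : seq mpair := [seq ((x.1 + U_(i))%MM, x.2) | x <- L].

Lemma stanley_exists_box B : (0 < B)%N -> forall K, upset K -> boxed B K -> exists L, stanley K L.
Proof.
move=> B0 K; move: {2}(box_measure B K).+1 (ltnSn (box_measure B K)) => M.
elim: M K => // M IH K KM uK bK.
have [op|no] := pselect (exists tau, face_option K tau); last first.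
  have no' tau : ~ face_option K tau by move=> o; apply: no; exists tau.
  exists [::]; split=> //.
  - by move=> [].
  - by move=> m p _; apply: no_option_torsion.
  - have [w wP] := no_option_cnt uK no'; exists [:: w] => t tw.
    by rewrite big_nil; apply: wP; apply: tw; rewrite inE.
have [tau ot tmin] := option_min op.
(* [K'] is [K] with the variables already treated added; treating those of [ils] as well leads to
   the ideal of [tau]. *)
have inner (ils : seq 'I_n) : forall K', upset K' -> boxed B K' -> (forall u, K u -> K' u) ->
    (forall i, i \in ils -> i \notin tau) ->
    (forall u, (forall i, i \in ils -> u i = 0%N) -> (K' u <-> coord_upset tau u)) ->
    exists L, [/\ forall x, x \in L -> face_option K x.2,
      forall L1 x L2, L = L1 ++ x :: L2 -> parent (0%MM, tau) x \/ exists2 y, y \in L1 & parent y x,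
      forall m p, (forall x, x \in L -> HK (coord_upset x.2) m.+1 (p - deg x.1)) ->
        HK (coord_upset tau) m.+1 p -> HK K' m.+1 p
      & exists ws, forall t, deep_for ws t ->
        cnt K' t = (cnt (coord_upset tau) t + \sum_(x <- L) cnt (coord_upset x.2) (t - deg x.1)%R)%N].
  elim: ils => [|i ils IHi] K' uK' bK' KK' ist Kfin.
    have KE u : coord_upset tau u <-> K' u by rewrite Kfin.
    exists [::]; split=> //; first by move=> [].
      by move=> m p _; apply: eq_HK.
    exists [::] => t _; rewrite big_nil addn0; apply: eq_count => u.
    by congr (`[< ~ _ >]); rewrite propeqE KE.
  have it : i \notin tau by apply: ist; rewrite inE eqxx.
  have KC u : K u -> colon_var K' i u by move=> /KK' K'u; apply: uK'.
  (* The measure drops strictly. Otherwise [K] would be stable under division by [x_i], and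
     [i |: tau] would be an option, which [prec_incl] places before the least one. *)
  have [u Cu nKu] : exists2 u, colon_var K' i u & ~ K u.
    apply: contrapT => nex.
    have cK u : K (u + U_(i))%MM -> K u.
      by move=> /KK' Cu; apply: contrapT => nKu; apply: nex; exists u.
    have oi : face_option K (i |: tau).
      split; first by apply: fsub (proj1 ot); rewrite setCS subsetUr.
      move=> u us; move: {2}(u i) (erefl (u i)) => j; elim: j u us => [|j IHj] u us ui Ku.
        apply: (proj2 ot u) Ku => i' i't; have [->//|ii'] := eqVneq i' i.
        by apply: us; rewrite !inE negb_or ii'.
      have Uu : (U_(i) <= u)%MM by rewrite lep1mP ui.
      apply: (IHj (u - U_(i))%MM).
      - by move=> i' ni'; rewrite mnmBE us.
      - by rewrite mnmBE mnm1E eqxx ui subn1.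
      - by apply: cK; rewrite submK.
    have e : ~: tau = ~: (i |: tau).
      by apply: prec_anti; [exact: (proj1 ot)|exact: (proj1 oi)|rewrite tmin // prec_incl //; case: ot].
    by move: it; rewrite -[tau]setCK e setCK setU11.
  have [|L1 sL1] := IH (colon_var K' i) _ (colon_upset uK') (boxed_colon i bK').
    by rewrite -ltnS; apply: leq_trans KM; rewrite ltnS;
      apply: box_measure_lt Cu nKu => //; apply: boxed_colon.
  have [|||L2 [oL2 pL2 cL2 [ws2 dL2]]] := IHi (add_var K' i) (add_upset uK') (boxed_add i B0 bK').
  - by move=> v /KK'; left.
  - by move=> i' ii'; apply: ist; rewrite inE ii' orbT.
  - move=> v vs; have [vi|vi] := eqVneq (v i) 0%N.
      have := Kfin v _; rewrite /add_var vi eqxx => <-.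
        by split=> [[]//|]; left.
      by move=> i'; rewrite inE => /orP[/eqP->|/vs].
    by split=> _; [exists i | right].
  exists (shift_pairs i L1 ++ L2); split.
  - move=> x; rewrite mem_cat => /orP[/mapP[y yL ->]|/oL2//] /=.
    have [yD yK] := st_option sL1 yL; split=> // v vs Kv; exact: (yK v vs (KC v Kv)).
  - move=> M1 x M2 e; have [[M2' ME]|[M1' M1E L2E]] := cat_eq_cat_cons e; last first.
      have [px|[y yM py]] := pL2 M1' x M2 L2E; [by left | right].
      by exists y => //; rewrite M1E mem_cat yM orbT.
    have [N1 [y [N2 [LE M1E xE]]]] := map_eq_cat_cons ME; rewrite -M1E -xE {M1E}.
    have yL : y \in L1 by rewrite LE mem_cat inE eqxx orbT.
    case: N1 LE => [LE|y1 N1 LE].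
      (* The head of a colon part has monomial 1 before the shift, so its parent is the pair of
         [tau]; its face is also an option of [K], and minimality of [tau] gives the order. *)
      left; split; last by exists i => //=; rewrite (st_head sL1 LE).
      apply: tmin; have [yD yK] := st_option sL1 yL; split=> // v vs Kv.
      exact: (yK v vs (KC v Kv)).
    right; have [//|y' y'N [py' [l' ly' e']]] := st_parent sL1 LE.
    exists ((y'.1 + U_(i))%MM, y'.2); first by apply/mapP; exists y'.
    by split=> //; exists l' => //=; rewrite e' -!addmA [(U_(l') + _)%MM]addmC.
  - move=> m p H Ht; apply: (@Hvan_var_ext _ _ _ _ _ _ _ deg_eta K' i) => //.
      apply: (st_coh sL1) => x xL; have := H ((x.1 + U_(i))%MM, x.2).
      rewrite mem_cat map_f // => /(_ isT); rewrite /= mon_degD mon_degU opprD addrA addrAC.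
      by [].
    by apply: cL2 => // x xL; apply: H; rewrite mem_cat xL orbT.
  - have [ws1 dL1] := st_cnt sL1.
    exists ([seq w + col i A | w <- ws1] ++ ws2) => t tw.
    rewrite (cnt_var FP K' i) dL2; last by move=> w ww; apply: tw; rewrite mem_cat ww orbT.
    rewrite dL1; last first.
      move=> w ww; have := tw (w + col i A); rewrite mem_cat (map_f (fun w => w + col i A) ww) => /(_ isT).
      by rewrite opprD addrA addrAC.
    rewrite big_cat /= big_map -addnA; congr (_ + _)%N.
    rewrite addnC; congr (_ + _)%N; apply: eq_bigr => x _.
    by rewrite mon_degD mon_degU opprD addrA addrAC.
have [||L [oL pL cL [ws dL]]] := inner (enum (~: tau)) K uK bK (fun _ => id).
- by move=> i; rewrite mem_enum inE.
- move=> u u0; split=> [Ku|[i it]]; last by rewrite u0 ?eqxx // mem_enum inE.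
  by case: (proj2 ot u) => // i it; apply: u0; rewrite mem_enum inE.
exists ((0%MM, tau) :: L); split.
- by move=> x; rewrite inE => /orP[/eqP->//|/oL].
- by move=> x L' [<-].
- move=> [//|y L1] x L2 [<- LE] _; have [px|[y' y'L py']] := pL L1 x L2 LE.
    by exists (0%MM, tau); rewrite ?inE ?eqxx.
  by exists y' => //; rewrite inE y'L orbT.
- move=> m p H; apply: cL; first by move=> x xL; apply: H; rewrite inE xL orbT.
  by have := H (0%MM, tau); rewrite inE eqxx /= mon_deg0 subr0; apply.
- by exists ws => t tw; rewrite big_cons /= mon_deg0 subr0; apply: dL.
Qed.

Lemma stanley_exists K : upset K -> exists L, stanley K L.
Proof. by move=> uK; have [B B0 bK] := upset_boxed uK; apply: stanley_exists_box bK. Qed.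

End Stanley.

(** * Polynomial functions on the degree lattice *)

Section Translates.
Variable r : nat.
Local Notation P := {mpoly rat[r]}.
Implicit Types (Q T : P) (w t : 'cV[int]_r) (u v m : 'X_{1..r}).

Definition ev Q t : rat := Q.@[fun i => (t i 0)%:~R].

Lemma ev_translate w Q t : ev (translate w Q) t = ev Q (t - w).
Proof.
rewrite /ev /translate comp_mpoly_meval; apply: meval_eq => i.
by rewrite tnth_mktuple mevalB mevalXU mevalC !mxE rmorphB.
Qed.

Lemma evD Q T t : ev (Q + T) t = ev Q t + ev T t.
Proof. exact: mevalD. Qed.

Lemma evB Q T t : ev (Q - T) t = ev Q t - ev T t.
Proof. exact: mevalB. Qed.

Lemma translateB w Q T : translate w (Q - T) = translate w Q - translate w T.
Proof. exact: comp_mpolyB. Qed.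

Definition dir_deriv w Q : P := \sum_i (w i 0)%:~R *: Q^`M(i).

(** The error of the first-order Taylor expansion of a translate; its degree is lower by two. *)
Definition second_order w Q : P := Q - translate w Q - dir_deriv w Q.

Lemma dir_derivX w j Q :
  dir_deriv w ('X_j * Q) = (w j 0)%:~R *: Q + 'X_j * dir_deriv w Q.
Proof.
rewrite /dir_deriv mulr_sumr (bigD1 j) //= [in RHS](bigD1 j) //= addrA; congr (_ + _).
  rewrite mderivM scalerDr -!scalerAr mderivX mnm1E eqxx.
  rewrite (_ : (U_(j) - U_(j))%MM = 0%MM) ?mpolyX0 ?scale1r ?mul1r //.
  by apply/mnmP => i; rewrite mnmBE subnn mnm0E.
apply: eq_bigr => i ij; rewrite mderivM mderivX mnm1E eq_sym (negbTE ij) scale0r mul0r add0r.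
by rewrite scalerAr.
Qed.

Lemma second_orderX w j Q : second_order w ('X_j * Q) =
  'X_j * second_order w Q - (w j 0)%:~R *: (second_order w Q + dir_deriv w Q).
Proof.
have tX : translate w ('X_j * Q) = ('X_j - ((w j 0)%:~R)%:MP) * translate w Q.
  rewrite /translate rmorphM /= comp_mpolyXU; congr (_ * _).
  by rewrite -tnth_nth tnth_mktuple.
rewrite /second_order tX dir_derivX -!mul_mpolyC; ring.
Qed.

Lemma msizeD_leq Q T (b : nat) : (msize Q <= b)%N -> (msize T <= b)%N -> (msize (Q + T) <= b)%N.
Proof. by move=> sQ sT; apply: leq_trans (msizeD_le _ _) _; rewrite geq_max sQ. Qed.

Lemma msizeB_leq Q T (b : nat) : (msize Q <= b)%N -> (msize T <= b)%N -> (msize (Q - T) <= b)%N.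
Proof. by move=> sQ sT; apply: msizeD_leq => //; rewrite msizeN. Qed.

Lemma msize_sum_leq (I : eqType) (s : seq I) (f : I -> P) (b : nat) :
  (forall i, i \in s -> (msize (f i) <= b)%N) -> (msize (\sum_(i <- s) f i) <= b)%N.
Proof.
elim: s => [|i s IH] H; first by rewrite big_nil msize0.
rewrite big_cons; apply: msizeD_leq; first by apply: H; rewrite inE eqxx.
by apply: IH => j js; apply: H; rewrite inE js orbT.
Qed.

Lemma msizeZ_leq a Q (b : nat) : (msize Q <= b)%N -> (msize (a *: Q) <= b)%N.
Proof. exact: leq_trans (msizeZ_le _ _). Qed.

Lemma msizeXM_leq j Q (b : nat) : (msize Q <= b)%N -> (msize ('X_j * Q) <= b.+1)%N.
Proof.
move=> sQ; have [->|Q0] := eqVneq Q 0; first by rewrite mulr0 msize0.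
have X0 : 'X_j != 0 :> P by rewrite -msupp_eq0 msuppX.
by rewrite msizeM // msizeX mdeg1.
Qed.

Lemma msize_deriv w Q (b : nat) : (msize Q <= b.+1)%N -> (msize (dir_deriv w Q) <= b)%N.
Proof.
move=> sQ; apply: msize_sum_leq => i _; apply: msizeZ_leq.
rewrite msizeE; apply/bigmax_leqP_seq => v.
rewrite mcoeff_msupp mcoeff_deriv => vi _.
have : (v + U_(i))%MM \in msupp Q.
  by rewrite mcoeff_msupp; apply: contraNneq vi => ->; rewrite mul0rn.
move=> /msize_mdeg_lt; rewrite mdegD mdeg1 addn1 => /leq_trans/(_ sQ).
by rewrite ltnS.
Qed.

Lemma mnm_split m : m != 0%MM -> exists j m', m = (U_(j) + m')%MM.
Proof.
move=> m0; have [j mj] : exists j, m j != 0%N.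
  apply/existsP; apply: contraNT m0; rewrite negb_exists => /forallP m0.
  by apply/eqP/mnmP => i; rewrite mnm0E; apply/eqP; move: (m0 i); rewrite negbK.
by exists j, (m - U_(j))%MM; rewrite addmC submK // lep1mP.
Qed.

Lemma msize_second_order_mon w m : (msize (second_order w 'X_[m]) <= (mdeg m).-1)%N.
Proof.
move: {2}(mdeg m) (erefl (mdeg m)) => d; elim: d m => [|d IH] m md.
  move/eqP: md; rewrite mdeg_eq0 => /eqP->; rewrite /second_order mpolyX0.
  rewrite /translate comp_mpoly1 subrr sub0r msizeN /dir_deriv big1 ?msize0 // => i _.
  by rewrite -mpolyC1 mderivC scaler0.
have [|j [m' mE]] := @mnm_split m; first by rewrite -mdeg_eq0 md.
have m'd : mdeg m' = d by move: md; rewrite mE mdegD mdeg1 add1n => -[].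
rewrite mE mpolyXD second_orderX mdegD mdeg1 m'd /=.
have s2 := IH m' m'd; rewrite m'd in s2.
have s1 : (msize (dir_deriv w 'X_[m']) <= d)%N by apply: msize_deriv; rewrite msizeX m'd.
case: d {IH md} m'd s2 s1 => [|d] m'd s2 s1.
  move: s2 s1; rewrite !leqn0 !msize_poly_eq0 => /eqP-> /eqP->.
  by rewrite mulr0 addr0 scaler0 subr0.
apply: msizeB_leq; first exact: msizeXM_leq.
by apply: msizeZ_leq; apply: msizeD_leq => //; apply: leq_trans s2 _.
Qed.

Lemma second_orderE w Q : second_order w Q = \sum_(m <- msupp Q) Q@_m *: second_order w 'X_[m].
Proof.
have so_lin : linear (second_order w).
  move=> a Q1 Q2; rewrite /second_order /translate linearP /= /dir_deriv.
  rewrite (eq_bigr (fun i => a *: ((w i 0)%:~R *: Q1^`M(i)) + (w i 0)%:~R *: Q2^`M(i))).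
    rewrite big_split /= -scaler_sumr -!mul_mpolyC; ring.
  by move=> i _; rewrite linearP scalerDr !scalerA mulrC.
pose sl := GRing.isLinear.Build _ _ _ _ _ so_lin.
pose f : {linear P -> P} := HB.pack (second_order w) sl.
rewrite -[second_order w Q]/(f Q) {1}[Q]mpolyE linear_sum; apply: eq_bigr => m _.
by rewrite linearZ.
Qed.

Lemma msize_second_order w Q (b : nat) : (msize Q <= b.+2)%N -> (msize (second_order w Q) <= b)%N.
Proof.
move=> sQ; rewrite second_orderE; apply: msize_sum_leq => m mQ; apply: msizeZ_leq.
apply: leq_trans (msize_second_order_mon _ _) _.
have := leq_trans (msize_mdeg_lt mQ) sQ; lia.
Qed.

Lemma msize_diff w Q (b : nat) : (msize Q <= b.+1)%N -> (msize (Q - translate w Q) <= b)%N.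
Proof.
move=> sQ; have -> : Q - translate w Q = second_order w Q + dir_deriv w Q by rewrite subrK.
apply: msizeD_leq; last exact: msize_deriv.
case: b sQ => [|b] sQ; last by apply: leq_trans (msize_second_order _ sQ) _.
by apply: msize_second_order; apply: leq_trans sQ _.
Qed.

(** In degree [d] only the directional derivative contributes. *)
Lemma mcoeff_diff w Q (d : nat) u : (msize Q <= d.+2)%N -> mdeg u = d ->
  (Q - translate w Q)@_u = \sum_i (w i 0)%:~R * ((u i).+1%:R * Q@_(u + U_(i))).
Proof.
move=> sQ ud; have -> : Q - translate w Q = second_order w Q + dir_deriv w Q by rewrite subrK.
rewrite mcoeffD [X in X + _]memN_msupp_eq0 ?add0r; last first.
  by apply/negP => /msize_mdeg_lt; rewrite ud ltnNge msize_second_order.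
rewrite /dir_deriv linear_sum; apply: eq_bigr => i _ /=.
by rewrite mcoeffZ mcoeff_deriv mulr_natl.
Qed.

(** A difference along a variable of the leading monomial is zero by induction, yet one of its
    coefficients is a nonzero multiple of the leading one. *)
Lemma ev_eq0 Q : (forall t, ev Q t = 0) -> Q = 0.
Proof.
move: {2}(msize Q) (leqnn (msize Q)) => d; elim: d Q => [|d IH] Q sQ Q0.
  by apply/eqP; rewrite -msize_poly_eq0 -leqn0.
case: d IH sQ => [|d] IH sQ.
  have := Q0 0; rewrite /ev (msize1_polyC sQ) mevalC => ->; exact: mpolyC0.
apply: (IH Q) => //; rewrite leqNgt; apply/negP => ltQ.
have Qn : Q != 0 by rewrite -msize_poly_eq0; case: (msize Q) ltQ.
have mQ : mdeg (mlead Q) = d.+1.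
  by apply: succn_inj; rewrite mlead_deg //; apply/eqP; rewrite eqn_leq sQ.
have [|j [m' mE]] := @mnm_split (mlead Q); first by rewrite -mdeg_eq0 mQ.
have m'd : mdeg m' = d by move: mQ; rewrite mE mdegD mdeg1 add1n => -[].
pose e : 'cV[int]_r := \col_i (i == j)%:R.
have D0 : Q - translate e Q = 0.
  apply: IH; first exact: msize_diff.
  by move=> t; rewrite evB ev_translate !Q0 subrr.
have := mcoeff_diff e sQ m'd; rewrite D0 mcoeff0 (bigD1 j) //= big1 ?addr0.
  rewrite mxE eqxx mul1r addmC -mE => /esym/eqP.
  by rewrite mulf_eq0 mleadc_eq0 (negbTE Qn) orbF pnatr_eq0.
by move=> i ij; rewrite mxE (negbTE ij) mul0r.
Qed.

Lemma ev_inj Q T : (forall t, ev Q t = ev T t) -> Q = T.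
Proof.
by move=> e; apply/eqP; rewrite -subr_eq0; apply/eqP/ev_eq0 => t; rewrite evB e subrr.
Qed.

Lemma translateD w w' Q : translate w (translate w' Q) = translate (w + w') Q.
Proof. by apply: ev_inj => t; rewrite !ev_translate opprD addrA. Qed.

(** On the line [Q] becomes a polynomial in one variable with infinitely many roots. *)
Lemma ev_line Q (a : 'cV[int]_r) w (k0 : nat) :
  (forall j : nat, (k0 <= j)%N -> ev Q (a + w *+ j) = 0) -> ev Q a = 0.
Proof.
move=> H; pose h i : {poly rat} := ((a i 0)%:~R)%:P + ((w i 0)%:~R)%:P * 'X.
pose q := mmap (@polyC _) h Q.
have qE x : q.[x] = Q.@[fun i => (a i 0)%:~R + (w i 0)%:~R * x].
  rewrite /q /mmap horner_sum mevalE; apply: eq_bigr => m _.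
  rewrite hornerM hornerC; congr (_ * _); rewrite /mmap1 horner_prod.
  by apply: eq_bigr => i _; rewrite horner_exp /h !hornerE.
have q0 : q = 0.
  apply/eqP; apply: contraT => qn.
  have := max_poly_roots qn (rs := [seq (k0 + j)%N%:R | j <- iota 0 (size q)]).
  rewrite size_map size_iota ltnn; apply.
    apply/allP => _ /mapP[j _ ->]; rewrite /root qE; apply/eqP.
    rewrite -[RHS](H (k0 + j)%N) ?leq_addr //; apply: meval_eq => i.
    by rewrite !mxE mulmxnE intrD; congr (_ + _); rewrite [w i 0 *+ _]pmulrn mulrzz intrM.
  rewrite map_inj_uniq ?iota_uniq // => x y /eqP; rewrite eqr_nat => /eqP.
  exact: addnI.
have := qE 0; rewrite q0 horner0 => /esym; rewrite /ev => <-; apply: meval_eq => i.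
by rewrite mulr0 addr0.
Qed.

End Translates.

(** * Leading monomials under changes of coordinates, translations and sums *)

Section LeadingMonomials.
Variable r : nat.
Local Notation P := {mpoly rat[r]}.
Implicit Types (Q T : P) (w t : 'cV[int]_r) (u v m : 'X_{1..r}).

Lemma msizeM_leq Q T (a b : nat) : (msize Q <= a.+1)%N -> (msize T <= b.+1)%N ->
  (msize (Q * T) <= (a + b).+1)%N.
Proof.
move=> sQ sT; have [->|Q0] := eqVneq Q 0; first by rewrite mul0r msize0.
have [->|T0] := eqVneq T 0; first by rewrite mulr0 msize0.
by rewrite msizeM //; move: sQ sT; move: (mmeasure _ Q) (mmeasure _ T) => x y; lia.
Qed.

Lemma ev_lin_change phi Q t : ev (lin_change phi Q) t = ev Q (invmx phi *m t).
Proof.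
rewrite /ev /lin_change comp_mpoly_meval; apply: meval_eq => i.
rewrite tnth_mktuple mxE rmorph_sum /= raddf_sum; apply: eq_bigr => j _ /=.
by rewrite mevalZ mevalXU intrM.
Qed.

Lemma msize_lin_change phi Q : (msize (lin_change phi Q) <= msize Q)%N.
Proof.
rewrite /lin_change comp_mpolyEX; apply: msize_sum_leq => m mQ; apply: msizeZ_leq.
apply: leq_trans (msize_mdeg_lt mQ); rewrite comp_mpolyX mdegE.
elim/big_rec2: _ => [|i a f _ IH]; first by rewrite msize1.
apply: msizeM_leq IH; rewrite tnth_mktuple; elim: (m i) => [|e IH]; first by rewrite expr0 msize1.
rewrite exprS; apply: (@msizeM_leq _ _ 1 e) => //; apply: msize_sum_leq => j _; apply: msizeZ_leq.
by rewrite msizeX mdeg1.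
Qed.

Lemma lin_change_translate phi w Q : phi \in unitmx ->
  lin_change phi (translate w Q) = translate (phi *m w) (lin_change phi Q).
Proof.
move=> uphi; apply: ev_inj => t.
by rewrite ev_lin_change !ev_translate ev_lin_change mulmxBr mulKmx.
Qed.

Lemma lin_changeK phi Q : phi \in unitmx -> lin_change (invmx phi) (lin_change phi Q) = Q.
Proof.
by move=> uphi; apply: ev_inj => t; rewrite !ev_lin_change invmxK mulKmx.
Qed.

Lemma msize_lin_changeE phi Q : phi \in unitmx -> msize (lin_change phi Q) = msize Q.
Proof.
move=> uphi; apply/eqP; rewrite eqn_leq msize_lin_change /=.
by rewrite -{1}(lin_changeK Q uphi) msize_lin_change.
Qed.

Lemma lin_changeB phi Q T : lin_change phi (Q - T) = lin_change phi Q - lin_change phi T.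
Proof. exact: comp_mpolyB. Qed.

Lemma lin_change_sum phi (I : Type) (s : seq I) (f : I -> P) :
  lin_change phi (\sum_(x <- s) f x) = \sum_(x <- s) lin_change phi (f x).
Proof. exact: raddf_sum. Qed.

Variable lt : rel 'X_{1..r}.
Hypothesis hlt : graded_monomial_order lt.

Lemma lead_exists Q : Q != 0 -> exists u, lead_mon lt Q u.
Proof.
rewrite -msupp_eq0 /lead_mon; elim: (msupp Q) => // v s IH _.
case: s IH => [|v' s] IH.
  by exists v; rewrite inE eqxx; split=> // v'; rewrite inE => /eqP->; rewrite eqxx.
have [//|u [us uP]] := IH.
have [uv|uv] := eqVneq u v.
  exists u; split; first by rewrite inE uv eqxx.
  by move=> x; rewrite inE => /orP[/eqP->|/uP//]; rewrite uv eqxx.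
have [luv|lvu] := orP (mo_total hlt uv).
  exists v; split; first by rewrite inE eqxx.
  move=> x; rewrite inE => /orP[/eqP->|xs _]; first by rewrite eqxx.
  have [->//|xu] := eqVneq x u; exact: (mo_trans hlt) (uP x xs xu) luv.
exists u; split; first by rewrite inE us orbT.
by move=> x; rewrite inE => /orP[/eqP->//|/uP].
Qed.

Lemma lt_asym u v : lt u v -> lt v u -> False.
Proof. by move=> uv /(mo_trans hlt uv); rewrite (mo_irr hlt). Qed.

Lemma lead_unique Q u v : lead_mon lt Q u -> lead_mon lt Q v -> u = v.
Proof.
move=> [uQ uP] [vQ vP]; apply/eqP; apply: contraT => uv.
by case: (lt_asym (vP u uQ uv) (uP v vQ _)); rewrite eq_sym.
Qed.

Lemma lead_deg_le Q u v : lead_mon lt Q u -> v \in msupp Q -> (mdeg v <= mdeg u)%N.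
Proof.
move=> [uQ uP] vQ; have [->//|vu] := eqVneq v u; rewrite leqNgt; apply/negP => d.
exact: lt_asym (uP v vQ vu) (mo_deg hlt d).
Qed.

Lemma lead_msize Q u : lead_mon lt Q u -> msize Q = (mdeg u).+1.
Proof.
move=> lu; apply/eqP; rewrite eqn_leq (msize_mdeg_lt (proj1 lu)) andbT.
by rewrite msizeE; apply/bigmax_leqP_seq => v vQ _; rewrite ltnS; apply: lead_deg_le vQ.
Qed.

(** Translation alters only terms of lower total degree, and [lt] refines total degree. *)
Lemma lead_translate Q u w : lead_mon lt Q u ->
  lead_mon lt (translate w Q) u /\ (translate w Q)@_u = Q@_u.
Proof.
move=> lu; have sQ := lead_msize lu.
have high v : (mdeg u <= mdeg v)%N -> (translate w Q)@_v = Q@_v.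
  move=> uv; apply/esym/eqP; rewrite -subr_eq0 -mcoeffB; apply/eqP/memN_msupp_eq0.
  by apply: msize_mdeg_ge; apply: leq_trans uv; apply: msize_diff; rewrite sQ.
split; last exact: high.
split=> [|v]; first by rewrite mcoeff_msupp high // -mcoeff_msupp; case: lu.
have [uv|vu] := leqP (mdeg u) (mdeg v); last by move=> _ _; exact: (mo_deg hlt).
by rewrite mcoeff_msupp high // -mcoeff_msupp; case: lu => _; apply.
Qed.

(** Positivity of the leading coefficients excludes cancellation at the largest leading monomial. *)
Lemma lead_sum (I : eqType) (s : seq I) (f : I -> P) (ld : I -> 'X_{1..r}) x0 :
  (forall x, x \in x0 :: s -> lead_mon lt (f x) (ld x) /\ 0 < (f x)@_(ld x)) ->
  (forall x, x \in s -> ld x = ld x0 \/ lt (ld x) (ld x0)) ->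
  lead_mon lt (\sum_(x <- x0 :: s) f x) (ld x0) /\ 0 < (\sum_(x <- x0 :: s) f x)@_(ld x0).
Proof.
move=> fl le.
have nn x : x \in s -> 0 <= (f x)@_(ld x0).
  move=> xs; have [|[lx lP] pos] := fl x; first by rewrite inE xs orbT.
  have [e|l] := le x xs; first by rewrite -e ltW.
  rewrite memN_msupp_eq0 //; apply/negP => x0f; apply: (lt_asym l); apply: lP => //.
  by apply: contraTneq l => ->; rewrite (mo_irr hlt).
have pos : 0 < (\sum_(x <- x0 :: s) f x)@_(ld x0).
  rewrite big_cons mcoeffD linear_sum /= ltr_wpDr //.
    by rewrite big_seq; apply: sumr_ge0 => x xs; apply: nn.
  by have [|_] := fl x0; first by rewrite inE eqxx.
split=> //; split; first by rewrite mcoeff_msupp gt_eqF.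
move=> v; rewrite mcoeff_msupp linear_sum /= => vn vx.
have [x xs vf] : exists2 x, x \in x0 :: s & v \in msupp (f x).
  apply: contrapT => no; case/eqP: vn; rewrite big_seq big1 // => x xs.
  by apply: memN_msupp_eq0; apply/negP => vf; apply: no; exists x.
have [[lx lP] _] := fl x xs.
have le' : ld x = ld x0 \/ lt (ld x) (ld x0).
  by move: xs; rewrite inE => /orP[/eqP->|/le//]; left.
have [e|vl] := eqVneq v (ld x); first by case: le' => [e'|]; rewrite -?e' ?e //; move: vx; rewrite e e' eqxx.
have := lP v vf vl; case: le' => [->//|l h]; exact: (mo_trans hlt) h l.
Qed.

End LeadingMonomials.

(** * Hilbert polynomials *)

Section HilbertPolynomials.
Variables (R : realType) (k : fieldType) (d n r : nat).
Variables (b : 'M[int]_(n, d)) (Delta : {set {set 'I_n}}).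
Hypothesis hX : smooth_projective_fan R b Delta.
Variable A : 'M[int]_(r, n).
Hypothesis hA : short_exact b A.
Variable c : 'cV[int]_r.
Hypothesis hc : forall i : 'I_n, Ksg A Delta (c - col i A).
Variable F : 'cV[int]_r -> seq 'X_{1..n}.
Hypothesis FP : forall q, uniq (F q) /\ forall u, (u \in F q) = (mon_deg A u == q).
Local Notation K := (Ksg A Delta).
Local Notation deg := (mon_deg A).
Local Notation cnt := (cnt F).
Local Notation deepf := (deep_for A Delta).
Local Notation S := {mpoly k[n]}.
Implicit Types (tau rho : {set 'I_n}) (i : 'I_n) (t w : 'cV[int]_r).

Lemma deep_for_cat ws1 ws2 t : deepf (ws1 ++ ws2) t -> deepf ws1 t /\ deepf ws2 t.
Proof. by move=> h; split=> w ww; apply: h; rewrite mem_cat ww ?orbT. Qed.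

Lemma deep_for_shift ws v t : deepf [seq w + v | w <- ws] t -> deepf ws (t - v).
Proof. by move=> h w ww; have := h (w + v) (map_f (fun w => w + v) ww); rewrite opprD addrA addrAC. Qed.

Lemma deep_for_ex ws : exists2 t, deepf ws t & K t.
Proof.
have [k0 h] := deep_ex hX hA hc ws; exists (c *+ k0).
  by move=> w ww; rewrite -[c *+ k0]addr0; apply: h => //; exact: Ksg0.
by apply: KsgMn; apply: Ksg_c hX _ hA _ hc.
Qed.

(** Every line in the direction [c] eventually enters the deep region. *)
Lemma deep_zero (Q : {mpoly rat[r]}) ws : (forall t, deepf ws t -> ev Q t = 0) -> Q = 0.
Proof.
move=> Q0; apply: ev_eq0 => t.
have [k0 h0] := deep_ex hX hA hc ws; have [k1 h1] := Ksg_add_c hX hA hc t.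
apply: (@ev_line _ _ _ c (k0 + k1)%N) => m km; apply: Q0 => w ww.
have -> : t + c *+ m = c *+ k0 + (t + c *+ (m - k0)).
  by rewrite addrCA -mulrnDr subnKC // (leq_trans (leq_addr _ _) km).
by apply: h0 => //; apply: h1; rewrite leq_subRL // (leq_trans (leq_addr _ _) km).
Qed.

Lemma coord_idealP tau (f : S) : f \in coord_ideal k tau <-> supported (coord_upset tau) f.
Proof.
have iT := upset_is_ideal k (coord_upset_upset (tau := tau)).
have iI := ideal_is_ideal (coord_ideal k tau).
split=> [/asboolP[s [sG ->]]|fT].
  rewrite big_seq; apply: (big_ind (fun f => supported (coord_upset tau) f)) => [|x y|x xs].
  - exact: supported0.
  - exact: supportedD.
  have [i it ->] := sG x xs; apply: (is_idealM iT); apply/supportedX; exists i => //.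
  by rewrite mnm1E eqxx.
rewrite [f]mpolyE big_seq; apply: (big_ind (fun f : S => f \in coord_ideal k tau)).
- exact: (is_ideal0 iI).
- by move=> x y; apply: (is_idealD iI).
move=> u; rewrite mcoeff_msupp => /fT[i it ui]; apply: (is_idealZ _ iI).
rewrite -(@submK _ U_(i)%MM u) ?lep1mP // mpolyXD; apply: (is_idealM iI).
apply/asboolP; exists [:: (1, 'X_i)]; rewrite big_seq1 mul1r; split=> // x.
by rewrite inE => /eqP->; exists i.
Qed.

Lemma has_dim_cnt (I : ideal k n) Kp t N :
  monomial_basis A (fun f : S => f \in I) t [seq u <- F t | `[< ~ Kp u >]] ->
  has_dim (quot_grading A (I := I) t) N -> N = cnt Kp t.
Proof.
move=> mb hd; have [uF mF] := FP t.
rewrite (has_dim_basis _ _ mb hd) ?size_filter ?filter_uniq //.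
by move=> u; rewrite mem_filter mF => /andP[_ /eqP].
Qed.

Lemma coord_basis tau t :
  monomial_basis A (fun f : S => f \in coord_ideal k tau) t [seq u <- F t | `[< ~ coord_upset tau u >]].
Proof.
apply: monomial_basis_mon; first exact: ideal_is_ideal.
  move=> l f w /coord_idealP fT; apply/coord_idealP; exact: supported_filter.
move=> u; rewrite mem_filter; have [_ ->] := FP t; split.
  by move=> /andP[/asboolP nu /eqP]; split=> // /coord_idealP/supportedX.
move=> [ut nu]; rewrite ut eqxx andbT; apply/asboolP => cu; apply: nu.
by apply/coord_idealP/supportedX.
Qed.

Variable PS : {set 'I_n} -> {mpoly rat[r]}.
Hypothesis hPS : forall tau : {set 'I_n}, ~: tau \in Delta ->
  hilbert_poly A Delta (quot_grading A (I := coord_ideal k tau)) (PS tau).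

Lemma PS_cnt tau : ~: tau \in Delta -> exists ws, forall t, deepf ws t ->
  ev (PS tau) t = (cnt (coord_upset tau) t)%:R.
Proof.
move=> tD; have [ws wsP] := hPS tD; exists ws => t tw.
have [N hd] := wsP t tw; rewrite /ev => ->; congr (_%:R).
exact: has_dim_cnt (coord_basis tau t) hd.
Qed.

(** Multiplication by [x_i] is injective on S_tau, with cokernel S_(tau - i). *)
Lemma cnt_coord_var tau i t : i \in tau ->
  cnt (coord_upset tau) t = (cnt (coord_upset (tau :\ i)) t + cnt (coord_upset tau) (t - col i A))%N.
Proof.
move=> it; rewrite (cnt_var FP _ i); congr (_ + _)%N; apply: eq_count => u; congr (`[< ~ _ >]);
  rewrite propeqE; split.
- move=> [[j jt uj]|ui]; [exists j | exists i] => //; rewrite !inE ?eqxx //.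
  by rewrite (negbTE jt) andbF.
- move=> [j]; rewrite !inE negb_and negbK => /orP[/eqP->|jt] uj; first by right.
  by left; exists j.
- move=> [j jt]; rewrite mnmDE mnm1E; case: (eqVneq i j) => [e|_]; first by rewrite -e it in jt.
  by rewrite addn0; exists j.
- by move=> cu; apply: coord_upset_upset.
Qed.

(** An option [rho] of this ideal would be contained in [tau], and the complement of [tau] would be
    a subset of a face. *)
Lemma cnt_nonface tau : ~: tau \notin Delta ->
  exists w, forall t, K (t - w) -> cnt (coord_upset tau) t = 0%N.
Proof.
move=> tD; apply: (no_option_cnt (deep_degree hX hA hc) FP); first exact: coord_upset_upset.
move=> rho [rD ro]; case/negP: tD; apply: fan_sub hX _ _ _ rD; rewrite setCS.
apply/subsetP => i ir; apply/negPn/negP => it.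
apply: (ro U_(i)%MM); last by exists i => //; rewrite mnm1E eqxx.
by move=> j jr; rewrite mnm1E; case: eqVneq => // e; rewrite -e ir in jr.
Qed.

Lemma PS_step tau i : ~: tau \in Delta -> i \in tau ->
  PS tau - translate (col i A) (PS tau) = if ~: (tau :\ i) \in Delta then PS (tau :\ i) else 0.
Proof.
move=> tD it; apply/eqP; rewrite -subr_eq0; apply/eqP.
have [ws wsP] := PS_cnt tD.
have [ws' ws'P] : exists ws, forall t, deepf ws t ->
    ev (if ~: (tau :\ i) \in Delta then PS (tau :\ i) else 0) t = (cnt (coord_upset (tau :\ i)) t)%:R.
  case: ifPn => [/PS_cnt//|/cnt_nonface[w wP]]; exists [:: w] => t tw.
  by rewrite wP ?/ev ?meval0 //; apply: tw; rewrite inE.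
apply: (@deep_zero _ (ws ++ [seq w + col i A | w <- ws] ++ ws')) => t.
move=> /deep_for_cat[t1 /deep_for_cat[/deep_for_shift t2 t3]].
by rewrite !evB ev_translate wsP // wsP // ws'P // (cnt_coord_var _ it) natrD addrK subrr.
Qed.

(** Such sums, unlike the single [PS tau], are closed under differences along K while still
    nonnegative in deep degrees; the induction on degree for the sign of the coefficients needs
    both. *)
Definition PSsum (s : seq ('cV[int]_r * {set 'I_n})) : {mpoly rat[r]} :=
  \sum_(x <- s) translate x.1 (PS x.2).

Definition all_faces (s : seq ('cV[int]_r * {set 'I_n})) : Prop :=
  forall x, x \in s -> ~: x.2 \in Delta.

Lemma PSsum_cat s s' : PSsum (s ++ s') = PSsum s + PSsum s'.
Proof. exact: big_cat. Qed.

Lemma translate0 (Q : {mpoly rat[r]}) : translate 0 Q = Q.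
Proof. by apply: ev_inj => t; rewrite ev_translate subr0. Qed.

Lemma translate_PSsum w s : translate w (PSsum s) = PSsum [seq (w + x.1, x.2) | x <- s].
Proof.
rewrite /PSsum big_map {1}/translate raddf_sum; apply: eq_bigr => x _ /=.
exact: translateD.
Qed.

Lemma PS_diff tau (u : 'X_{1..n}) : ~: tau \in Delta -> (forall i, i \notin tau -> u i = 0%N) ->
  exists2 s, all_faces s & PS tau - translate (deg u) (PS tau) = PSsum s.
Proof.
move=> tD; move: {2}(mdeg u) (erefl (mdeg u)) => m; elim: m u => [|m IH] u um ut.
  move/eqP: um; rewrite mdeg_eq0 => /eqP->; exists [::] => //.
  by rewrite mon_deg0 translate0 subrr /PSsum big_nil.
have [|j [u' uE]] := @mnm_split _ u; first by rewrite -mdeg_eq0 um.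
have jt : j \in tau.
  by apply: contraT => /ut; rewrite uE mnmDE mnm1E eqxx.
have [||s sF sE] := IH u'.
- by move: um; rewrite uE mdegD mdeg1 add1n => -[].
- by move=> i /ut; rewrite uE mnmDE; case: (u' i) => // ?; rewrite addnS.
exists ((if ~: (tau :\ j) \in Delta then [:: (0, tau :\ j)] else [::]) ++
    [seq (col j A + x.1, x.2) | x <- s]).
  move=> x; rewrite mem_cat => /orP[|/mapP[y /sF yD ->//]].
  by case: ifP => // tj; rewrite inE => /eqP->.
rewrite PSsum_cat -translate_PSsum -sE translateB translateD uE mon_degD mon_degU.
have e := PS_step tD jt; set T := translate (col j A) (PS tau) in e *.
set T' := translate (_ + _) _.
have -> : PS tau - T' = (PS tau - T) + (T - T') by rewrite addrA subrK.
congr (_ + _); rewrite e.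
by case: ifP => _; rewrite /PSsum ?big_seq1 ?big_nil ?translate0.
Qed.

(** Since [~: x.2] is a face, [w] is the degree of a monomial in the variables of [x.2], and the
    difference telescopes one variable at a time by [PS_diff]. *)
Lemma PSsum_diff s w : all_faces s -> K w ->
  exists2 s', all_faces s' & PSsum s - translate w (PSsum s) = PSsum s'.
Proof.
move=> + Kw; elim: s => [|x s IH] sF.
  by exists [::] => //; rewrite /PSsum big_nil {1}/translate comp_mpoly0 subrr.
have xD : ~: x.2 \in Delta by apply: sF; rewrite inE eqxx.
have [s1 s1F s1E] : exists2 s1, all_faces s1 & PS x.2 - translate w (PS x.2) = PSsum s1.
  have /NAP[u <- u0] := Kw _ xD; apply: PS_diff => // i it; apply: u0.
  by rewrite inE negbK inE.
have [|s2 s2F s2E] := IH; first by move=> y ys; apply: sF; rewrite inE ys orbT.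
exists ([seq (x.1 + y.1, y.2) | y <- s1] ++ s2).
  move=> y; rewrite mem_cat => /orP[/mapP[y' /s1F yD ->//]|/s2F//].
rewrite PSsum_cat -translate_PSsum -s1E -s2E translateB.
have -> : PSsum (x :: s) = translate x.1 (PS x.2) + PSsum s by rewrite /PSsum big_cons.
have -> : translate w (translate x.1 (PS x.2) + PSsum s) =
    translate w (translate x.1 (PS x.2)) + translate w (PSsum s) by exact: comp_mpolyD.
by rewrite opprD addrACA !translateD [w + x.1]addrC.
Qed.

Variable phi : 'M[int]_r.
Hypothesis hphi : phi \in unitmx.
Hypothesis horth : orthant_in_cone A Delta R phi.

Lemma PSsum_deep_ge0 s : all_faces s -> exists ws, forall t, deepf ws t -> 0 <= ev (PSsum s) t.
Proof.
elim: s => [|x s IH] sF; first by exists [::] => t _; rewrite /PSsum big_nil /ev meval0.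
have [|ws wsP] := IH; first by move=> y ys; apply: sF; rewrite inE ys orbT.
have [|ws1 ws1P] := @PS_cnt x.2; first by apply: sF; rewrite inE eqxx.
exists (ws ++ [seq w + x.1 | w <- ws1]) => t /deep_for_cat[t1 /deep_for_shift t2].
rewrite /PSsum big_cons evD addr_ge0 //; last exact: wsP.
by rewrite ev_translate ws1P // ler0n.
Qed.

(* The coefficients of degree m of a difference along K are the values on K of
   the linear form whose coordinates are those of degree m.+1, and by horth this
   form is then nonnegative on the positive orthant. *)
Lemma PSsum_coeff_ge0 s m u : all_faces s -> (msize (PSsum s) <= m.+1)%N -> mdeg u = m ->
  0 <= (lin_change phi (PSsum s))@_u.
Proof.
elim: m s u => [|m IH] s u sF sm um.
  have [ws wsP] := PSsum_deep_ge0 sF; have [t tw _] := deep_for_ex ws.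
  have := wsP t tw; rewrite /ev (msize1_polyC sm) mevalC => c0.
  rewrite /lin_change comp_mpolyC mcoeffC mulr_ge0 ?ler0n //.
set T := lin_change phi (PSsum s).
have sT : (msize T <= m.+2)%N by rewrite /T msize_lin_changeE.
have [|i [u' uE]] := @mnm_split _ u; first by rewrite -mdeg_eq0 um.
have u'm : mdeg u' = m by move: um; rewrite uE mdegD mdeg1 add1n => -[].
pose cf j : rat := (u' j).+1%:R * T@_(u' + U_(j)).
have posK w : K w -> 0 <= \sum_j ((phi *m w) j 0)%:~R * cf j.
  move=> Kw; rewrite -(mcoeff_diff (phi *m w) sT u'm).
  have [s' s'F s'E] := PSsum_diff sF Kw.
  rewrite /T -lin_change_translate // -lin_changeB s'E; apply: IH => //.
  by rewrite -s'E; apply: msize_diff.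
have [j|y [xs [xsP ->]] e] := horth (x := \col_j (j == i)%:R).
  by rewrite mxE ler0n.
have : 0 <= \sum_j ((\col_j (j == i)%:R : 'cV[R]_r) j 0) * ratr (cf j).
  rewrite e mulmx_sumr.
  under eq_bigr do rewrite summxE mulr_suml.
  rewrite exchange_big big_seq /=; apply: sumr_ge0 => x xin; have [x0 Kx] := xsP x xin.
  have -> : \sum_j (map_mx intr phi *m (x.1 *: map_mx intr x.2)) j 0 * ratr (cf j) =
      x.1 * ratr (\sum_j ((phi *m x.2) j 0)%:~R * cf j).
    rewrite rmorph_sum mulr_sumr; apply: eq_bigr => j _ /=.
    rewrite -scalemxAr -map_mxM mxE [map_mx _ _ _ _]mxE -mulrA; congr (_ * _).
    by move: (cf j) => q; rewrite rmorphM /= ratr_int.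
  by rewrite mulr_ge0 // ler0q posK.
rewrite (bigD1 i) //= big1 ?addr0 => [|j ji]; last by rewrite mxE (negbTE ji) mul0r.
by rewrite mxE eqxx mul1r ler0q /cf pmulr_rge0 ?ltr0Sn // addmC -uE.
Qed.

Lemma PS_neq0 tau : ~: tau \in Delta -> PS tau != 0.
Proof.
move=> tD; have [ws wsP] := PS_cnt tD; have [t tw Kt] := deep_for_ex ws.
apply: contraT; rewrite negbK => /eqP P0; have := wsP t tw; rewrite P0 /ev meval0 => /esym/eqP.
rewrite pnatr_eq0 => /eqP c0; have /NAP[u ut u0] := Kt _ tD.
have : has (fun u => `[< ~ coord_upset tau u >]) (F t).
  apply/hasP; exists u; first by have [_ ->] := FP t; apply/eqP.
  by apply/asboolP => -[i it]; rewrite u0 ?eqxx // inE negbK inE.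
by rewrite has_count -/(cnt _ _) c0.
Qed.

Variable lt : rel 'X_{1..r}.
Hypothesis hlt : graded_monomial_order lt.

Lemma PS_lead tau : ~: tau \in Delta -> exists u,
  lead_mon lt (lin_change phi (PS tau)) u /\ 0 < (lin_change phi (PS tau))@_u.
Proof.
move=> tD; have [|u lu] := @lead_exists _ _ hlt (lin_change phi (PS tau)).
  by rewrite -msize_poly_eq0 msize_lin_changeE // msize_poly_eq0 PS_neq0.
exists u; split=> //; rewrite lt_neqAle eq_sym -mcoeff_msupp (proj1 lu) /=.
have E : PSsum [:: (0, tau)] = PS tau by rewrite /PSsum big_seq1 translate0.
rewrite -E; apply: (@PSsum_coeff_ge0 _ (mdeg u)) => //.
  by move=> x; rewrite inE => /eqP->.
by rewrite E -(msize_lin_changeE _ hphi) (lead_msize hlt lu).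
Qed.

(** [PS tau] is a difference of [PS (i |: tau)], so it has smaller total degree. *)
Lemma PS_lead_lt tau i u v : ~: tau \in Delta -> i \notin tau ->
  lead_mon lt (lin_change phi (PS tau)) u ->
  lead_mon lt (lin_change phi (PS (i |: tau))) v -> lt u v.
Proof.
move=> tD it lu lv; apply: (mo_deg hlt).
have rD : ~: (i |: tau) \in Delta by apply: fan_sub hX _ _ _ tD; rewrite setCS subsetUr.
have := PS_step rD (setU11 i tau); rewrite setU1K // tD => e.
rewrite -ltnS -(lead_msize hlt lu) -(lead_msize hlt lv) !msize_lin_changeE //.
have := lead_msize hlt lv; rewrite msize_lin_changeE // => ->.
rewrite ltnS -e; apply: msize_diff.
by rewrite -(lead_msize hlt lv) msize_lin_changeE.
Qed.

End HilbertPolynomials.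

(** * Comparison with the Cech complex *)

Section Fractions.
Variables (k : fieldType) (n : nat).
Local Notation S := {mpoly k[n]}.
Variable M : lmodType S.
Implicit Types (f h s : S) (u v w : Defs.frac M) (x y : M).

Lemma frac_eq_refl f u : frac_eq f u u.
Proof. by exists 0%N; rewrite subrr scaler0. Qed.

Lemma frac_eq_sym f u v : frac_eq f u v -> frac_eq f v u.
Proof. by move=> [l e]; exists l; rewrite -opprB scalerN e oppr0. Qed.

Lemma frac_eq_trans f v u w : frac_eq f u v -> frac_eq f v w -> frac_eq f u w.
Proof.
case: u v w => [u1 u2] [v1 v2] [w1 w2] [l /= e] [l' /= e'].
exists (l + l' + v2)%N => /=.
have -> : f ^+ (l + l' + v2) *: (f ^+ w2 *: u1 - f ^+ u2 *: w1) =
    f ^+ (l' + w2) *: (f ^+ l *: (f ^+ v2 *: u1 - f ^+ u2 *: v1)) +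
    f ^+ (l + u2) *: (f ^+ l' *: (f ^+ w2 *: v1 - f ^+ v2 *: w1)).
  rewrite !scalerBr !scalerA -!exprD.
  rewrite [(l' + w2 + l + u2)%N](_ : _ = l + u2 + l' + w2)%N; last by lia.
  rewrite addrA subrK; congr (_ ^+ _ *: _ - _ ^+ _ *: _); lia.
by rewrite e e' !scaler0 addr0.
Qed.

Lemma frac_eq_add f u v x y a : frac_eq f u (x, a) -> frac_eq f v (y, a) ->
  frac_eq f (frac_add f u v) (x + y, a).
Proof.
case: u v => [u1 u2] [v1 v2] [l /= e] [l' /= e']; exists (l + l')%N => /=.
have -> : f ^+ (l + l') *: (f ^+ a *: (f ^+ v2 *: u1 + f ^+ u2 *: v1) - f ^+ (u2 + v2) *: (x + y)) =
    f ^+ (l' + v2) *: (f ^+ l *: (f ^+ a *: u1 - f ^+ u2 *: x)) +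
    f ^+ (l + u2) *: (f ^+ l' *: (f ^+ a *: v1 - f ^+ v2 *: y)).
  rewrite !(scalerBr, scalerDr) !scalerA -!exprD opprD addrACA.
  by congr (_ ^+ _ *: _ - _ ^+ _ *: _ + (_ ^+ _ *: _ - _ ^+ _ *: _)); lia.
by rewrite e e' !scaler0 addr0.
Qed.

Lemma frac_eq_scale f s u x a : frac_eq f u (x, a) -> frac_eq f (frac_scale s u) (s *: x, a).
Proof.
case: u => [u1 u2] [l /= e]; exists l => /=.
rewrite -[X in _ = X](scaler0 _ s) -e !scalerBr !scalerA.
by congr (_ *: _ - _ *: _); ring.
Qed.

Lemma frac_eq_res f h u x a : frac_eq f u (x, a) ->
  frac_eq (h * f) (frac_res h u) (h ^+ a *: x, a).
Proof.
case: u => [u1 u2] [l /= e]; exists l => /=.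
rewrite -[X in _ = X](scaler0 _ (h ^+ (l + a + u2))) -e !scalerBr !scalerA !exprMn !exprD.
by congr (_ *: _ - _ *: _); ring.
Qed.

Lemma frac_eq_raise f x a e : frac_eq f (x, a) (f ^+ e *: x, (a + e)%N).
Proof. by exists 0%N; rewrite /= scalerA -exprD subrr scaler0. Qed.

Lemma frac_eq_zero f a : frac_eq f (frac0 M) (0, a).
Proof. by exists 0%N; rewrite /= !scaler0 subrr scaler0. Qed.

Variables (N : nat) (g : 'I_N -> S).

(** Over a common exponent [a] the Cech differential becomes the Koszul differential on
    numerators. *)
Lemma frac_eq_cech (c : {set 'I_N} -> Defs.frac M) (x : {set 'I_N} -> M) a (J : {set 'I_N}) :
  (forall j, j \in J -> frac_eq (cech_loc g (J :\ j)) (c (J :\ j)) (x (J :\ j), a)) ->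
  frac_eq (cech_loc g J) (cech_d g c J)
    (\sum_(j in J) ksign S j J *: (g j ^+ a *: x (J :\ j)), a).
Proof.
move=> cx; rewrite /cech_d.
elim/big_rec2: _ => [|j y u jJ IH]; first exact: frac_eq_zero.
apply: frac_eq_add => //; apply: frac_eq_scale.
have -> : cech_loc g J = g j * cech_loc g (J :\ j) by rewrite /cech_loc (big_setD1 j).
exact/frac_eq_res/cx.
Qed.

End Fractions.

Section CechKoszul.
Variables (k : fieldType) (n r : nat) (A : 'M[int]_(r, n)) (I : ideal k n).
Local Notation S := {mpoly k[n]}.
Local Notation deg := (mon_deg A).
Variables (N : nat) (eta : 'I_N -> 'X_{1..n}).
Let z (j : 'I_N) : S := 'X_[eta j].
Let dz (j : 'I_N) : 'cV[int]_r := deg (eta j).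
Local Notation pi := (quot_pi I).
Local Notation Z := (hideal A (fun f : S => f \in I)).
Implicit Types (J : {set 'I_N}).

Lemma cech_locE J : cech_loc z J = 'X_[(\sum_(j in J) eta j)%MM].
Proof. by rewrite -mprodXE. Qed.

Lemma cech_loc_deg J q : homogeneous A q (cech_loc z J) <-> q = kdeg dz J.
Proof.
rewrite homogeneousP cech_locE supportedX.
have -> : deg (\sum_(j in J) eta j)%MM = kdeg dz J.
  by rewrite (big_morph deg (mon_degD A) (mon_deg0 A)).
by split=> ->.
Qed.

Lemma quot_piZ (a f : S) : a *: pi f = pi (a * f).
Proof. exact: quot_scaleE. Qed.

Lemma quot_pi_kdiff a (c : {set 'I_N} -> S) J :
  \sum_(j in J) ksign S j J *: (z j ^+ a *: pi (c (J :\ j))) = pi (kdiff z a c J).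
Proof.
rewrite /kdiff /quot_pi raddf_sum; apply: eq_bigr => j _.
by rewrite -!/(quot_pi _ _) !quot_piZ.
Qed.

Lemma frac_eq_pi f (x y : S) a : frac_eq f (pi x, a) (pi y, a) ->
  exists l : nat, f ^+ l * (x - y) \in I.
Proof.
move=> [l /= e]; exists (l + a)%N; apply/quot_pi0; rewrite -quot_piZ quot_piB exprD -scalerA.
by rewrite scalerBr.
Qed.

(** There are finitely many [J], so their levels have a maximum. *)
Lemma uniform_level (P : {set 'I_N} -> nat -> Prop) (Q : {set 'I_N} -> Prop) :
  (forall J l l', P J l -> (l <= l')%N -> P J l') ->
  (forall J, Q J -> exists l, P J l) -> exists l, forall J, Q J -> P J l.
Proof.
move=> mono ex.
have /choice[l lP] : forall J, exists l, Q J -> P J l.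
  by move=> J; have [/ex[l Pl]|nQ] := pselect (Q J); [exists l | exists 0%N].
by exists (\max_J l J)%N => J QJ; apply: mono (lP J QJ) _; apply: leq_bigmax.
Qed.

Lemma gsubG : gsub z dz (hpoly A).
Proof. exact: gsub_hpoly. Qed.

Lemma hpoly_raise p J a e x : hpoly A (p + kdeg dz J *+ a) x ->
  hpoly A (p + kdeg dz J *+ (a + e)) (kprod z J ^+ e * x).
Proof. by move=> hx; rewrite mulrnDr addrA; exact: (gsub_kprod J e gsubG hx). Qed.

(** The bound [e0] allows a primitive to be taken at a level above that of a given cochain. *)
Lemma frac_homog_level p c (Q : {set 'I_N} -> Prop) (e0 : nat) :
  (forall J, Q J -> frac_homog A (quot_grading A (I := I)) (cech_loc z J) p (c J)) ->
  exists E (x : {set 'I_N} -> S), (e0 <= E)%N /\ forall J, Q J ->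
    hpoly A (p + kdeg dz J *+ E) (x J) /\ frac_eq (cech_loc z J) (c J) (pi (x J), E).
Proof.
move=> hc.
have [||E EP] := @uniform_level (fun J E => exists x : S, (e0 <= E)%N /\
    hpoly A (p + kdeg dz J *+ E) x /\ frac_eq (cech_loc z J) (c J) (pi x, E)) Q.
- move=> J l l' [x [el [hx cx]]] ll'; exists (kprod z J ^+ (l' - l) * x).
  split; first exact: leq_trans el ll'.
  rewrite -(subnKC ll'); move: (l' - l)%N => e; rewrite addKn; split.
    exact: hpoly_raise.
  by apply: frac_eq_trans cx _; rewrite -quot_piZ; apply: frac_eq_raise.
- move=> J QJ; have [[v1 v2] [q [cv /cech_loc_deg qE [f hf /= vE]]]] := hc J QJ.
  exists (v2 + e0)%N, (kprod z J ^+ e0 * f); split; first exact: leq_addl.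
  split; last by rewrite vE in cv; apply: frac_eq_trans cv _; rewrite -quot_piZ; apply: frac_eq_raise.
  by apply: hpoly_raise; rewrite -qE; apply/homogeneousP.
have /choice[x xP] : forall J, exists x : S, Q J ->
    (e0 <= E)%N /\ hpoly A (p + kdeg dz J *+ E) x /\ frac_eq (cech_loc z J) (c J) (pi x, E).
  by move=> J; have [/EP[x xP]|nQ] := pselect (Q J); [exists x | exists 0].
exists (maxn e0 E), (fun J => kprod z J ^+ (maxn e0 E - E) * x J); split; first exact: leq_maxl.
move=> J QJ; have [eE [hx cx]] := xP J QJ; have -> : maxn e0 E = E by apply/maxn_idPr.
by rewrite subnn expr0 mul1r.
Qed.

Lemma cech_Hvan m p :
  cech_cohomology_vanishes A (quot_grading A (I := I)) z m p ->
  Hvan z dz (hpoly A) Z m p.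
Proof.
move=> H a c Gc Zc; have iI := ideal_is_ideal I.
pose C J : Defs.frac (quot_mod I) := (pi (c J), a).
have [||B [hB CB]] := H C.
- move=> J cJ; exists (C J), (kdeg dz J); split; [exact: frac_eq_refl|exact/cech_loc_deg|].
  by exists (c J) => //; apply/homogeneousP; exact: Gc.
- move=> J cJ; apply: (frac_eq_trans (v := (pi (kdiff z a c J), a))).
    rewrite -quot_pi_kdiff; apply: (frac_eq_cech (x := fun J => pi (c J))) => j jJ.
    exact: frac_eq_refl.
  have [_ Ic] := Zc J cJ; rewrite (proj2 (quot_pi0 _ _) Ic).
  exact/frac_eq_sym/frac_eq_zero.
have [E [b [aE bP]]] := frac_homog_level a hB.
have [||l lP] := @uniform_level (fun J l =>
    kprod z J ^+ l * (kprod z J ^+ (E - a) * c J - kdiff z E b J) \in I) (fun J => #|J| = m).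
- by move=> J l l' Il ll'; rewrite -(subnK ll') exprD -mulrA; apply: (is_idealM iI).
- move=> J cJ; apply: (@frac_eq_pi (cech_loc z J) _ _ E); apply: (frac_eq_trans (v := C J)).
    apply: frac_eq_sym; rewrite -quot_piZ.
    by have := frac_eq_raise (cech_loc z J) (pi (c J)) a (E - a); rewrite subnKC.
  apply: frac_eq_trans (CB J cJ) _; rewrite -quot_pi_kdiff.
  apply: (frac_eq_cech (x := fun J => pi (b J))) => j jJ.
  by apply: (proj2 (bP _ _)); rewrite -cJ (cardsD1 j J) jJ.
have aEl : (a + (E - a + l) = E + l)%N by rewrite addnA subnKC.
exists (E - a + l)%N, (fun J => kprod z J ^+ l * b J); rewrite aEl; split=> J cJ.
  by apply: hpoly_raise; have [] := bP J cJ.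
rewrite kdiff_raise exprD [_ ^+ _ * _ ^+ l]mulrC -mulrA -mulrBr; split; last exact: lP.
apply: hpoly_raise; apply: (gsubB gsubG).
  by rewrite -{1}(subnKC aE); apply: hpoly_raise; exact: Gc.
apply: (gsub_kdiff gsubG).
by move=> j jJ; apply: (proj1 (bP _ _)); rewrite -cJ (cardsD1 j J) jJ.
Qed.

Lemma Hvan_cech m p :
  Hvan z dz (hpoly A) Z m p ->
  cech_cohomology_vanishes A (quot_grading A (I := I)) z m p.
Proof.
move=> H c hc Zc; have iI := ideal_is_ideal I.
have [E [x [_ xP]]] := frac_homog_level 0 hc.
have [||l lP] := @uniform_level (fun J l => kprod z J ^+ l * kdiff z E x J \in I)
    (fun J => #|J| = m.+1).
- by move=> J l l' Il ll'; rewrite -(subnK ll') exprD -mulrA; apply: (is_idealM iI).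
- move=> J cJ; have [l lI] : exists l : nat, cech_loc z J ^+ l * (kdiff z E x J - 0) \in I.
    apply: (@frac_eq_pi _ _ _ E); apply: (frac_eq_trans (v := cech_d z c J)).
      apply: frac_eq_sym; rewrite -quot_pi_kdiff.
      apply: (frac_eq_cech (x := fun J => pi (x J))) => j jJ.
      by apply: (proj2 (xP _ _)); apply: card_setD1 cJ.
    apply: frac_eq_trans (Zc J cJ) _; rewrite (proj2 (quot_pi0 _ _)).
      exact: frac_eq_zero.
    exact: (is_ideal0 iI).
  by exists l; rewrite subr0 in lI.
have Gx : kcochain dz (hpoly A) m p (E + l) (fun J => kprod z J ^+ l * x J).
  by move=> J cJ; apply: hpoly_raise; have [] := xP J cJ.
have [|e [b [Gb Zb]]] := H (E + l)%N _ Gx.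
  move=> J cJ; split; last by rewrite kdiff_raise; apply: lP.
  by apply: (gsub_kdiff gsubG) => j jJ; apply: Gx; apply: card_setD1 cJ.
exists (fun J => (pi (b J), (E + l + e)%N)); split=> J cJ.
  exists (pi (b J), (E + l + e)%N), (kdeg dz J); split; [exact: frac_eq_refl|exact/cech_loc_deg|].
  by exists (b J) => //; apply/homogeneousP; exact: Gb.
have [_ cx] := xP J cJ; apply: frac_eq_trans cx _.
apply: (frac_eq_trans (v := (pi (kdiff z (E + l + e) b J), (E + l + e)%N))).
  rewrite -(proj2 (quot_piP _ _ _) (proj2 (Zb J cJ))) mulrA -exprD -quot_piZ -addnA [(e + l)%N]addnC.
  exact: frac_eq_raise.
rewrite -quot_pi_kdiff; apply: frac_eq_sym.
by apply: (frac_eq_cech (x := fun J => pi (b J))) => j jJ; exact: frac_eq_refl.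
Qed.

End CechKoszul.

(** * Gotzmann sequences and the theorem *)

(** Ties are broken by the position in [L], so a parent, which is not greater and comes earlier in
    [L], stays before its child. An entry other than the head has a parent, so only the head can
    come first. *)
Lemma sort_with_parents (T : eqType) (x0 : T) (le Par : rel T) (L : seq T) :
  {in L &, total le} -> {in L & &, transitive le} ->
  (forall i, (0 < i < size L)%N -> exists2 j, (j < i)%N &
     le (nth x0 L j) (nth x0 L i) && Par (nth x0 L j) (nth x0 L i)) ->
  exists s, [/\ perm_eq s L,
    forall i j, (i < j < size s)%N -> le (nth x0 s i) (nth x0 s j),
    forall i, (0 < i < size s)%N -> exists2 j, (j < i)%N &
      le (nth x0 s j) (nth x0 s i) && Par (nth x0 s j) (nth x0 s i)
    & nth x0 s 0 = nth x0 L 0].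
Proof.
move=> tot trans par; pose v := nth x0 L.
pose leI (i j : nat) := le (v i) (v j) && (le (v j) (v i) ==> (i <= j)%N).
pose idx := sort leI (iota 0 (size L)).
pose D := fun i => (i < size L)%N.
have vL i : D i -> v i \in L by move=> ?; rewrite mem_nth.
have allD : all D (iota 0 (size L)) by apply/allP => i; rewrite mem_iota.
have totI : {in D &, total leI}.
  move=> i j Di Dj; rewrite /leI; have := tot _ _ (vL i Di) (vL j Dj).
  by case: (le (v i) (v j)); case: (le (v j) (v i)) => //= _; exact: leq_total.
have transI : {in D & &, transitive leI}.
  move=> j i l Dj Di Dl /andP[ij ji] /andP[jl lj].
  have il := trans _ _ _ (vL j Dj) (vL i Di) (vL l Dl) ij jl.
  rewrite /leI il /=; apply/implyP => li.
  have lj' := trans _ _ _ (vL i Di) (vL l Dl) (vL j Dj) li ij.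
  have ji' := trans _ _ _ (vL l Dl) (vL j Dj) (vL i Di) jl li.
  by apply: leq_trans (implyP ji ji') (implyP lj lj').
have pidx : perm_eq idx (iota 0 (size L)) by rewrite perm_sort.
have uidx : uniq idx by rewrite (perm_uniq pidx) iota_uniq.
have szidx : size idx = size L by rewrite (perm_size pidx) size_iota.
have allDs : all D idx by rewrite (perm_all _ pidx).
have sidx : sorted leI idx by apply: (sort_sorted_in totI).
have mono i j : (i < j < size idx)%N -> leI (nth 0%N idx i) (nth 0%N idx j).
  move=> /andP[ij jn]; apply: (sorted_ltn_nth_in transI 0%N allDs sidx) => //.
  by rewrite inE (ltn_trans ij jn).
have Didx i : (i < size idx)%N -> D (nth 0%N idx i).
  by move=> ii; apply: (allP allDs); rewrite mem_nth.
have parI i : (i < size idx)%N -> (0 < nth 0%N idx i)%N -> exists2 j, (j < i)%N &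
    le (v (nth 0%N idx j)) (v (nth 0%N idx i)) && Par (v (nth 0%N idx j)) (v (nth 0%N idx i)).
  move=> ii i0; have [|j ji /andP[lej pj]] := par (nth 0%N idx i); first by rewrite i0 /=; exact: Didx.
  have jidx : j \in idx.
    by rewrite (perm_mem pidx) mem_iota /= (ltn_trans ji (Didx i ii)).
  exists (index j idx); last by rewrite nth_index // lej.
  rewrite ltnNge leq_eqVlt; apply/negP => /orP[/eqP e|lt].
    by move: ji; rewrite e nth_index // ltnn.
  have := mono i (index j idx); rewrite lt index_mem jidx nth_index // => /(_ isT) /andP[_].
  by rewrite lej /= leqNgt ji.
have head0 : (0 < size idx)%N -> nth 0%N idx 0 = 0%N.
  by move=> s0; apply/eqP; rewrite -leqn0 leqNgt; apply/negP => /(parI 0%N s0)[j].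
exists [seq v i | i <- idx]; rewrite size_map.
have nthE i : (i < size idx)%N -> nth x0 [seq v i | i <- idx] i = v (nth 0%N idx i).
  by move=> ii; rewrite (nth_map 0%N).
split.
- apply: perm_trans (perm_map v pidx) _.
  by rewrite -[X in perm_eq _ X](mkseq_nth x0 L).
- move=> i j ijs; have /andP[ij js] := ijs.
  by rewrite !nthE ?(ltn_trans ij js) //; have /andP[] := mono i j ijs.
- move=> i /andP[i0 ii]; have [|j ji h] := parI i ii; last first.
    by exists j => //; rewrite !nthE // (ltn_trans ji ii).
  rewrite lt0n; apply/negP => /eqP e.
  have s0 : (0 < size idx)%N by apply: leq_ltn_trans ii.
  by have := nth_uniq 0%N s0 ii uidx; rewrite head0 // e eqxx eq_sym (gtn_eqF i0).
- have [s0|s0] := posnP (size idx).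
    have e1 : idx = [::] by apply: size0nil.
    have e2 : L = [::] by apply: size0nil; rewrite -szidx.
    by rewrite e1 e2.
  by rewrite nthE // head0.
Qed.

(** * Saturation and powers of the generators of B *)

Section Saturation.
Variables (k : fieldType) (n : nat) (I : ideal k n) (Delta : {set {set 'I_n}}).
Local Notation S := {mpoly k[n]}.

(** A pigeonhole argument: [e s] counts the factors [face_gen k s] collected so far. Each further
    factor in B, expanded in generators, lowers the total deficit by one until some [e s] reaches
    [a]; when the deficit is zero, [set0] is such an [s]. *)
Lemma power_products_in (a : nat) (x : S) (t : nat) (h : 'I_t -> S) (e : {set 'I_n} -> nat) :
  set0 \in Delta -> (forall s, s \in Delta -> face_gen k s ^+ a * x \in I) ->
  (forall i, h i \in irrelevant_ideal k Delta) ->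
  (\sum_(s in Delta) (a - e s) <= t)%N ->
  x * (\prod_(s in Delta) face_gen k s ^+ e s) * \prod_i h i \in I.
Proof.
move=> D0 xI; have iI := ideal_is_ideal I.
elim: t h e => [|t IH] h e hB le.
  have : (a <= e set0)%N.
    by move: le; rewrite leqn0 sum_nat_eq0 => /forall_inP/(_ set0 D0); rewrite subn_eq0.
  move=> ae; rewrite (bigD1 set0) //= -(subnK ae) exprD.
  set f := face_gen k set0 ^+ a; set f' := face_gen k set0 ^+ _; set p := \prod_(_ in _ | _) _.
  set q := \prod_(_ < _) _.
  have -> : x * (f' * f * p) * q = (f' * p * q) * (f * x) by ring.
  by apply: (is_idealM iI); apply: xI.
rewrite big_ord_recl /=; have /asboolP[l [lG ->]] := hB ord0.
rewrite mulr_suml mulr_sumr big_seq; apply: (big_ind (fun f : S => f \in I)).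
- exact: (is_ideal0 iI).
- by move=> y z; apply: (is_idealD iI).
move=> [y1 y2] yl; have [s sD /= ->] := lG _ yl.
pose e' := fun s' => (e s' + (s' == s))%N.
have -> : x * \prod_(s in Delta) face_gen k s ^+ e s * (y1 * face_gen k s * \prod_(i < t) h (lift ord0 i)) =
    y1 * (x * (\prod_(s in Delta) face_gen k s ^+ e' s) * \prod_(i < t) h (lift ord0 i)).
  rewrite [in RHS](bigD1 s) //= [in LHS](bigD1 s) //= /e' eqxx addn1 exprS.
  have -> : \prod_(s' in Delta | s' != s) face_gen k s' ^+ (e s' + (s' == s)) =
      \prod_(s' in Delta | s' != s) face_gen k s' ^+ e s'.
    by apply: eq_bigr => s' /andP[_ ns]; rewrite (negbTE ns) addn0.
  set p := \prod_(_ in _ | _) _; set q := \prod_(_ < _) _; ring.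
apply: (is_idealM iI).
have [ae|ea] := leqP a (e s).
  have ae' : (a <= e' s)%N by apply: leq_trans ae (leq_addr _ _).
  rewrite (bigD1 s) //= -(subnK ae') exprD.
  set f := face_gen k s ^+ a; set f' := face_gen k s ^+ _; set p := \prod_(_ in _ | _) _.
  set q := \prod_(_ < _) _.
  have -> : x * (f' * f * p) * q = (f' * p * q) * (f * x) by ring.
  by apply: (is_idealM iI); apply: xI.
apply: IH => //; rewrite -ltnS; apply: leq_trans le.
rewrite (bigD1 s) //= [in X in (_ < X)%N](bigD1 s) //= /e' eqxx addn1.
have -> : (\sum_(s' in Delta | s' != s) (a - (e s' + (s' == s))) =
    \sum_(s' in Delta | s' != s) (a - e s'))%N.
  by apply: eq_bigr => s' /andP[_ ns]; rewrite (negbTE ns) addn0.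
by rewrite ltn_add2r; lia.
Qed.

Lemma saturated_mem (a : nat) (x : S) : set0 \in Delta ->
  saturated (irrelevant_ideal k Delta) I ->
  (forall s, s \in Delta -> face_gen k s ^+ a * x \in I) -> x \in I.
Proof.
move=> D0 sat xI; apply/sat; exists (\sum_(s in Delta) a)%N => g /asboolP[l [lG ->]].
have iI := ideal_is_ideal I.
rewrite mulr_sumr big_seq; apply: (big_ind (fun f : S => f \in I)).
- exact: (is_ideal0 iI).
- by move=> y z; apply: (is_idealD iI).
move=> y yl; have [h [hB ->]] := lG y yl; rewrite mulrCA; apply: (is_idealM iI).
have := @power_products_in a x _ h (fun=> 0%N) D0 xI hB.
have -> : \prod_(s in Delta) face_gen k s ^+ 0 = 1 by rewrite big1.
by rewrite mulr1; apply; apply: leq_sum => s _; rewrite subn0.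
Qed.

End Saturation.

(** * Exchanging the generators of B for monomials of a common degree *)

Section FaceGenerators.
Variables (R : realType) (k : fieldType) (d n r : nat).
Variables (b : 'M[int]_(n, d)) (Delta : {set {set 'I_n}}).
Hypothesis hX : smooth_projective_fan R b Delta.
Variable A : 'M[int]_(r, n).
Hypothesis hA : short_exact b A.
Variable c : 'cV[int]_r.
Hypothesis hc : forall i : 'I_n, Ksg A Delta (c - col i A).
Local Notation S := {mpoly k[n]}.
Local Notation deg := (mon_deg A).
Local Notation N := #|Delta|.

Definition face_exp (j : 'I_N) : 'X_{1..n} := [multinom (i \notin enum_val j : nat) | i < n].

Lemma face_genE j : face_gen k (enum_val j) = 'X_[face_exp j] :> S.
Proof.
rewrite /face_gen mprodXE; congr 'X_[_]; apply/mnmP=> i.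
rewrite mnm_sumE mnmE big_mkcond (bigD1 i) //= big1 ?addn0 => [|j' ji].
  by rewrite inE mnm1E eqxx; case: ifP.
by case: ifP => // _; rewrite mnm1E (negbTE ji).
Qed.

Lemma face_exp_eq0 j i : (face_exp j i == 0%N) = (i \in enum_val j).
Proof. by rewrite mnmE eqb0 negbK. Qed.

Variable eta : 'I_N -> 'X_{1..n}.
Hypothesis deg_eta : forall j, deg (eta j) = c *+ n.
Hypothesis eta_eq0 : forall j i, (eta j i == 0%N) = (i \in enum_val j).
Local Notation da := (fun _ : 'I_N => c *+ n).
Local Notation df := (fun j => deg (face_exp j)).

Lemma eta_divides (p : 'cV[int]_r) : exists k0 : nat, forall m, (k0 <= m)%N ->
  forall u, deg u = p + c *+ n *+ m -> exists j, (eta j <= u)%MM.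
Proof.
pose B := (\sum_j \sum_i eta j i)%N.
have [w wP] := deep_degree hX hA hc B.
have [k1 k1P] := Ksg_add_c hX hA hc (p - w).
exists k1 => m km u um.
have N0 : (0 < N)%N by apply/card_gt0P; exists set0; exact: fan_empty hX.
have [n0|n0] := posnP n.
  exists (Ordinal N0); apply/mnm_lepP => i.
  by have := leq_trans (leq_ltn_trans (leq0n i) (ltn_ord i)) (eq_leq n0).
have [|s sD us] := wP (p + c *+ n *+ m) _ u um.
  rewrite addrAC -mulrnA; apply: k1P; apply: leq_trans km _; exact: leq_pmull.
exists (enum_rank_in sD s); apply/mnm_lepP => i.
have [is_|ns] := boolP (i \in s).
  by have /eqP-> : eta (enum_rank_in sD s) i == 0%N by rewrite eta_eq0 enum_rankK_in.
apply: (@leq_trans B).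
  by rewrite /B (bigD1 (enum_rank_in sD s)) //= (bigD1 i) //= -addnA leq_addr.
by rewrite leqNgt; apply: contra ns; apply: us.
Qed.

(** [L.-1] bounds all the exponents of the [eta j], so [eta j] divides the power [L] of the
    squarefree generator; the successor provides the relation [L = M.+1] needed to change
    generators. *)
Let L := (\sum_j \sum_i eta j i).+1%N.

Lemma eta_le_face j i : (eta j i <= face_exp j i * L.-1)%N.
Proof.
rewrite mnmE; case: (boolP (i \in enum_val j)) => is_ /=.
  by move: (eta_eq0 j i); rewrite is_ => /eqP->.
by rewrite mul1n /L /= (bigD1 j) //= (bigD1 i) //= -addnA leq_addr.
Qed.

Lemma face_le_eta j i : (face_exp j i <= eta j i)%N.
Proof.
rewrite mnmE; case: (boolP (i \in enum_val j)) => //= is_.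
by rewrite lt0n eta_eq0.
Qed.

Let up j : 'X_{1..n} := (face_exp j *+ L - eta j)%MM.
Let vp j : 'X_{1..n} := (eta j - face_exp j)%MM.

Lemma upE j : (eta j + up j = face_exp j *+ L)%MM.
Proof.
rewrite /up addmC submK //; apply/mnm_lepP => i; rewrite mulmnE.
by apply: leq_trans (eta_le_face j i) _; rewrite leq_mul2l leq_pred orbT.
Qed.

Lemma vpE j : (face_exp j + vp j = eta j)%MM.
Proof. by rewrite /vp addmC submK //; apply/mnm_lepP => i; exact: face_le_eta. Qed.

Section Ideal.
Variable I : S -> Prop.
Hypothesis iI : is_ideal I.
Let yf (j : 'I_N) : S := 'X_[eta j].
Let ff (j : 'I_N) : S := 'X_[face_exp j].

Lemma Hvan_face_eta m p : Hvan ff df (hpoly A) (hideal A I) m p ->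
  Hvan yf da (hpoly A) (hideal A I) m p.
Proof.
apply: (@Hvan_change_gens _ _ _ _ ff yf (fun j => 'X_[up j]) (fun j => 'X_[vp j]) df da
  (fun j => deg (up j)) (fun j => deg (vp j)) L 1 L.-1).
- exact: gsub_hpoly.
- exact: gsub_hideal.
- exact: gsub_hpoly.
- exact: gsub_hideal.
- exact: gsub_hpoly.
- exact: gsub_hideal.
- exact: gsub_hpoly.
- exact: gsub_hideal.
- by move=> j; rewrite /ff /yf mpolyXn -mpolyXD upE.
- by move=> j; rewrite -(deg_eta j) -mon_degD upE mon_degMn.
- by move=> j; rewrite expr1 /ff /yf -mpolyXD vpE.
- by move=> j; rewrite mulr1n -mon_degD vpE deg_eta.
- move=> j; rewrite /yf !mpolyXn -mpolyXD; congr 'X_[_]; apply/mnmP => i.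
  have := congr1 (fun u : 'X_{1..n} => u i) (upE j); have := congr1 (fun u : 'X_{1..n} => u i) (vpE j).
  rewrite !mnmDE !mulmnE /L /=; nia.
- by rewrite mul1n.
Qed.

Lemma Hvan_eta_face m p : Hvan yf da (hpoly A) (hideal A I) m p ->
  Hvan ff df (hpoly A) (hideal A I) m p.
Proof.
apply: (@Hvan_change_gens _ _ _ _ yf ff (fun j => 'X_[vp j]) (fun j => 'X_[up j]) da df
  (fun j => deg (vp j)) (fun j => deg (up j)) 1 L L.-1).
- exact: gsub_hpoly.
- exact: gsub_hideal.
- exact: gsub_hpoly.
- exact: gsub_hideal.
- exact: gsub_hpoly.
- exact: gsub_hideal.
- exact: gsub_hpoly.
- exact: gsub_hideal.
- by move=> j; rewrite expr1 /ff /yf -mpolyXD vpE.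
- by move=> j; rewrite mulr1n -mon_degD vpE deg_eta.
- by move=> j; rewrite /ff /yf mpolyXn -mpolyXD upE.
- by move=> j; rewrite -(deg_eta j) -mon_degD upE mon_degMn.
- move=> j; rewrite /ff !mpolyXn -mpolyXD; congr 'X_[_]; apply/mnmP => i.
  have := congr1 (fun u : 'X_{1..n} => u i) (upE j); have := congr1 (fun u : 'X_{1..n} => u i) (vpE j).
  rewrite !mnmDE !mulmnE /L /=; nia.
- by rewrite muln1.
Qed.

End Ideal.

(** [Hvan_init] needs all generators in one degree, hence the passage to [eta] and back. *)
Lemma Hvan_init_seq I ls m p : is_ideal I -> stable_filter deg I ->
  Hvan (fun j => 'X_[face_exp j] : S) df (hpoly A) (hideal A (init_seq I ls)) m p ->
  Hvan (fun j => 'X_[face_exp j] : S) df (hpoly A) (hideal A I) m p.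
Proof.
move=> iI hI; have [iJ _ _] := init_seq_ideal ls iI hI.
move=> /(Hvan_face_eta iJ) H; apply: Hvan_eta_face => //.
elim: ls I iI hI {iJ} H => //= l ls IH I iI hI H.
apply: (@Hvan_init k n r A l N eta _ deg_eta (fiber_finite hX hA) eta_divides p I m iI hI).
apply: IH => //; [exact: init_is_ideal|exact: init_stable].
Qed.

End FaceGenerators.

(** * Sorted lists of pairs as Gotzmann sequences *)

Section GotzmannSequence.
Variables (R : realType) (k : fieldType) (d n r : nat).
Variables (b : 'M[int]_(n, d)) (Delta : {set {set 'I_n}}).
Hypothesis hX : smooth_projective_fan R b Delta.
Variable A : 'M[int]_(r, n).
Hypothesis hA : short_exact b A.
Variable c : 'cV[int]_r.
Hypothesis hc : forall i : 'I_n, Ksg A Delta (c - col i A).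
Variables (phi : 'M[int]_r) (hphi : phi \in unitmx) (horth : orthant_in_cone A Delta R phi).
Variables (lt : rel 'X_{1..r}) (hlt : graded_monomial_order lt).
Variable PS : {set 'I_n} -> {mpoly rat[r]}.
Hypothesis hPS : forall tau : {set 'I_n}, ~: tau \in Delta ->
  hilbert_poly A Delta (quot_grading A (I := coord_ideal k tau)) (PS tau).
Variables (prec : rel {set 'I_n}) (hprec : refining_total_order Delta phi lt PS prec).
Variable F : 'cV[int]_r -> seq 'X_{1..n}.
Hypothesis FP : forall q, uniq (F q) /\ forall u, (u \in F q) = (mon_deg A u == q).
Local Notation mpair := ('X_{1..n} * {set 'I_n})%type.
Local Notation x0 := ((0%MM, set0) : mpair).
Local Notation deg := (mon_deg A).

Lemma prec_incl (tau : {set 'I_n}) (i : 'I_n) : i \notin tau -> ~: tau \in Delta ->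
  prec (~: (i |: tau)) (~: tau).
Proof.
move=> it tD.
have rD : ~: (i |: tau) \in Delta by apply: fan_sub hX _ _ _ tD; rewrite setCS subsetUr.
apply: (prec_refines hprec rD tD).
have [u [lu _]] := PS_lead hX hA hc FP hPS hphi horth hlt tD.
have [v [lv _]] := PS_lead hX hA hc FP hPS hphi horth hlt rD.
exists u, v; rewrite !setCK; split=> //.
exact: (PS_lead_lt hX hA hc FP hPS hphi hlt tD it lu lv).
Qed.

(** If [u] came strictly before [v], refinement would give [prec] in the other direction, and
    antisymmetry would identify the two faces. *)
Lemma lead_prec tau rho u v : ~: tau \in Delta -> ~: rho \in Delta ->
  lead_mon lt (lin_change phi (PS tau)) u -> lead_mon lt (lin_change phi (PS rho)) v ->
  prec (~: tau) (~: rho) -> v = u \/ lt v u.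
Proof.
move=> tD rD lu lv tr; have [->|vu] := eqVneq v u; [by left | right].
have [//|luv] := orP (mo_total hlt vu).
have rt : prec (~: rho) (~: tau).
  by apply: (prec_refines hprec rD tD); exists u, v; rewrite !setCK.
have e : tau = rho.
  by apply: setC_inj; apply: (prec_anti hprec) => //; rewrite tr rt.
by case/eqP: vu; move: lv; rewrite -e => lv; exact: (lead_unique hlt lv lu).
Qed.

(** The remainder at index [i] is the sum over the tail from [i] on, and sortedness puts its largest
    leading monomial at the entry [i]. *)
Lemma gotzmann_seq_sorted (s : seq mpair) :
  (forall x, x \in s -> ~: x.2 \in Delta) ->
  (forall i j, (i < j < size s)%N -> prec (~: (nth x0 s i).2) (~: (nth x0 s j).2)) ->
  ((0 < size s)%N -> (nth x0 s 0).1 = 0%MM) ->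
  (forall i, (0 < i < size s)%N -> exists j l,
    [/\ (j < i)%N, prec (~: (nth x0 s j).2) (~: (nth x0 s i).2), l \notin (nth x0 s j).2
      & (nth x0 s i).1 = ((nth x0 s j).1 + U_(l))%MM]) ->
  gotzmann_seq A Delta phi lt PS prec (\sum_(x <- s) translate (deg x.1) (PS x.2)) s.
Proof.
move=> sD srt s0 sp; set P := \sum_(x <- s) _.
have /choice[ld ldP] : forall tau, exists u, ~: tau \in Delta ->
    lead_mon lt (lin_change phi (PS tau)) u /\ 0 < (lin_change phi (PS tau))@_u.
  move=> tau; have [tD|] := boolP (~: tau \in Delta); last by exists 0%MM.
  by have [u uP] := PS_lead hX hA hc FP hPS hphi horth hlt tD; exists u.
have remE i : remainder A PS P s i = \sum_(x <- drop i s) translate (deg x.1) (PS x.2).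
  by rewrite /remainder /P -{1}(cat_take_drop i s) big_cat /= [LHS]addrAC subrr add0r.
split=> //; last by rewrite remE drop_size big_nil.
move=> i si; exists (ld (nth x0 s i).2).
have iD : ~: (nth x0 s i).2 \in Delta by apply: sD; rewrite mem_nth.
rewrite remE (drop_nth x0 si) lin_change_sum.
have [||l1 l2] := @lead_sum _ _ hlt _ (drop i.+1 s)
    (fun x : mpair => lin_change phi (translate (deg x.1) (PS x.2))) (fun x => ld x.2) (nth x0 s i).
- move=> x; rewrite inE => xs.
  have xD : ~: x.2 \in Delta.
    by case/orP: xs => [/eqP->//|/mem_drop/sD].
  have [lx px] := ldP _ xD; rewrite lin_change_translate //.
  by have [? ->] := lead_translate hlt (phi *m deg x.1) lx.
- move=> x xs; have xD : ~: x.2 \in Delta by apply: sD; exact: mem_drop xs.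
  have [lx _] := ldP _ xD; have [li _] := ldP _ iD.
  apply: lead_prec li lx _ => //.
  have /(nthP x0)[j] := xs; rewrite size_drop ltn_subRL nth_drop => js <-.
  by apply: srt; rewrite js andbT addSn ltnS leq_addr.
by split=> //; case: (ldP _ iD).
Qed.

End GotzmannSequence.

Lemma mem_split (T : eqType) (s : seq T) x : x \in s -> exists s1 s2, s = s1 ++ x :: s2.
Proof. by case/splitPr => s1 s2; exists s1, s2. Qed.

(** Going from [x] to predecessors, the degree falls by one at a time down to 0, so [L] contains a
    pair for each of [(mdeg x.1).+1] degrees. *)
Lemma mdeg_lt_undup (n : nat) (L : seq ('X_{1..n} * {set 'I_n})) x :
  (forall y L', L = y :: L' -> y.1 = 0%MM) ->
  (forall L1 y L2, L = L1 ++ y :: L2 -> L1 <> [::] ->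
     exists2 z, z \in L1 & exists l, y.1 = (z.1 + U_(l))%MM) ->
  x \in L -> (mdeg x.1 < size (undup L))%N.
Proof.
move=> head par xL.
have chain m : forall L1 y L2, (size L1 <= m)%N -> L = L1 ++ y :: L2 ->
    forall e, (e <= mdeg y.1)%N -> exists2 z, z \in L & mdeg z.1 = e.
  elim: m => [|m IH] L1 y L2 sz LE e le.
    case: L1 sz LE => // _ LE; exists y; first by rewrite LE inE eqxx.
    by move: le; rewrite (head y L2 LE) mdeg0 leqn0 => /eqP.
  have yL : y \in L by rewrite LE mem_cat inE eqxx orbT.
  have [L10|L10] := eqVneq L1 [::].
    exists y => //; move: le; rewrite (head y L2) ?mdeg0 ?leqn0 => [/eqP//|].
    by rewrite LE L10.
  have [|z zL [l yE]] := par L1 y L2 LE; first exact/eqP.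
  have [->|ne] := eqVneq e (mdeg y.1); first by exists y.
  have [M1 [M2 L1E]] := mem_split zL.
  apply: (IH M1 z (M2 ++ y :: L2)); first by move: sz; rewrite L1E size_cat /= ; lia.
    by rewrite LE L1E -catA.
  move: le ne; rewrite yE mdegD mdeg1; move: (mdeg z.1) => q.
  by rewrite leq_eqVlt addn1 ltnS => /orP[/eqP->|]; rewrite ?eqxx.
have [M1 [M2 LE]] := mem_split xL.
have sub : {subset iota 0 (mdeg x.1).+1 <= [seq mdeg y.1 | y <- undup L]}.
  move=> e; rewrite mem_iota ltnS /= => le; apply/mapP.
  by have [z zL ze] := chain _ M1 x M2 (leqnn _) LE e le; exists z; rewrite ?mem_undup.
by have := uniq_leq_size (iota_uniq 0 _) sub; rewrite size_iota size_map.
Qed.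

Theorem theorem4p11
  (R : realType) (k : fieldType) (d n r : nat) (hr : r = (n - d)%N)
  (b : 'M[int]_(n, d)) (Delta : {set {set 'I_n}})
  (hX : smooth_projective_fan R b Delta)
  (A : 'M[int]_(r, n)) (hA : short_exact b A)
  (e : nat) (cs : 'I_e -> 'cV[int]_r) (hcs : hilbert_basis A Delta cs)
  (phi : 'M[int]_r) (hphi : phi \in unitmx) (horth : orthant_in_cone A Delta R phi)
  (lt : rel 'X_{1..r}) (hlt : graded_monomial_order lt)
  (PS : {set 'I_n} -> {mpoly rat[r]})
  (hPS : forall tau : {set 'I_n}, ~: tau \in Delta ->
     hilbert_poly A Delta (quot_grading A (I := coord_ideal k tau)) (PS tau))
  (prec : rel {set 'I_n}) (hprec : refining_total_order Delta phi lt PS prec)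
  (I : ideal k n) (hI : homog_ideal A I) (hsat : saturated (irrelevant_ideal k Delta) I)
  (c : 'cV[int]_r) (hc : forall i : 'I_n, Ksg A Delta (c - col i A))
  (P : {mpoly rat[r]}) (hP : hilbert_poly A Delta (quot_grading A (I := I)) P)
  (m : nat) (hm : gotzmann_number A Delta phi lt PS prec P m) :
  forall q : 'cV[int]_r,
    (forall sigma : {set 'I_n}, ~: sigma \in Delta ->
       regular A Delta (quot_grading A (I := coord_ideal k sigma)) cs
         (q - (m%:Z - 1) *: c)) ->
    regular A Delta (quot_grading A (I := I)) cs q.
Proof.
have /choice[F FP] := fiber_finite hX hA.
pose deg := mon_deg A; pose K := Ksg A Delta.
pose N := #|Delta|; pose fe : 'I_N -> 'X_{1..n} := @face_exp n Delta.
pose zf (j : 'I_N) : {mpoly k[n]} := 'X_[fe j]; pose df j := deg (fe j).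
have genE : (fun j : 'I_N => face_gen k (enum_val j)) = zf.
  by apply: funext => j; exact: face_genE.
have /choice[eta etaP] : forall j : 'I_N, exists u,
    deg u = c *+ n /\ forall i, (u i == 0%N) = (i \in enum_val j).
  by move=> j; exact: (face_monomial hX hA hc (enum_valP j)).
have deg_eta j : deg (eta j) = c *+ n by case: (etaP j).
have eta_eq0 j i : (eta j i == 0%N) = (i \in enum_val j) by case: (etaP j).
pose II (f : {mpoly k[n]}) := f \in I.
have iI : is_ideal II := ideal_is_ideal I.
have sI : stable_filter deg II by move=> f t; exact: hI.
pose ls := enum 'I_n; pose J := init_seq II ls.
have [iJ sJ lJ'] := init_seq_ideal ls iI sI.
have lJ l : stable_filter (fun u : 'X_{1..n} => u l) J by apply: lJ'; rewrite mem_enum.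
pose Kp (u : 'X_{1..n}) : Prop := J 'X_[u].
have uK : upset Kp by move=> u v Ku; rewrite /Kp addmC mpolyXD; apply: is_idealM.
have JE f : J f <-> supported Kp f.
  split=> [Jf u fu|Kf]; first exact: stable_monomial Jf fu.
  rewrite [f]mpolyE big_seq; apply: big_ind; [exact: is_ideal0|exact: is_idealD|].
  by move=> u; rewrite mcoeff_msupp => /Kf Ku; apply: is_idealZ.
have incl := prec_incl hX hA hc hphi horth hlt hPS hprec FP.
have feD (j : 'I_N) : exists2 sigma, sigma \in Delta & forall i, (fe j i == 0%N) = (i \in sigma).
  by exists (enum_val j); [exact: enum_valP | move=> i; exact: face_exp_eq0].
have [L sL] := stanley_exists k (fan_sub hX) (prec_anti hprec) (prec_trans hprec)
  (prec_total hprec) incl (deep_degree hX hA hc) (fun j => erefl (df j)) feD FP uK.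
(* In deep degrees both sides count the monomials outside [J]: these form a basis of S/I, by passing
   back through the successive initial ideals. *)
have PE : P = \sum_(x <- L) translate (deg x.1) (PS x.2).
  apply/eqP; rewrite -subr_eq0; apply/eqP.
  have [ws1 ws1P] := hP; have [ws2 ws2P] := st_cnt sL.
  have [ws3 ws3P] : exists ws, forall t, deep_for A Delta ws t ->
      ev (\sum_(x <- L) translate (deg x.1) (PS x.2)) t =
      (\sum_(x <- L) cnt F (coord_upset x.2) (t - deg x.1)%R)%N%:R.
    have : forall x, x \in L -> ~: x.2 \in Delta by move=> x /(st_option sL)[].
    elim: {sL ws2P} L => [|x L' IH] xD; first by exists [::] => t _; rewrite !big_nil /ev meval0.
    have [|ws wsP] := IH; first by move=> y yL; apply: xD; rewrite inE yL orbT.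
    have [|ws' ws'P] := PS_cnt FP hPS (tau := x.2); first by apply: xD; rewrite inE eqxx.
    exists (ws ++ [seq w + deg x.1 | w <- ws']) => t /deep_for_cat[t1 /deep_for_shift t2].
    by rewrite !big_cons evD natrD ev_translate ws'P // wsP.
  apply: (@deep_zero _ _ _ _ _ _ hX _ hA _ hc _ (ws1 ++ ws2 ++ ws3)) => t.
  move=> /deep_for_cat[t1 /deep_for_cat[t2 t3]].
  have [M hd] := ws1P t t1; rewrite evB ws3P // -ws2P // {1}/ev => ->.
  rewrite (@has_dim_cnt _ _ _ _ _ FP I Kp t M) ?subrr //.
  apply: (monomial_basis_seq (ls := ls)) => //.
    by move=> u; rewrite mem_filter; have [_ ->] := FP t; case/andP => _ /eqP.
  apply: monomial_basis_mon => // u; rewrite mem_filter; have [_ ->] := FP t; split.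
    by move=> /andP[/asboolP nu /eqP].
  by move=> [-> nu]; rewrite eqxx andbT; apply/asboolP.
have LD x : x \in L -> ~: x.2 \in Delta by move=> /(st_option sL)[].
pose x0 : 'X_{1..n} * {set 'I_n} := (0%MM, set0).
have [|||s [sL_perm s_sorted s_par s_head]] := @sort_with_parents _ x0
    (fun y x => prec (~: y.2) (~: x.2))
    (fun y x => [exists l, (l \notin y.2) && (x.1 == (y.1 + U_(l))%MM)]) L.
- by move=> x y xL yL; apply: (prec_total hprec); apply: LD.
- by move=> y x z yL xL zL; apply: (prec_trans hprec); apply: LD.
- move=> i /andP[i0 iL].
  have LE : L = take i L ++ nth x0 L i :: drop i.+1 L by rewrite -drop_nth // cat_take_drop.
  have [|y yL [py [l ly xE]]] := st_parent sL LE.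
    by move=> /(congr1 size); rewrite size_take iL => sz0; rewrite sz0 in i0.
  have /(nthP x0)[j] := yL; rewrite size_take iL => ji; rewrite nth_take // => yE.
  exists j => //; rewrite yE py /=; apply/existsP; exists l; rewrite ly xE eqxx //.
have gs : gotzmann_seq A Delta phi lt PS prec P s.
  have -> : P = \sum_(x <- s) translate (deg x.1) (PS x.2).
    by rewrite PE; apply: perm_big; rewrite perm_sym.
  apply: (gotzmann_seq_sorted hX hA hc hphi horth hlt hPS hprec FP) => //.
  - by move=> x; rewrite (perm_mem sL_perm) => /LD.
  - move=> s0; rewrite s_head; move: s0; rewrite (perm_size sL_perm).
    by case: (L) (st_head sL) => // y L' h _; exact: (h y L').
  - move=> i is_; have [j ji /andP[pj /existsP[l /andP[lj /eqP xE]]]] := s_par i is_.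
    by exists j, l.
have sm := proj2 hm s gs.
have xm x : x \in L -> (mdeg x.1 < m)%N.
  move=> xL; apply: leq_trans sm; rewrite (perm_size (perm_undup (perm_mem sL_perm))).
  apply: mdeg_lt_undup xL; first exact: st_head sL.
  move=> L1 y L2 LE L10; have [z zL [_ [l _ yE]]] := st_parent sL LE L10.
  by exists z => //; exists l.
move=> q reg.
have vanish i p' : (forall x, x \in L ->
      Hvan zf df (hpoly A) (hideal A (supported (coord_upset x.2))) i.+1 (p' - deg x.1)) ->
    HB_vanishes A Delta (quot_grading A (I := I)) i.+1 p'.
  move=> H; rewrite /HB_vanishes genE; apply: Hvan_cech.
  apply: (Hvan_init_seq hX hA hc deg_eta eta_eq0 (ls := ls)) => //.
  have := st_coh sL H; apply: eq_Hvan => // g x.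
  by split=> -[hx Kx]; split=> //; apply/JE.
split=> [i l p i1 li Kpp|j p _].
  case: i i1 li => // i _ li; apply: vanish => x xL.
  have [reg1 _] := reg _ (LD x xL).
  (* If [m] were 0 there would be no pair [x], so [m] is a successor. *)
  case: m hm sm xm reg reg1 => [|m'] _ _ xm _ reg1; first by have := xm x xL.
  (* The twist by [deg x.1] is traded for the shift by [c *+ m']. The excess lies in K: it is a sum
     of one [c - col i' A] per variable of [x.1], counted with multiplicity, and of [m' - mdeg x.1]
     further copies of [c]. *)
  pose p1 := p + (c *+ m' - deg x.1).
  have Kp1 : K p1.
    apply: KsgD => //; have := xm x xL; rewrite ltnS => le.
    have -> : c *+ m' - deg x.1 = \sum_i (c - col i A) *+ x.1 i + c *+ (m' - mdeg x.1).
      have -> : \sum_i (c - col i A) *+ x.1 i = c *+ mdeg x.1 - deg x.1.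
        by rewrite /deg mon_degE mdegE -sumrMnr -sumrB; apply: eq_bigr => i' _; exact: mulrnBl.
      by rewrite addrAC -mulrnDr subnKC.
    apply: KsgD; first by apply: Ksg_sum => i' _; apply: KsgMn; exact: hc.
    by apply: KsgMn; exact: (Ksg_c hX hA hc).
  have := reg1 i.+1 l p1 isT li Kp1; rewrite /HB_vanishes genE => /cech_Hvan.
  have -> : q - (m'.+1%:Z - 1) *: c - \sum_j cs j *+ l j + p1 = q - \sum_j cs j *+ l j + p - deg x.1.
    have -> : (m'.+1%:Z - 1) *: c = c *+ m'.
      by rewrite (_ : m'.+1%:Z - 1 = m'%:R) ?scaler_nat //; rewrite -addn1 PoszD addrK natz.
    by rewrite /p1 [q - c *+ m' - _]addrAC [p + _]addrCA [LHS]addrA subrK addrA.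
  apply: eq_Hvan => // g y; split=> -[hy Ky]; split=> //; exact/coord_idealP.
rewrite /HB_vanishes genE; apply: Hvan_cech => a x Gx Zx.
(* A cocycle in degree 0 is an element multiplied into [I] by the power [a] of every generator of B,
   so saturation places it in [I]. *)
have xI : x set0 \in I.
  apply: (saturated_mem (a := a) (fan_empty hX) hsat) => sigma sD.
  pose j0 : 'I_N := enum_rank_in sD sigma.
  have [|_] := Zx [set j0]; first by rewrite cards1.
  rewrite /kdiff big_set1 setDv.
  move=> /(is_idealM iI (ksign _ j0 [set j0])).
  rewrite [X in II X]mulrA (ksignK {mpoly k[n]} j0 [set j0]) mul1r.
  by rewrite -(face_genE k) /j0 enum_rankK_in.
exists 0%N, (fun=> 0); split=> // J0 /cards0_eq->.
rewrite /kdiff big_set0 subr0 expr0 mul1r addn0; split=> //.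
by apply: Gx; rewrite cards0.
Qed.
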